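(* Let $E\subset\mathbb{R}^n$ be such that $\operatorname{Per}_s(E,\Omega)<\infty$. Then $E$ is $s$-minimal in $\Omega$ if and only if $\chi_E$ is a weak solution of $(-\Delta)_1^s\chi_E=0$ in $\Omega$.
   Context: Throughout, $\Omega\subset\mathbb{R}^n$ is a bounded open set with Lipschitz boundary, $s\in(0,1)$, $\mathcal{C}\Omega:=\mathbb{R}^n\setminus\Omega$, $Q(\Omega):=\mathbb{R}^{2n}\setminus(\mathcal{C}\Omega)^2$, and $E$ is measurable with characteristic function $\chi_E$. The $s$-perimeter is $$\operatorname{Per}_s(E,\Omega):=\frac12\iint_{Q(\Omega)}\frac{|\chi_E(x)-\chi_E(y)|}{|x-y|^{n+s}}\,dx\,dy.$$ $E$ is $s$-minimal in $\Omega$ if $\operatorname{Per}_s(E,\Omega)<\infty$ and $\operatorname{Per}_s(E,\Omega)\le\operatorname{Per}_s(F,\Omega)$ for any (measurable) $F\subset\mathbb{R}^n$ with $F\setminus\Omega=E\setminus\Omega$. $\mathcal{W}^{s,1}_0(\Omega)$ is the set of measurable $w:\mathbb{R}^n\to\mathbb{R}$ with $w=0$ a.e. in $\mathcal{C}\Omega$, $w\in L^1(\Omega)$ and $\int_\Omega\int_\Omega\frac{|w(x)-w(y)|}{|x-y|^{n+s}}\,dx\,dy<\infty$. A measurable $u:\mathbb{R}^n\to\mathbb{R}$ is a weak solution of $(-\Delta)_1^su=0$ in $\Omega$ if there exists $\mathbf{z}\in L^\infty(Q(\Omega))$ with $\|\mathbf{z}\|_{L^\infty(Q(\Omega))}\le1$,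 $\mathbf{z}(x,y)=-\mathbf{z}(y,x)$, $$\iint_{Q(\Omega)}\frac{\mathbf{z}(x,y)}{|x-y|^{n+s}}(w(x)-w(y))\,dx\,dy=0\quad\text{for all }w\in\mathcal{W}^{s,1}_0(\Omega),$$ and $\mathbf{z}(x,y)(u(x)-u(y))=|u(x)-u(y)|$ for a.e. $(x,y)\in Q(\Omega)$. *)

(* Defs.v *)
From HB Require Import structures.
From mathcomp Require Import all_boot all_order all_algebra.
From mathcomp Require Import all_classical all_reals all_analysis.
From mathcomp Require Import measurable_realfun ess_sup_inf.

Set Implicit Arguments.
Unset Strict Implicit.
Unset Printing Implicit Defensive.

Import Order.TTheory GRing.Theory Num.Theory.
Import numFieldNormedType.Exports.

Local Open Scope classical_set_scope.
Local Open Scope ring_scope.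

(** * Borel sigma-algebra and Lebesgue measure on R^n

   Points of R^n are row vectors ['rV[R]_n], which already carry the topology of
   R^n but no sigma-algebra or measure. *)

Definition measure_rV_display : measure_display -> measure_display.
Proof. exact. Qed.

Section measurable_rV.
Context {R : realType} (n : nat).

Definition coord_rV (i : 'I_n) (x : 'rV[R]_n) : R := x ord0 i.

Let rV_set0 : g_sigma_preimage coord_rV set0.
Proof. exact: sigma_algebra0. Qed.

Let rV_setC A : g_sigma_preimage coord_rV A -> g_sigma_preimage coord_rV (~` A).
Proof. exact: sigma_algebraC. Qed.

Let rV_bigcup (F : (set 'rV[R]_n)^nat) :
  (forall i, g_sigma_preimage coord_rV (F i)) ->
  g_sigma_preimage coord_rV (\bigcup_i (F i)).
Proof. exact: sigma_algebra_bigcup. Qed.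

(* The product sigma-algebra, i.e., the Borel sets of R^n. *)
HB.instance Definition _ :=
  @isMeasurable.Build (measure_rV_display default_measure_display)
    'rV[R]_n (g_sigma_preimage coord_rV) rV_set0 rV_setC rV_bigcup.

End measurable_rV.

Section lebesgue_rV.
Context {R : realType}.

Definition consrV n (p : measurableTypeR R * 'rV[R]_n) : 'rV[R]_n.+1 :=
  \row_i oapp (p.2 ord0) p.1 (unlift ord0 i).

Definition headrV n (x : 'rV[R]_n.+1) : R := x ord0 ord0.

Definition tailrV n (x : 'rV[R]_n.+1) : 'rV[R]_n :=
  \row_i x ord0 (lift ord0 i).

Lemma headrV_cons n p : headrV (@consrV n p) = p.1.
Proof. by rewrite /headrV mxE unlift_none. Qed.

Lemma tailrV_cons n p : tailrV (@consrV n p) = p.2.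
Proof. by apply/rowP => i; rewrite !mxE liftK. Qed.

Lemma measurable_coord_rV n i : measurable_fun setT (@coord_rV R n i).
Proof.
move=> _ Y mY; rewrite setTI; apply: sub_sigma_algebra => /=.
rewrite -bigcup_seq/=; exists i => /=; first by rewrite mem_index_enum.
by exists Y => //; rewrite setTI.
Qed.

Lemma measurable_fun_rVP d (T : measurableType d) n (f : T -> 'rV[R]_n) :
  measurable_fun setT f <->
  forall i, measurable_fun setT (fun x => f x ord0 i).
Proof.
split=> [mf i|mf].
  exact: (measurableT_comp (measurable_coord_rV i) mf).
apply: (@iffRL _ (g_sigma_preimage
    (fun i => @coord_rV R n i \o f) `<=` measurable)).
  rewrite g_sigma_preimage_comp; split=> [mg A [/= C preC <-]|prefS].
    exact: mg.
  by move=> _ A mA; apply: prefS; exists A.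
apply: smallest_sub; first exact: sigma_algebra_measurable.
rewrite -bigcup_seq; apply: bigcup_sub => i _.
by move=> A [B mB <-]; exact: mf.
Qed.

Lemma measurable_consrV n : measurable_fun setT (@consrV n).
Proof.
apply/measurable_fun_rVP => i.
case: (unliftP ord0 i) => [j ->|->].
  rewrite [X in measurable_fun _ X](_ : _ = @coord_rV R n j \o snd); last first.
    by apply/funext => p; rewrite /= mxE liftK.
  exact: (measurableT_comp (measurable_coord_rV j) measurable_snd).
rewrite [X in measurable_fun _ X](_ : _ = fst); last first.
  by apply/funext => p; rewrite /= mxE unlift_none.
exact: measurable_fst.
Qed.

Lemma measurable_tailrV n : measurable_fun setT (@tailrV n).
Proof.
apply/measurable_fun_rVP => i.
rewrite [X in measurable_fun _ X](_ : _ = @coord_rV R n.+1 (lift ord0 i)).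
  exact: measurable_coord_rV.
by apply/funext => x; rewrite mxE.
Qed.

Local Open Scope ereal_scope.

Section step.
Context n (mu : {sigma_finite_measure set 'rV[R]_n -> \bar R}).

Definition lebesgue_rVS : set 'rV[R]_n.+1 -> \bar R :=
  pushforward (@lebesgue_measure R \x mu) (@consrV n).

Let pf : {measure set 'rV[R]_n.+1 -> \bar R} :=
  measure_function_pushforward__canonical__measure_function_Measure
    (@lebesgue_measure R \x mu)%E (@measurable_consrV n).

Let lebesgue_rVS0 : lebesgue_rVS set0 = 0.
Proof. exact: (measure0 pf). Qed.

Let lebesgue_rVS_ge0 A : 0 <= lebesgue_rVS A.
Proof. exact: (measure_ge0 pf). Qed.

Let lebesgue_rVS_sigma_additive : semi_sigma_additive lebesgue_rVS.
Proof. exact: (@measure_semi_sigma_additive _ _ _ pf). Qed.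

HB.instance Definition _ := isMeasure.Build _ _ _ lebesgue_rVS
  lebesgue_rVS0 lebesgue_rVS_ge0 lebesgue_rVS_sigma_additive.

Lemma lebesgue_rVSE (A : set R) (B : set 'rV[R]_n) :
  measurable A -> measurable B ->
  lebesgue_rVS [set x | A (headrV x) /\ B (tailrV x)] = lebesgue_measure A * mu B.
Proof.
move=> mA mB; rewrite /lebesgue_rVS /pushforward -product_measure1E//.
congr product_measure1; apply/funext => p /=.
by rewrite headrV_cons tailrV_cons.
Qed.

Let lebesgue_rVS_sigma_finite : sigma_finite setT lebesgue_rVS.
Proof.
have /sigma_finiteP[F [TF ndF Foo]] := sigma_finiteT (@lebesgue_measure R).
have /sigma_finiteP[G [TG ndG Goo]] := sigma_finiteT mu.
exists (fun k => [set x | F k (headrV x) /\ G k (tailrV x)]).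
  apply/seteqP; split=> [x _|x _]//.
  have : (\bigcup_k F k) (headrV x) by rewrite -TF.
  have : (\bigcup_k G k) (tailrV x) by rewrite -TG.
  move=> [k _ Gk] [j _ Fj]; exists (maxn k j) => //; split.
  - by move: Fj; exact/subsetPset/ndF/leq_maxr.
  - by move: Gk; exact/subsetPset/ndG/leq_maxl.
move=> k; have [mF Fk] := Foo k; have [mG Gk] := Goo k; split.
  apply: measurableI.
  - by rewrite -[X in measurable X]setTI; apply: measurable_coord_rV.
  - by rewrite -[X in measurable X]setTI; apply: measurable_tailrV.
by rewrite lebesgue_rVSE// lte_mul_pinfty// ge0_fin_numE.
Qed.

HB.instance Definition _ := Measure_isSigmaFinite.Build _ _ _ lebesgue_rVS
  lebesgue_rVS_sigma_finite.

End step.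

Fixpoint lebesgue_rV n : {sigma_finite_measure set 'rV[R]_n -> \bar R} :=
  match n with
  | 0 => \d_(0%R : 'rV[R]_0)
  | n'.+1 => lebesgue_rVS (lebesgue_rV n')
  end.

(* This property characterizes the Lebesgue measure on Borel sets. *)
Lemma lebesgue_rV_box n (A : 'I_n -> set R) : (forall i, measurable (A i)) ->
  lebesgue_rV n [set x | forall i, A i (x ord0 i)] =
  \prod_(i < n) lebesgue_measure (A i).
Proof.
elim: n A => [|n ih] A mA.
  by rewrite big_ord0 /= diracE mem_set// => -[].
rewrite big_ord_recl -ih//= -lebesgue_rVSE//; last first.
  rewrite [X in measurable X](_ : _ =
      \bigcap_(i in [set: 'I_n]) (@coord_rV R n i @^-1` A (lift ord0 i))).
    apply: fin_bigcap_measurable => // i _.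
    by rewrite -[X in measurable X]setTI; exact: measurable_coord_rV.
  by apply/seteqP; split=> x /= h i; [move=> _; exact: h|exact: (h i I)].
congr (lebesgue_rVS _ _); apply/seteqP; split=> x /= => [h|[h0 h] i].
  by split=> [|i]; [exact: h|rewrite mxE; exact: h].
by case: (unliftP ord0 i) => [j ->|-> //]; have := h j; rewrite mxE.
Qed.

End lebesgue_rV.

(** * Lebesgue measurability

   The sigma-algebras above are Borel; Lebesgue measurability is measurability
   for the completed sigma-algebra.  The integral [\int[mu]_(x in D) f x] is
   defined for every function, as the difference of the suprema of the integrals
   of the Borel simple functions below the positive and the negative parts; on
   Lebesgue measurable functions, this is the usual Lebesgue integral.  By the
   convention [+oo - +oo = -oo] a null integral entails integrability. *)

Section lebesgue_measurability.
Context d {T : measurableType d} {R : realType}.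
Variable mu : {measure set T -> \bar R}.

Definition Lmeasurable (A : set T) : Prop :=
  (completed_algebra_gen mu).-sigma.-measurable A.

Definition Lmeasurable_fun (D : set T) (f : T -> R) : Prop :=
  measurable_fun (D : set (g_sigma_algebraType (completed_algebra_gen mu))) f.

End lebesgue_measurability.

Section fractional_perimeter.
Context {R : realType}.

(* The norm [`| x |] on row vectors is the sup norm. *)
Definition enorm n (x : 'rV[R]_n) : R := Num.sqrt (\sum_i x ord0 i ^+ 2).

(* In suitable Cartesian coordinates (given by the orthogonal matrix [O]), the
   set is, near each of its boundary points, the strict epigraph of a Lipschitz
   function.  The coordinate that is a function of the others is the first one. *)
Definition lipschitz_boundary n (Omega : set 'rV[R]_n.+1) : Prop :=
  forall x0, (closure Omega `\` interior Omega) x0 ->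
  exists (O : 'M[R]_n.+1) (g : 'rV[R]_n -> R),
    [/\ O *m O^T = 1%:M, lipschitz g &
        \forall x \near x0,
          Omega x <-> g (tailrV (x *m O)) < headrV (x *m O)].

Context {n : nat}.
Implicit Types (s : R) (Omega E F : set 'rV[R]_n) (u w : 'rV[R]_n -> R).

Local Notation leb := (@lebesgue_rV R n).
Local Notation leb2 := (leb \x leb)%E.

Definition frac_kernel s (p : 'rV[R]_n * 'rV[R]_n) : R :=
  (enorm (p.1 - p.2) `^ (n%:R + s))^-1.

Definition crossQ Omega : set ('rV[R]_n * 'rV[R]_n) :=
  ~` (~` Omega `*` ~` Omega).

Definition s_perimeter s E Omega : \bar R :=
  (2^-1%:E * \int[leb2]_(p in crossQ Omega)
    (`|\1_E p.1 - \1_E p.2| * frac_kernel s p)%:E)%E.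

Definition s_minimal s E Omega : Prop :=
  (s_perimeter s E Omega < +oo)%E /\
  forall F, Lmeasurable leb F -> F `\` Omega = E `\` Omega ->
    (s_perimeter s E Omega <= s_perimeter s F Omega)%E.

Definition W0s1 s Omega w : Prop :=
  [/\ Lmeasurable_fun leb setT w,
      {ae leb, forall x, (~` Omega) x -> w x = 0},
      (\int[leb]_(x in Omega) `|w x|%:E < +oo)%E &
      (\int[leb2]_(p in Omega `*` Omega)
        (`|w p.1 - w p.2| * frac_kernel s p)%:E < +oo)%E].

(* Elements of [L^oo(Q)] are classes of functions: the antisymmetry holds
   almost everywhere. *)
Definition frac_one_laplace_weak_solution s Omega u : Prop :=
  Lmeasurable_fun leb setT u /\
  exists z : 'rV[R]_n * 'rV[R]_n -> R,
    [/\ Lmeasurable_fun leb2 (crossQ Omega) z,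
        (Lnorm leb2 +oo (EFin \o (z \_ (crossQ Omega))) <= 1)%E,
        {ae leb2, forall p, crossQ Omega p -> z p = - z (p.2, p.1)},
        (forall w, W0s1 s Omega w ->
          \int[leb2]_(p in crossQ Omega)
            (z p * frac_kernel s p * (w p.1 - w p.2))%:E = 0)%E &
        {ae leb2, forall p, crossQ Omega p ->
          z p * (u p.1 - u p.2) = `|u p.1 - u p.2|}].

End fractional_perimeter.

(* Main.v *)
Require Import Defs.
From HB Require Import structures.
From mathcomp Require Import all_boot all_order all_algebra.
From mathcomp Require Import all_classical all_reals all_analysis.
From mathcomp Require Import measurable_realfun ess_sup_inf.
From mathcomp Require Import ring lra.

(** Let [Q] be the set of pairs of points that are not both outside [Omega], and
    call energy of a function [u] the integral over [Q] of [`|u x - u y|] against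
    the kernel: the energy of [\1_E] is twice the perimeter of [E].

    If [\1_E] is a weak solution, the field [z] is a calibration.  A competitor
    [F] of finite perimeter gives the admissible test function [\1_F - \1_E], so
    that [z] pairs equally with the differences of [\1_E] and of [\1_F].  The
    first pairing is the energy of [E], and the second is at most the energy of
    [F] because [`|z| <= 1] ([weak_solution_s_minimal]).

    Conversely, let [E] be minimal.  By a layer-cake decomposition, [\1_E] also
    minimizes the energy among the functions [\1_E + w] with [w] vanishing
    outside [Omega] ([minimal_energy_le]).  The energy is the [L^1] norm of a
    linear expression in the function, its [flow].  Minimality says exactly that
    the functional which sends the flow of [\1_E] to the energy of [E] and the
    flows of the test functions to zero is dominated by the [L^1] norm on the
    span of these flows ([calibration_graph_dominated]).  It extends to [L^1] by
    the Hahn-Banach theorem ([hahn_banach]), and the extension is the integral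
    against a function [z] with [`|z| <= 1] because the dual of [L^1] of a
    sigma-finite measure is [L^oo] ([L1_dual], from the Radon-Nikodym theorem).
    Equality in [z * flow \1_E <= `|flow \1_E|] gives the pointwise condition
    ([calibration_ae]), and antisymmetrizing [z] completes the proof
    ([s_minimal_weak_solution]).

    The functional can only be evaluated at the test functions whose flow is
    integrable on the whole of [Q], whereas the definition of [W0s1] only
    controls the flow on [Omega * Omega].  The gap is filled by a fractional Hardy
    inequality ([fractional_hardy]), which rests on the Lipschitz boundary and on
    [s < 1]: the interaction of a point [x] of [Omega] with the complement is at
    most of the order of the [- s] power of its distance to the boundary, and the
    integral of [w] with this weight is bounded by comparing [w] at [x] with averages of [w] over points farther
    from the boundary ([average_bound], [layer_integral_le]).

    Sets and functions are only Lebesgue measurable, while Tonelli's theorem is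
    about Borel functions on the product space; they are therefore replaced by
    Borel representatives, which changes no integral ([integral_ae_eq_fun],
    [Lmeasurable_fun_borel]). *)

Set Implicit Arguments.
Unset Strict Implicit.
Unset Printing Implicit Defensive.

Import Order.TTheory GRing.Theory Num.Theory.
Import numFieldNormedType.Exports.

Local Open Scope classical_set_scope.
Local Open Scope ring_scope.

(** * Lebesgue measure on R^n *)

Lemma measurable_funV d (T : measurableType d) (R : realType) (f : T -> R) :
  measurable_fun setT f -> measurable_fun setT (fun x => (f x)^-1).
Proof.
move=> mf; apply: (measurableT_comp (f := fun x : R => x^-1)) => //.
have E : [set x : R | x != 0] = ~` [set 0].
  by apply/seteqP; split => x /= /eqP.
rewrite -(setUv [set (0 : R)]); apply/measurable_funU => //.
  exact: measurableC.
split; first exact: measurable_fun_set1.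
rewrite -E; apply: open_continuous_measurable_fun.
  by rewrite E; apply: closed_openC; exact: closed_eq.
by move=> x; rewrite inE /= => x0; exact: inv_continuous.
Qed.

Lemma measurable_set_lt d (T : measurableType d) (R : realType) (f g : T -> R) :
  measurable_fun setT f -> measurable_fun setT g ->
  measurable [set x | f x < g x].
Proof.
move=> mf mg.
rewrite (_ : [set x | _] = (fun x => g x - f x) @^-1` `]0, +oo[%classic).
  by rewrite -[X in measurable X]setTI; apply: measurable_funB.
by apply/seteqP; split => x /=; rewrite in_itv /= andbT subr_gt0.
Qed.

Lemma measurable_set_le d (T : measurableType d) (R : realType) (f g : T -> R) :
  measurable_fun setT f -> measurable_fun setT g ->
  measurable [set x | f x <= g x].
Proof.
move=> mf mg; rewrite (_ : [set x | _] = ~` [set x | g x < f x]).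
  by apply: measurableC; exact: measurable_set_lt.
by apply/seteqP; split => x /=; rewrite leNgt => /negP.
Qed.

Section rV_measure.
Context {R : realType}.

Lemma ball_rVP n (x y : 'rV[R]_n) (e : R) : 0 < e ->
  ball x e y <-> forall i, `|x ord0 i - y ord0 i| < e.
Proof.
by move=> e0; split => [[_ h] i|h]; [exact: h|split => // i j; rewrite (ord1 i); exact: h].
Qed.

Lemma measurable_ball_rV n (x : 'rV[R]_n) (e : R) : measurable (ball x e).
Proof.
have [e0|e0] := ltP 0 e; last first.
  rewrite (_ : ball x e = set0)//; apply/seteqP; split => // y [+ _].
  by rewrite ltNge e0.
rewrite (_ : ball x e = \bigcap_(i in [set: 'I_n])
    (@coord_rV R n i @^-1` ball (x ord0 i) e)).
  apply: fin_bigcap_measurable => // i _.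
  rewrite -[X in measurable X]setTI; apply: measurable_coord_rV => //.
  exact: measurable_ball.
apply/seteqP; split => y /=; first by move=> /ball_rVP h i _; exact: h.
by move=> h; apply/ball_rVP => // i; exact: h.
Qed.

(** The sigma-algebra is generated by the coordinates; an open set is the
    union of the countably many balls with rational centre and radius [1 / k]
    that it contains. *)
Lemma open_measurable_rV n (U : set 'rV[R]_n) : open U -> measurable U.
Proof.
move=> oU.
pose B (p : 'rV[rat]_n * nat) := ball (map_mx (@ratr R) p.1) (p.2.+1%:R^-1 : R).
rewrite (_ : U = \bigcup_(p in [set p | B p `<=` U]) B p).
  rewrite bigcup_mkcond; apply: countable_bigcupT_measurable => [|p].
    exact: countableP.
  by case: ifPn => // _; exact: measurable_ball_rV.
apply/seteqP; split; last by move=> x [p pU Bx]; exact: pU.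
move=> x Ux.
have /nbhs_ballP[e /= e0 eU] : nbhs x U by exact: open_nbhs_nbhs.
have [k k0 /= ke] : exists2 k : nat, (0 < k)%N & (2 * k%:R^-1 < e).
  have := near_infty_natSinv_lt (PosNum (divr_gt0 e0 (@ltr0n R 2))).
  case=> k _ /(_ _ (leqnn k)) /= h; exists k.+1 => //.
  by rewrite mulrC -ltr_pdivlMr.
have k0' : 0 < (k%:R^-1 : R) by rewrite invr_gt0 ltr0n.
have /choice[q qP] : forall i : 'I_n, exists q : rat,
    x ord0 i - k%:R^-1 < ratr q < x ord0 i + k%:R^-1.
  move=> i; have [|q] := @rat_in_itvoo R (x ord0 i - k%:R^-1) (x ord0 i + k%:R^-1).
    by lra.
  by rewrite in_itv /= => h; exists q.
have xB : ball (map_mx (@ratr R) (\row_i q i)) (k%:R^-1 : R) x.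
  apply/ball_rVP => // j; rewrite !mxE ltr_norml.
  by move: (k%:R^-1) (qP j) => c /andP[h1 h2]; apply/andP; split; lra.
exists (\row_i q i, k.-1); last by rewrite /B /= prednK.
rewrite /= /B /= prednK// => y yB; apply: eU.
apply: (@le_ball _ _ x (k%:R^-1 + k%:R^-1)); first by move: ke; rewrite mulr_natl mulr2n => /ltW.
by apply: ball_triangle yB; exact: ball_sym.
Qed.

Lemma continuous_measurable_rV n (f : 'rV[R]_n -> R) :
  continuous f -> measurable_fun setT f.
Proof.
move=> /continuousP cf.
apply: (measurability _ (RGenOpens.measurableE R)) => // _ [_ [a [b ->] <-]].
by rewrite setTI; apply: open_measurable_rV; apply: cf; exact: interval_open.
Qed.

(** Lebesgue measure is the only measure giving intervals their length, and
    its translates give intervals the same length. *)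
Lemma lebesgue_measure_shift (a : R) (A : set R) : measurable A ->
  lebesgue_measure ((fun x => x + a) @^-1` A) = lebesgue_measure A.
Proof.
move=> mA.
have mf : measurable_fun [set: measurableTypeR R]
    (fun x : measurableTypeR R => x + a : measurableTypeR R).
  by apply: measurable_funD.
pose pf : {measure set (measurableTypeR R) -> \bar R} :=
  measure_function_pushforward__canonical__measure_function_Measure
    (@lebesgue_measure R) mf.
apply/esym; rewrite (@lebesgue_measure_unique _ pf)// => _ [[b c]] _ <-.
rewrite /= /pushforward.
rewrite [X in _ = _ X](_ : _ = `]b - a, c - a]%classic); last first.
  by apply/seteqP; split => x /=; rewrite !in_itv /= => /andP[h1 h2];
    apply/andP; split; lra.
rewrite !lebesgue_measure_itv/= !lte_fin ltrD2r; case: ifPn => //.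
by rewrite -!EFinD => _; congr EFin; lra.
Qed.

Lemma measurable_shift_rV n (a : 'rV[R]_n) :
  measurable_fun setT (fun x : 'rV[R]_n => x + a).
Proof.
apply/measurable_fun_rVP => i.
rewrite [X in measurable_fun _ X](_ : _ = fun x => coord_rV i x + a ord0 i).
  by apply: measurable_funD => //; exact: measurable_coord_rV.
by apply/funext => x; rewrite mxE.
Qed.

Lemma lebesgue_rV_shift n (a : 'rV[R]_n) (A : set 'rV[R]_n) : measurable A ->
  lebesgue_rV n ((fun x => x + a) @^-1` A) = lebesgue_rV n A.
Proof.
elim: n a A => [|n ih] a A mA.
  by congr (_ _); apply/seteqP; split => x /=; rewrite !(thinmx0 _) // (thinmx0 a).
pose phi (p : measurableTypeR R * 'rV[R]_n) : measurableTypeR R * 'rV[R]_n :=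
  (p.1 + headrV a, p.2 + tailrV a).
have mphi : measurable_fun setT phi.
  apply/measurable_fun_pairP; split.
    by apply: measurable_funD.
  by apply: (measurableT_comp (measurable_shift_rV _)).
pose pf : {measure set _ -> \bar R} :=
  measure_function_pushforward__canonical__measure_function_Measure
    (@lebesgue_measure R \x lebesgue_rV n)%E mphi.
have mc : measurable (@consrV R n @^-1` A).
  by rewrite -[X in measurable X]setTI; exact: measurable_consrV.
rewrite /= /lebesgue_rVS /pushforward.
rewrite [RHS](product_measure_unique (m' := pf)) //=.
  rewrite /pushforward; congr (product_measure1 _ _ _).
  apply/funext => -[r x] /=; congr A; apply/rowP => i.
  rewrite !mxE /=; case: (unliftP ord0 i) => [j ->|->].
    by rewrite /= !mxE.
  by [].
move=> B C mB mC; rewrite /pushforward.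
rewrite [X in product_measure1 _ _ X](_ : _ =
   ((fun x => x + headrV a) @^-1` B) `*` ((fun x => x + tailrV a) @^-1` C)) //.
rewrite product_measure1E//=.
- by rewrite ih// lebesgue_measure_shift.
- rewrite -[X in measurable X]setTI.
  have h : measurable_fun [set: measurableTypeR R]
    (fun x : measurableTypeR R => x + headrV a : measurableTypeR R).
    by apply: measurable_funD.
  exact: h.
- by rewrite -[X in measurable X]setTI; exact: measurable_shift_rV.
Qed.

Lemma lebesgue_rV_ball n (x : 'rV[R]_n) (r : R) : 0 < r ->
  lebesgue_rV n (ball x r) = ((2 * r) ^+ n)%:E.
Proof.
move=> r0.
rewrite (_ : ball x r = [set y | forall i, ball (x ord0 i) r (y ord0 i)]); last first.
  by apply/seteqP; split => y /=; move/(ball_rVP _ _ r0).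
rewrite (lebesgue_rV_box (A := fun i => ball (x ord0 i) r)); last by move=> i; exact: measurable_ball.
under eq_bigr do rewrite (lebesgue_measure_ball _ (ltW r0)).
by rewrite prodEFin prodr_const card_ord mulr_natl.
Qed.

End rV_measure.

(** * Null sets, completion and product measures *)

Section null_sets.
Context d (T : measurableType d) (R : realType).
Variable mu : {measure set T -> \bar R}.

Import HBNNSimple.

(** The integral of an arbitrary nonnegative function is the supremum of the
    integrals of the simple functions below it, and such simple functions can
    be set to zero on the exceptional null set. *)
Lemma integral_le_ae (f g : T -> \bar R) : (forall x, 0 <= f x)%E ->
  (forall x, 0 <= g x)%E -> {ae mu, forall x, f x = g x} ->
  (\int[mu]_x f x <= \int[mu]_x g x)%E.
Proof.
move=> f0 g0 [N [mN N0 fgN]].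
rewrite !ge0_integralTE//; apply: ge_ereal_sup => /= _ [h hf <-].
pose k := proj_nnsfun h (measurableC mN).
have kE x : ~ N x -> k x = h x.
  by move=> xN; rewrite /k -mrestrict patchE ifT// inE.
rewrite (_ : sintegral mu h = sintegral mu k).
  apply: ereal_sup_ubound => /=; exists k => // x.
  rewrite /k -mrestrict patchE; case: ifPn => [xN|_]; last exact: g0.
  apply: (le_trans (hf x)); suff -> : f x = g x by [].
  by apply: contrapT => fgx; move: xN; rewrite inE; apply; exact: fgN.
rewrite -!integralT_nnsfun; apply: ge0_ae_eq_integral => //.
- by apply/measurable_EFinP.
- by apply/measurable_EFinP.
- by move=> x _; rewrite lee_fin.
- by move=> x _; rewrite lee_fin.
- exists N; split => // x hk; apply: contrapT => xN; apply: hk => _.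
  by rewrite kE.
Qed.

(** This is what allows a Lebesgue measurable function to be replaced by a
    Borel representative under every integral. *)
Lemma integral_ae_eq_fun (D : set T) (f g : T -> \bar R) :
  {ae mu, forall x, D x -> f x = g x} ->
  (\int[mu]_(x in D) f x = \int[mu]_(x in D) g x)%E.
Proof.
move=> fg.
have fgD : {ae mu, forall x, (f \_ D) x = (g \_ D) x}.
  apply: filterS fg => x h; rewrite !patchE; case: ifPn => //.
  by rewrite inE => /h.
rewrite integral_mkcond [RHS]integral_mkcond integralE [RHS]integralE.
by congr (_ - _)%E; apply/eqP; rewrite eq_le; apply/andP; split;
  apply: integral_le_ae => //; apply: filterS fgD => x; rewrite ?funeposE ?funenegE => ->.
Qed.

(** The sets squeezed between a Borel set and that Borel set enlarged by a null
    set form a sigma-algebra, which contains the generators of the completion. *)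
Lemma Lmeasurable_borel (A : set T) : Lmeasurable mu A ->
  exists B N, [/\ measurable B, measurable N, mu N = 0%E &
    B `<=` A /\ A `<=` B `|` N].
Proof.
pose C := [set A : set T | exists B N, [/\ measurable B, measurable N,
  mu N = 0%E & B `<=` A /\ A `<=` B `|` N]].
rewrite /Lmeasurable => mA; suff : C A by [].
move: A mA; apply: smallest_sub; last first.
  move=> _ [B mB [N [M [mM M0 NM]] <-]]; exists B, M; split => //.
  by split => [x|x [|/NM]]; [left|left|right].
split.
- by exists set0, set0; split => //; split => // x [].
- move=> A [B [N [mB mN N0 [BA ABN]]]]; rewrite setTD.
  exists (~` (B `|` N)), N; split => //; first exact/measurableC/measurableU.
  split=> [x /= BN Ax|x /= nAx]; first exact: BN (ABN _ Ax).
  by have [|?] := pselect (N x); [right|left => -[/BA|]].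
- move=> A /choice[B /choice[N h]].
  exists (\bigcup_k B k), (\bigcup_k N k); split.
  + by apply: bigcup_measurable => k _; have [] := h k.
  + by apply: bigcup_measurable => k _; have [] := h k.
  + apply/negligibleP; first by apply: bigcup_measurable => k _; have [] := h k.
    by apply: negligible_bigcup => k; apply/negligibleP; have [] := h k.
  + split => x [k _]; have [_ _ _ [BA ABN]] := h k; first by move/BA; exists k.
    by move/ABN => [?|?]; [left|right]; exists k.
Qed.

Lemma Lmeasurable_of_measurable (A : set T) : measurable A -> Lmeasurable mu A.
Proof.
move=> mA; apply: sub_sigma_algebra; exists A => //; exists set0.
  exact: negligible_set0.
by rewrite setU0.
Qed.

Lemma Lmeasurable_fun_of_measurable (D : set T) (f : T -> R) :
  measurable_fun D f -> measurable D -> Lmeasurable_fun mu D f.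
Proof.
by move=> mf mD _ Y mY; apply: Lmeasurable_of_measurable; exact: mf.
Qed.

(** Off a single null set [M], the preimages of the countably many rational
    rays are Borel; hence [f], set to zero outside of [D] minus [M], is Borel. *)
Lemma Lmeasurable_fun_borel (D : set T) (f : T -> R) : measurable D ->
  Lmeasurable_fun mu D f ->
  exists g, measurable_fun setT g /\ {ae mu, forall x, D x -> g x = f x}.
Proof.
move=> mD mf.
(* [unpickle] enumerates the rationals; other values of [k] give [0]. *)
pose q (k : nat) : R := ratr (odflt 0 (unpickle k)).
have /choice[B /choice[N h]] k :
    exists B N, [/\ measurable B, measurable N, mu N = 0%E &
    B `<=` D `&` f @^-1` `]q k, +oo[%classic /\
    D `&` f @^-1` `]q k, +oo[%classic `<=` B `|` N].
  apply: Lmeasurable_borel; apply: mf; last exact: measurable_itv.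
  exact: Lmeasurable_of_measurable.
pose M := \bigcup_k N k.
have mM : measurable M by apply: bigcup_measurable => k _; have [] := h k.
have M0 : mu M = 0%E.
  apply/negligibleP => //; apply: negligible_bigcup => k.
  by apply/negligibleP; have [] := h k.
have mDM : measurable (D `\` M) by exact: measurableD.
exists (f \_ (D `\` M)); split; last first.
  exists M; split => // x /= /not_implyP[Dx]; apply: contra_notP => nMx.
  by rewrite patchE ifT// inE.
apply/(measurable_restrictT _ mDM) => //.
apply: (measurability _ (RGenOInfty.measurableE R)) => // _ [_ [y ->] <-].
rewrite (_ : _ `&` _ = \bigcup_(k in [set k | y < q k]) (B k `\` M)).
  apply: bigcup_measurable => k _; apply: measurableD => //.
  by have [] := h k.
apply/seteqP; split => x /=.
  move=> [[Dx nMx]]; rewrite in_itv /= andbT => yf.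
  have [r] := rat_in_itvoo yf; rewrite in_itv /= => /andP[yr rf].
  exists (pickle r); first by rewrite /= /q pickleK.
  split => //; have [_ _ _ [_]] := h (pickle r).
  case/(_ x); first by split => //=; rewrite in_itv /= andbT /q pickleK.
    by [].
  by move=> Nx; exfalso; apply: nMx; exists (pickle r).
move=> [k /= yq [Bx nMx]]; have [_ _ _ [/(_ _ Bx) + _]] := h k.
move=> [Dx /=]; rewrite !in_itv /= !andbT => qf.
by split => //; exact: lt_trans qf.
Qed.

Lemma Lmeasurable_indic (A : set T) : Lmeasurable mu A ->
  Lmeasurable_fun mu setT (\1_A : T -> R).
Proof.
by move=> mA; exact: (@measurable_indic _
  (g_sigma_algebraType (completed_algebra_gen mu)) R setT A mA).
Qed.

Lemma Lmeasurable_indic_borel (A : set T) : Lmeasurable mu A ->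
  exists B, measurable B /\ {ae mu, forall x, \1_B x = \1_A x :> R}.
Proof.
move=> /Lmeasurable_borel[B [N [mB mN N0 [BA ABN]]]]; exists B; split => //.
exists N; split => // x /= h; apply: contrapT => nNx; apply: h.
rewrite !indicE; have [Bx|nBx] := pselect (B x).
  by rewrite !mem_set//; exact: BA.
by rewrite !memNset// => /ABN[].
Qed.

End null_sets.

Section product_swap.
Context d (T : measurableType d) (R : realType).
Variable mu : {sigma_finite_measure set T -> \bar R}.
Local Notation mu2 := (mu \x mu)%E.

Lemma measurable_swap_pair : measurable_fun setT (@swap_pair T T).
Proof. by apply/measurable_fun_pairP; split; [exact: measurable_snd|exact: measurable_fst]. Qed.

(** Both sides agree on rectangles, which determine a product measure. *)
Lemma product_measure_swap (A : set (T * T)) : measurable A ->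
  mu2 (@swap_pair T T @^-1` A) = mu2 A.
Proof.
move=> mA.
pose pf : {measure set (T * T) -> \bar R} :=
  measure_function_pushforward__canonical__measure_function_Measure
    mu2 measurable_swap_pair.
rewrite [RHS](product_measure_unique (m' := pf)) //= => B C mB mC.
rewrite /pushforward (_ : _ @^-1` _ = C `*` B).
  by rewrite product_measure1E// muleC.
by apply/seteqP; split => -[x y] /= [].
Qed.

Lemma ge0_integral_swap (D : set (T * T)) (f : T * T -> \bar R) :
  measurable D -> measurable_fun D f -> (forall p, 0 <= f p)%E ->
  (\int[mu2]_(p in D) f p = \int[mu2]_(p in @swap_pair T T @^-1` D) f (p.2, p.1))%E.
Proof.
move=> mD mf f0.
pose pf : {measure set (T * T) -> \bar R} :=
  measure_function_pushforward__canonical__measure_function_Measure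
    mu2 measurable_swap_pair.
transitivity (\int[pf]_(p in D) f p)%E.
  by apply: eq_measure_integral => //= A mA _; rewrite -[LHS]product_measure_swap.
by rewrite (ge0_integral_pushforward measurable_swap_pair mu2 mD mf).
Qed.

Lemma ae_swap (P : T * T -> Prop) :
  {ae mu2, forall p, P p} -> {ae mu2, forall p, P (p.2, p.1)}.
Proof.
move=> [N [mN N0 PN]]; exists (@swap_pair T T @^-1` N); split.
- by rewrite -[X in measurable X]setTI; exact: measurable_swap_pair.
- by rewrite product_measure_swap.
- by move=> p /= nP; exact: PN.
Qed.

Lemma integral_swap (D : set (T * T)) (f : T * T -> \bar R) :
  measurable D -> measurable_fun D f ->
  (\int[mu2]_(p in D) f p = \int[mu2]_(p in @swap_pair T T @^-1` D) f (p.2, p.1))%E.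
Proof.
move=> mD mf; rewrite integralE [RHS]integralE.
rewrite !(@ge0_integral_swap D)//.
- by congr (_ - _)%E; apply: eq_integral => p _; rewrite ?funeposE ?funenegE.
- exact: measurable_funeneg.
- exact: measurable_funepos.
Qed.

Lemma ae_fst (P : T -> Prop) :
  {ae mu, forall x, P x} -> {ae mu2, forall p, P p.1}.
Proof.
move=> [N [mN N0 PN]]; exists (N `*` setT); split.
- exact: measurableX.
- transitivity (mu N * mu setT)%E; first exact: product_measure1E.
  by rewrite N0 mul0e.
- by move=> p /= nP; split => //; exact: PN.
Qed.

Lemma ae_snd (P : T -> Prop) :
  {ae mu, forall x, P x} -> {ae mu2, forall p, P p.2}.
Proof. by move=> /ae_fst/ae_swap. Qed.

Lemma square_sigma_finite : sigma_finite setT mu2.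
Proof.
have /sigma_finiteP[F [TF ndF Foo]] := sigma_finiteT mu.
exists (fun k => F k `*` F k).
  apply/seteqP; split => // -[x y] _.
  have [i _ Fx] : (\bigcup_k F k) x by rewrite -TF.
  have [j _ Fy] : (\bigcup_k F k) y by rewrite -TF.
  exists (maxn i j) => //; split.
  - by move: Fx; exact/subsetPset/ndF/leq_maxl.
  - by move: Fy; exact/subsetPset/ndF/leq_maxr.
move=> k; have [mF Fk] := Foo k; split; first exact: measurableX.
by rewrite product_measure1E// lte_mul_pinfty// ge0_fin_numE.
Qed.

(** The product measure packed with its sigma-finiteness, as Tonelli's theorem
    on a triple product and the Radon-Nikodym theorem require. *)
Definition square_measure : {sigma_finite_measure set (T * T)%type -> \bar R} :=
  HB.pack mu2 (Measure_isSigmaFinite.Build _ _ _ _ square_sigma_finite).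

End product_swap.

Section positive_weight.
Context d (T : measurableType d) (R : realType).
Variable mu : {sigma_finite_measure set T -> \bar R}.

(** Weight the pieces [F k] of finite measure by numbers [a k > 0] such that the
    [a k] and the [a k * mu (F k)] have sum at most [1].  Multiplication by the
    resulting [h] turns a functional on [L^1] into a finite charge even when
    [mu] is infinite. *)
Lemma integrable_weight : exists h : T -> R,
  [/\ measurable_fun setT h, forall x, 0 < h x &
      mu.-integrable setT (EFin \o h)].
Proof.
have /sigma_finiteP[F [TF _ Foo]] := sigma_finiteT mu.
pose a k : R := (1 / (2 ^ k.+1)%:R) / (1 + fine (mu (F k))).
have m0 k : 0 <= fine (mu (F k)) by exact: fine_ge0.
have a0 k : 0 < a k.
  by rewrite /a divr_gt0// ?divr_gt0 ?ltr0n ?expn_gt0// ltr_pwDl.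
have ale k : a k <= 1 / (2 ^ k.+1)%:R.
  by rewrite /a ler_pdivrMr ?ltr_pwDl// ler_peMr ?divr_ge0// lerDl.
have amu k : ((a k)%:E * mu (F k) <= (1 / (2 ^ k.+1)%:R)%:E)%E.
  have -> : mu (F k) = (fine (mu (F k)))%:E.
    by rewrite fineK// ge0_fin_numE//; have [] := Foo k.
  rewrite -EFinM lee_fin /a mulrAC ler_pdivrMr ?ltr_pwDl//.
  by rewrite ler_wpM2l ?divr_ge0// lerDr.
pose H x := (\sum_(k <oo) ((a k)%:E * (\1_(F k) x)%:E))%E.
have term0 k x : (0 <= (a k)%:E * (\1_(F k) x)%:E :> \bar R)%E.
  by rewrite mule_ge0// lee_fin ?ltW// indicE ler0n.
have H0 x : (0 < H x)%E.
  have [k _ Fk] : (\bigcup_i F i) x by rewrite -TF.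
  apply: (@lt_le_trans _ _ (\sum_(0 <= i < k.+1) ((a i)%:E * (\1_(F i) x)%:E))%E).
    rewrite big_nat_recr//= indicE mem_set// mule1.
    apply: (@lt_le_trans _ _ (a k)%:E); first by rewrite lte_fin.
    by rewrite leeDr//; apply: sume_ge0 => i _; exact: term0.
  exact: nneseries_lim_ge.
have Hle x : (H x <= 1)%E.
  apply: (le_trans _ (@epsilon_trick0 R 1 xpredT ler01)).
  apply: lee_nneseries => // k _; rewrite -EFinM lee_fin.
  by apply: (le_trans _ (ale k)); rewrite indicE; case: (_ \in _); rewrite ?mulr1 ?mulr0// ltW.
have Hfin x : H x \is a fin_num.
  by rewrite ge0_fin_numE ?(ltW (H0 x))// (le_lt_trans (Hle x))// ltry.
have mH : measurable_fun setT H.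
  apply: ge0_emeasurable_sum => // k _; apply/measurable_EFinP.
  by apply: measurable_funM => //; apply: measurable_indic; have [] := Foo k.
exists (fine \o H); split.
- exact: measurableT_comp.
- by move=> x; rewrite -lte_fin fineK.
- rewrite (_ : EFin \o _ = H); last by apply/funext => x /=; rewrite fineK.
  apply/integrableP; split => //.
  under eq_integral do rewrite (gee0_abs (ltW (H0 _))).
  rewrite integral_nneseries//; last first.
    move=> k; apply/measurable_EFinP.
    by apply: measurable_funM => //; apply: measurable_indic; have [] := Foo k.
  apply: (@le_lt_trans _ _ 1%E); last exact: ltry.
  apply: (le_trans _ (@epsilon_trick0 R 1 xpredT ler01)).
  apply: lee_nneseries => [k _ _|k _]; first exact: integral_ge0.
  rewrite ge0_integralZl//; last 2 first.
  + apply/measurable_EFinP; apply: measurable_indic; by have [] := Foo k.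
  + by rewrite lee_fin ltW.
  by rewrite integral_indic ?setIT//; have [] := Foo k.
Qed.

End positive_weight.

(** * Hahn-Banach and the dual of L^1 *)

Section hahn_banach.
Context {R : realType} {V : lmodType R}.
Variables (W : set V) (p : V -> R).
Hypothesis W_lin : forall (a : R) x y, W x -> W y -> W (a *: x + y).
Hypothesis pD : forall x y, W x -> W y -> p (x + y) <= p x + p y.
Hypothesis pZ : forall (a : R) x, 0 <= a -> W x -> p (a *: x) = a * p x.

(** A partial linear functional dominated by [p] is encoded as its graph, so
    that the union of a chain of extensions is a union of sets.  The sublinear
    function [p] is only controlled on the subspace [W]: in the application [V]
    consists of all functions and [W] of the integrable ones. *)
Definition dominated_graph (G : set (V * R)) : Prop :=
  [/\ G (0, 0), forall x r, G (x, r) -> W x /\ r <= p x &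
      forall a x r y q, G (x, r) -> G (y, q) -> G (a *: x + y, a * r + q)].

Lemma dominated_graphZ G (a : R) x r : dominated_graph G ->
  G (x, r) -> G (a *: x, a * r).
Proof.
by move=> [G0 _ GL] Gx; have := GL a _ _ _ _ Gx G0; rewrite !addr0.
Qed.

(** Domination alone makes the graph functional: two values over the same
    point differ by a value over [0], which is at most [p 0 = 0]. *)
Lemma dominated_graph_fun G x r q : dominated_graph G ->
  G (x, r) -> G (x, q) -> r = q.
Proof.
move=> dG; have [G0 Gp GL] := dG.
have W0 : W 0 by have [] := Gp _ _ G0.
have p0 : p 0 = 0 by rewrite -(scale0r 0) pZ// mul0r.
suff h r' q' : G (x, r') -> G (x, q') -> r' <= q'.
  by move=> Gr Gq; apply/eqP; rewrite eq_le !h.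
move=> Gr Gq; have := GL (-1) _ _ _ _ Gq Gr.
by rewrite scaleN1r addNr mulN1r => /Gp[_]; rewrite p0 addrC subr_le0.
Qed.

(** One-dimensional extension: the value [c] at the new vector must lie
    between all the [r - p (x - x1)] and all the [p (y + x1) - q]; these do not
    cross by subadditivity, so the supremum of the former will do. *)
Lemma dominated_graph_extend G x1 : dominated_graph G -> W x1 ->
  exists G', [/\ dominated_graph G', G `<=` G' & exists r, G' (x1, r)].
Proof.
move=> dG Wx1; have [G0 Gp GL] := dG.
have W0 : W 0 by have [] := Gp _ _ G0.
have WZ a x : W x -> W (a *: x).
  by move=> Wx; have := W_lin a Wx W0; rewrite addr0.
have WD x y : W x -> W y -> W (x + y).
  by move=> Wx Wy; have := W_lin 1 Wx Wy; rewrite scale1r.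
have WN x : W x -> W (- x) by rewrite -scaleN1r; exact: WZ.
pose S := [set z.2 - p (z.1 - x1) | z in G].
have key x r y q : G (x, r) -> G (y, q) -> r - p (x - x1) <= p (y + x1) - q.
  move=> Gx Gy; have [Wx _] := Gp _ _ Gx; have [Wy _] := Gp _ _ Gy.
  have := GL 1 _ _ _ _ Gx Gy; rewrite scale1r mul1r => /Gp[_ h].
  have : p (x + y) <= p (x - x1) + p (y + x1).
    rewrite (_ : x + y = (x - x1) + (y + x1)); first by apply: pD; apply: WD => //; exact: WN.
    by rewrite addrCA subrK addrC.
  by lra.
have S0 : S !=set0 by exists (0 - p (0 - x1)); exists (0, 0).
have Sub : has_ubound S.
  by exists (p (0 + x1) - 0) => _ [[x r] Gx <-]; exact: key.
pose c := sup S.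
have c1 x r : G (x, r) -> r - p (x - x1) <= c.
  by move=> Gx; apply: ub_le_sup => //; exists (x, r).
have c2 y q : G (y, q) -> c <= p (y + x1) - q.
  by move=> Gy; apply: ge_sup => // _ [[x r] Gx <-]; exact: key.
pose G' := [set z : V * R | exists x r t, [/\ G (x, r), z.1 = x + t *: x1 &
   z.2 = r + t * c]].
exists G'; split; last 2 first.
- by move=> [x r] Gx; exists x, r, 0; rewrite scale0r mul0r !addr0.
- by exists c, 0, 0, 1; rewrite scale1r mul1r !add0r.
split.
- by exists 0, 0, 0; rewrite scale0r mul0r !addr0.
- move=> _ _ [x [r [t [/= Gx -> ->]]]]; have [Wx rp] := Gp _ _ Gx.
  split; first by apply: WD => //; exact: WZ.
  have [t0|t0|->] := ltgtP t 0; last by rewrite scale0r mul0r !addr0.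
  + have nt0 : 0 < - t by rewrite oppr_gt0.
    have nti : 0 <= (- t)^-1 by rewrite invr_ge0 ltW.
    have := c1 _ _ (dominated_graphZ ((- t)^-1) dG Gx).
    have -> : x + t *: x1 = (- t) *: ((- t)^-1 *: x - x1).
      by rewrite scalerBr scalerA divff ?gt_eqF// scale1r scaleNr opprK.
    rewrite pZ ?(ltW nt0)//; last by apply: WD; [exact: WZ|exact: WN].
    move: (p _) => u h.
    have : (- t) * ((- t)^-1 * r - u) <= (- t) * c by rewrite ler_pM2l.
    rewrite mulrBr mulrA divff ?gt_eqF// mul1r => h2.
    by move: h2; rewrite !mulNr; lra.
  + have ti : 0 <= t^-1 by rewrite invr_ge0 ltW.
    have := c2 _ _ (dominated_graphZ (t^-1) dG Gx).
    have -> : x + t *: x1 = t *: (t^-1 *: x + x1).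
      by rewrite scalerDr scalerA divff ?gt_eqF// scale1r.
    rewrite pZ ?(ltW t0)//; last by apply: WD => //; exact: WZ.
    move: (p _) => u h.
    have : t * c <= t * (u - t^-1 * r) by rewrite ler_pM2l.
    rewrite mulrBr mulrA divff ?gt_eqF// mul1r.
    by lra.
- move=> a _ _ _ _ [x [r [t [/= Gx -> ->]]]] [y [q [u [/= Gy -> ->]]]].
  exists (a *: x + y), (a * r + q), (a * t + u); split => /=.
  + exact: GL.
  + by rewrite scalerDr scalerDl scalerA addrACA.
  + by ring.
Qed.

Lemma hahn_banach (G0 : set (V * R)) : dominated_graph G0 ->
  exists l : V -> R,
  [/\ forall x r, G0 (x, r) -> l x = r,
      forall x, W x -> l x <= p x &
      forall (a : R) x y, W x -> W y -> l (a *: x + y) = a * l x + l y].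
Proof.
move=> dG0.
(* Zorn's lemma is applied to sets [A] such that [A] together with [G0] is a
   dominated graph, so that the empty chain also has an upper bound. *)
have [|A [dA Amax]] := @Zorn_bigcup _ [set G | dominated_graph (G `|` G0)].
  move=> F FP tF; have [G00 G0p G0L] := dG0; split; first by right.
  - move=> x r [[G FG Gx]|]; last exact: G0p.
    by have [_ h _] := FP _ FG; apply: h; left.
  - have step a x r y q G : F G -> (G `|` G0) (x, r) -> (G `|` G0) (y, q) ->
        ((\bigcup_(X in F) X) `|` G0) (a *: x + y, a * r + q).
      move=> FG Gx Gy; have [_ _ GL] := FP _ FG.
      by have [h|h] := GL a _ _ _ _ Gx Gy; [left; exists G|right].
    move=> a x r y q [[G FG Gx]|Gx] [[H FH Hy]|Hy].
    + have [GH|HG] := tF _ _ FG FH.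
      * by apply: (step _ _ _ _ _ H) => //; left => //; exact: GH.
      * by apply: (step _ _ _ _ _ G) => //; left => //; exact: HG.
    + by apply: (step _ _ _ _ _ G) => //; [left|right].
    + by apply: (step _ _ _ _ _ H) => //; [right|left].
    + by right; exact: G0L.
set G := A `|` G0 in dA.
have Wdom x : W x -> exists r, G (x, r).
  move=> Wx; have [G' [dG' GG' [r Gr]]] := dominated_graph_extend dA Wx.
  apply: contrapT => nG; apply: (Amax G'); last first.
    by rewrite /= setUidl// => z G0z; apply: GG'; right.
  split; first by move=> z Az; apply: GG'; left.
  by move=> G'A; apply: nG; exists r; left; exact: G'A.
have /choice[l lP] : forall x, exists r, W x -> G (x, r).
  move=> x; have [/Wdom[r Gr]|nW] := pselect (W x); first by exists r.
  by exists 0.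
have [G00 Gp GL] := dA.
exists l; split.
- move=> x r G0x; have Gx : G (x, r) by right.
  by apply: (dominated_graph_fun dA _ Gx); apply: lP; have [] := Gp _ _ Gx.
- by move=> x /lP/Gp[].
- move=> a x y Wx Wy; apply: (dominated_graph_fun dA).
    by apply: lP; exact: W_lin.
  by apply: GL; exact: lP.
Qed.

End hahn_banach.

Section L1_functional.
Context d (T : measurableType d) (R : realType).
Variable mu : {measure set T -> \bar R}.

Definition integrable_real (f : T -> R) := mu.-integrable setT (EFin \o f).

(** A linear functional of norm at most one on [L^1].  The bound is one-sided
    since it is also applied to [- f].  The functional is defined on all
    functions but only constrained on the integrable ones. *)
Definition L1_contraction (l : (T -> R) -> R) : Prop :=
  (forall a f g, integrable_real f -> integrable_real g ->
     l (fun x => a * f x + g x) = a * l f + l g) /\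
  (forall f, integrable_real f -> ((l f)%:E <= \int[mu]_x `|f x|%:E)%E).

Lemma integrable_realD a f g : integrable_real f -> integrable_real g ->
  integrable_real (fun x => a * f x + g x).
Proof.
move=> If Ig; rewrite /integrable_real (_ : _ \o _ =
  (fun x => a%:E * (EFin \o f) x)%E \+ (EFin \o g)).
  by apply: integrableD => //; exact: integrableZl.
by apply/funext => x /=; rewrite EFinD EFinM.
Qed.

Lemma integrable_real0 : integrable_real (fun=> 0).
Proof. exact: integrable0. Qed.

Lemma integrable_realZ a f : integrable_real f ->
  integrable_real (fun x => a * f x).
Proof.
move=> If; have := integrable_realD a If integrable_real0.
by under eq_fun do rewrite addr0.
Qed.

Lemma integrable_real_add f g : integrable_real f -> integrable_real g ->
  integrable_real (fun x => f x + g x).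
Proof.
by move=> If Ig; have := integrable_realD 1 If Ig; under eq_fun do rewrite mul1r.
Qed.

Lemma integrable_real_indic f A : measurable A -> integrable_real f ->
  integrable_real (fun x => f x * \1_A x).
Proof.
move=> mA If; apply: le_integrable (If) => //.
  apply/measurable_EFinP/measurable_funM; last exact: measurable_indic.
  exact/measurable_EFinP/(measurable_int _ If).
move=> x _ /=; rewrite lee_fin normrM indicE ler_piMr// normr_nat.
by case: (_ \in _).
Qed.

Section contraction_theory.
Variable l : (T -> R) -> R.
Hypothesis lP : L1_contraction l.
Let l_lin := lP.1.
Let l_le := lP.2.

Lemma L1_contraction0 : l (fun=> 0) = 0.
Proof.
have := l_lin 1 integrable_real0 integrable_real0.
by under eq_fun do rewrite mulr0 addr0; lra.
Qed.

Lemma L1_contractionD f g : integrable_real f -> integrable_real g ->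
  l (fun x => f x + g x) = l f + l g.
Proof.
move=> If Ig; have := l_lin 1 If Ig; rewrite mul1r => <-.
by congr l; apply/funext => x; rewrite mul1r.
Qed.

Lemma L1_contractionZ a f : integrable_real f ->
  l (fun x => a * f x) = a * l f.
Proof.
move=> If; have := l_lin a If integrable_real0; rewrite L1_contraction0 addr0 => <-.
by congr l; apply/funext => x; rewrite addr0.
Qed.

Lemma L1_contraction_abs f : integrable_real f ->
  (`|l f|%:E <= \int[mu]_x `|f x|%:E)%E.
Proof.
move=> If; have [l0|l0] := leP 0 (l f); first by rewrite ger0_norm//; exact: l_le.
rewrite ltr0_norm// -mulN1r -L1_contractionZ//.
apply: (le_trans (l_le (integrable_realZ _ If))).
by under eq_integral do rewrite mulN1r normrN.
Qed.

(** By dominated convergence [f_ n] tends to [f] in [L^1]. *)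
Lemma L1_contraction_cvg (f_ : nat -> T -> R) (f g : T -> R) :
  (forall n, measurable_fun setT (f_ n)) -> integrable_real f ->
  integrable_real g -> (forall n x, `|f_ n x| <= g x) ->
  (forall x, f_ n x @[n --> \oo] --> f x) -> l (f_ n) @[n --> \oo] --> l f.
Proof.
move=> mf_ If Ig f_g f_f.
have If_ n : integrable_real (f_ n).
  apply: le_integrable (Ig) => //; first exact/measurable_EFinP.
  by move=> x _ /=; rewrite lee_fin (le_trans (f_g n x))// ler_norm.
have f_f' x : (EFin \o f_^~ x) n @[n --> \oo] --> (f x)%:E.
  by apply: cvg_EFin; [exact: nearW|exact: f_f].
have [_ + _] := @dominated_convergence _ _ _ mu setT measurableT
  (fun n => EFin \o f_ n) (EFin \o f) (EFin \o g)
  (fun n => (measurable_EFinP _ _).2 (mf_ n)) (measurable_int _ If)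
  (aeW _ (fun x _ => f_f' x)) Ig (aeW _ (fun x n _ => f_g n x)).
move=> h; apply/cvgrPdist_lt => e e0.
have := (cvgrPdist_lt _ _).1 (fine_cvg h) e e0.
move=> /(_ eventually_filter eventually_filter).
apply: filterS => n /=; rewrite sub0r normrN; apply: le_lt_trans.
rewrite distrC; apply: (le_trans _ (ler_norm _)).
have If_f : integrable_real (fun x => -1 * f x + f_ n x).
  exact: integrable_realD.
have -> : l (f_ n) - l f = l (fun x => -1 * f x + f_ n x).
  by rewrite l_lin// mulN1r addrC.
rewrite -lee_fin fineK; last first.
  rewrite ge0_fin_numE; last exact: integral_ge0.
  have /integrableP[_] := If_f; apply: le_lt_trans; apply: ge0_le_integral => //.
  - apply/measurable_EFinP; apply: measurableT_comp => //.
    by apply: measurable_funB => //; exact/measurable_EFinP/(measurable_int _ If).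
  - apply/measurable_EFinP; apply: measurableT_comp => //.
    exact/measurable_EFinP/(measurable_int _ If_f).
  - by move=> x _ /=; rewrite lee_fin mulN1r addrC.
apply: (le_trans (L1_contraction_abs If_f)).
by rewrite le_eqVlt; apply/orP; left; apply/eqP; apply: eq_integral => x _;
  rewrite /= mulN1r addrC.
Qed.

End contraction_theory.

Lemma L1_contraction_mul (z : T -> R) : measurable_fun setT z ->
  (forall x, `|z x| <= 1) ->
  (forall f, integrable_real f -> integrable_real (fun x => z x * f x)) /\
  L1_contraction (fun f => fine (\int[mu]_x (z x * f x)%:E)).
Proof.
move=> mz z1.
have Iz f : integrable_real f -> integrable_real (fun x => z x * f x).
  move=> If; apply: le_integrable (If) => //.
    apply/measurable_EFinP/measurable_funM => //.
    exact/measurable_EFinP/(measurable_int _ If).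
  by move=> x _ /=; rewrite lee_fin normrM ler_piMl.
split=> //; split.
- move=> a f g If Ig.
  rewrite (_ : (fun x => _) =
     (fun x => (a%:E * (z x * f x)%:E + (z x * g x)%:E)%E)); last first.
    by apply/funext => x; rewrite -EFinM -EFinD; congr EFin; ring.
  rewrite integralD//; last 2 first.
    exact: integrableZl (Iz _ If).
    exact: Iz.
  rewrite integralZl//; last exact: Iz.
  rewrite fineD; last 2 first.
    by rewrite fin_numM// integrable_fin_num//; exact: Iz.
    by rewrite integrable_fin_num//; exact: Iz.
  by rewrite fineM// integrable_fin_num//; exact: Iz.
- move=> f If; rewrite fineK; last by rewrite integrable_fin_num//; exact: Iz.
  apply: le_integral => //; first exact: Iz.
    exact: (integrable_abse If).
  move=> x _; rewrite lee_fin (le_trans (ler_norm _))// normrM ler_piMl//.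
Qed.

End L1_functional.

Section L1_dual.
Context d (T : measurableType d) (R : realType).

Section uniqueness.
Variable mu : {measure set T -> \bar R}.
Local Notation integrable_real := (integrable_real mu).

Import HBNNSimple.

Lemma L1_contraction_sum (l : (T -> R) -> R) (I : Type) (r : seq I)
    (F : I -> T -> R) : L1_contraction mu l ->
  (forall i, integrable_real (F i)) ->
  integrable_real (fun x => \sum_(i <- r) F i x) /\
  l (fun x => \sum_(i <- r) F i x) = \sum_(i <- r) l (F i).
Proof.
move=> lP IF; elim: r => [|i r [ih1 ih2]].
  under eq_fun do rewrite big_nil.
  by rewrite big_nil; split; [exact: integrable_real0|exact: L1_contraction0 lP].
under eq_fun do rewrite big_cons.
rewrite big_cons -ih2; split; first exact: integrable_real_add.
exact: (L1_contractionD lP (IF i) ih1).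
Qed.

(** A functional is determined by its values on the [h * \1_A] because an
    integrable [f >= 0] is the dominated limit of [h * s_n], where the [s_n] are
    simple functions increasing to [f / h]. *)
Variables (l1 l2 : (T -> R) -> R) (h : T -> R).
Hypotheses (l1P : L1_contraction mu l1) (l2P : L1_contraction mu l2).
Hypotheses (Ih : integrable_real h) (h0 : forall x, 0 < h x).
Hypothesis l12 : forall A, measurable A ->
  l1 (fun x => h x * \1_A x) = l2 (fun x => h x * \1_A x).

Let mh : measurable_fun setT h.
Proof. exact/measurable_EFinP/(measurable_int _ Ih). Qed.

Let l12_nnsfun (s : {nnsfun T >-> R}) :
  l1 (fun x => h x * s x) = l2 (fun x => h x * s x).
Proof.
pose F y x := y * (h x * \1_(s @^-1` [set y]) x).
have IF y : integrable_real (F y).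
  by apply: integrable_realZ; exact: integrable_real_indic.
have [r sr] : exists r : seq R, range s = [set` r] by exact/finite_seqP.
rewrite (_ : (fun x => h x * s x) =
    fun x => \sum_(y <- undup r) F y x); last first.
  apply/funext => x; rewrite fimfunE sr.
  rewrite (_ : [set` r] = [set` undup r]); last first.
    by apply/seteqP; split => y /=; rewrite mem_undup.
  rewrite -fsbig_seq ?undup_uniq// mulr_sumr.
  by apply: eq_bigr => y _; rewrite /F mulrCA.
rewrite (L1_contraction_sum _ l1P IF).2 (L1_contraction_sum _ l2P IF).2.
apply: eq_bigr => y _; rewrite /F (L1_contractionZ l1P) ?(L1_contractionZ l2P).
- by rewrite l12.
- exact: integrable_real_indic.
- exact: integrable_real_indic.
Qed.

Let l12_ge0 (f : T -> R) : integrable_real f -> (forall x, 0 <= f x) ->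
  l1 f = l2 f.
Proof.
move=> If f0.
have mf : measurable_fun setT f by exact/measurable_EFinP/(measurable_int _ If).
pose g x := f x / h x.
have mg : measurable_fun setT (EFin \o g).
  apply/measurable_EFinP; apply: measurable_funM => //.
  exact: measurable_funV.
have g0 x : setT x -> (0 <= (EFin \o g) x)%E.
  by move=> _; rewrite lee_fin divr_ge0// ltW.
pose s := nnsfun_approx measurableT mg.
pose f_ n x := h x * s n x.
have f_f n x : `|f_ n x| <= f x.
  rewrite ger0_norm ?mulr_ge0 ?(ltW (h0 x))// /f_ mulrC -ler_pdivlMr//.
  rewrite -lee_fin /s nnsfun_approxE.
  by apply: le_approx; [exact: g0|].
have mf_ n : measurable_fun setT (f_ n) by exact: measurable_funM.
have f_cvg x : f_ n x @[n --> \oo] --> f x.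
  rewrite (_ : f x = h x * g x); last by rewrite /g mulrC divfK// gt_eqF.
  apply: cvgMr; apply: (@fine_cvg _ _ _ _ (EFin \o s^~ x)).
  exact: cvg_nnsfun_approx.
have c1 := L1_contraction_cvg l1P mf_ If If f_f f_cvg.
have c2 := L1_contraction_cvg l2P mf_ If If f_f f_cvg.
have c12 : (fun n => l1 (f_ n)) = (fun n => l2 (f_ n)).
  by apply/funext => n; exact: l12_nnsfun.
rewrite c12 in c1.
by apply: (cvg_unique _ c1 c2).
Qed.

Lemma L1_contraction_unique f : integrable_real f -> l1 f = l2 f.
Proof.
move=> If.
have mf : measurable_fun setT f by exact/measurable_EFinP/(measurable_int _ If).
have Ip : integrable_real (fun x => `|f x|) by exact: integrable_norm.
have Iq : integrable_real (fun x => `|f x| + f x).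
  exact: integrable_real_add.
have fE : f = fun x => -1 * `|f x| + (`|f x| + f x).
  by apply/funext => x; rewrite mulN1r addKr.
rewrite fE l1P.1// l2P.1// !l12_ge0// => x; rewrite -lerBlDl sub0r.
by rewrite lerNl -normrN ler_norm.
Qed.

End uniqueness.

Lemma ae_le_integral_set (mu : {measure set T -> \bar R}) (f g : T -> R) :
  integrable_real mu f -> integrable_real mu g ->
  (forall A, measurable A ->
     (\int[mu]_(x in A) (f x)%:E <= \int[mu]_(x in A) (g x)%:E)%E) ->
  {ae mu, forall x, f x <= g x}.
Proof.
move=> If Ig fg.
have mf : measurable_fun setT f by exact/measurable_EFinP/(measurable_int _ If).
have mg : measurable_fun setT g by exact/measurable_EFinP/(measurable_int _ Ig).
pose A := [set x | g x < f x].
have mA : measurable A by exact: measurable_set_lt.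
have IfA : mu.-integrable A (EFin \o f) by apply: integrableS If.
have IgA : mu.-integrable A (EFin \o g) by apply: integrableS Ig.
have mfg : measurable_fun A (fun x => (f x - g x)%:E).
  by apply/measurable_EFinP/measurable_funTS; exact: measurable_funB.
have : (\int[mu]_(x in A) `|(f x - g x)%:E| = 0)%E.
  rewrite (eq_integral (fun x => ((f x)%:E - (g x)%:E)%E)); last first.
    move=> x; rewrite inE => Ax; rewrite -EFinB gee0_abs// lee_fin subr_ge0.
    exact: ltW.
  rewrite integralB_EFin//; apply/eqP; rewrite eq_le; apply/andP; split.
    rewrite sube_le0 fg//.
  rewrite -integralB_EFin//; apply: integral_ge0 => x Ax.
  by rewrite -EFinB lee_fin subr_ge0 ltW.
move/(ae_eq_integral_abs mu mA mfg); apply: filterS => x /= h.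
rewrite leNgt; apply/negP => Ax; have /eqP := h Ax.
by rewrite eqe subr_eq0 gt_eqF.
Qed.

Section charge_of_functional.
Variable mu : {measure set T -> \bar R}.
Variables (l : (T -> R) -> R) (h : T -> R).
Hypotheses (lP : L1_contraction mu l) (Ih : integrable_real mu h).
Hypothesis h0 : forall x, 0 < h x.

(** The functional seen as a set function; without the weight [h] it would not
    be defined on sets of infinite measure. *)
Definition functional_charge (A : set T) : \bar R :=
  (l (fun x => h x * \1_A x))%:E.

Lemma functional_charge0 : functional_charge set0 = 0%E.
Proof.
rewrite /functional_charge; under eq_fun do rewrite indic0 mulr0.
by rewrite (L1_contraction0 lP).
Qed.

Lemma functional_charge_fin A : measurable A -> functional_charge A \is a fin_num.
Proof. by []. Qed.

Lemma functional_charge_sigma_additive : semi_sigma_additive functional_charge.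
Proof.
move=> F mF tF mUF.
pose f_ n x := h x * \1_(\big[setU/set0]_(i < n) F i) x.
have mU n : measurable (\big[setU/set0]_(i < n) F i).
  by apply: bigsetU_measurable => i _; exact: mF.
have If_ n : integrable_real mu (f_ n) by exact: integrable_real_indic.
have lE n : \sum_(0 <= i < n) l (fun x => h x * \1_(F i) x) = l (f_ n).
  elim: n => [|n ih].
    rewrite big_nil /f_ big_ord0; under eq_fun do rewrite indic0 mulr0.
    by rewrite (L1_contraction0 lP).
  rewrite big_nat_recr//= ih -(L1_contractionD lP)//; last exact: integrable_real_indic.
  congr l; apply/funext => x; rewrite /f_ big_ord_recr /= -mulrDr !indicE in_setU.
  case: (boolP (x \in F n)) => xF; last by rewrite orbF addr0.
  case: (boolP (x \in _)) => xU; last by rewrite add0r.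
  exfalso; move: xU xF; rewrite !inE -bigcup_mkord => -[k /= kn Fk] Fn.
  have /(tF _ _ I I) nk : F n `&` F k !=set0 by exists x.
  by rewrite nk ltnn in kn.
rewrite (_ : (fun n => _) = EFin \o (fun n => l (f_ n))); last first.
  by apply/funext => n /=; rewrite -lE sumEFin.
apply: cvg_EFin; first exact: nearW.
apply: (L1_contraction_cvg lP _ _ Ih) => //.
- by move=> n; exact/measurable_EFinP/(measurable_int _ (If_ n)).
- exact: (integrable_real_indic mUF Ih).
- move=> n x; rewrite /f_ normrM (gtr0_norm (h0 x)) ler_piMr ?(ltW (h0 x))//.
  by rewrite indicE normr_nat; case: (_ \in _).
- move=> x; rewrite /f_; apply: cvgMr.
  have [[k _ Fk]|nF] := pselect ((\bigcup_k F k) x).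
    apply: cvg_near_cst; exists k.+1 => // n /= kn.
    rewrite !indicE !mem_set//; first by exists k.
    by rewrite -bigcup_mkord; exists k.
  apply: cvg_near_cst; apply: nearW => n /=.
  rewrite !indicE !memNset// -bigcup_mkord => -[k _ Fk].
  by apply: nF; exists k.
Qed.

Lemma functional_charge_dominates : functional_charge `<< mu.
Proof.
apply/null_content_dominatesP => A mA A0; rewrite /functional_charge.
have := L1_contraction_abs lP (integrable_real_indic mA Ih).
rewrite (_ : (\int[mu]_x _)%E = 0%E).
  by rewrite lee_fin normr_le0 => /eqP ->.
rewrite (eq_integral ((fun x => `|h x|%:E) \_ A)); last first.
  move=> x _; rewrite patchE indicE.
  by case: (_ \in _); rewrite ?mulr1 ?mulr0 ?normr0.
rewrite -integral_mkcond; apply: null_set_integral => //.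
by apply/measurable_EFinP/measurable_funTS; apply: measurableT_comp => //;
  exact/measurable_EFinP/(measurable_int _ Ih).
Qed.

End charge_of_functional.

(** The charge of [l] has a Radon-Nikodym density [Z], and the norm bound on [l]
    gives [`|Z| <= h] almost everywhere, so that [Z / h] is the function sought. *)
Theorem L1_dual (mu : {sigma_finite_measure set T -> \bar R})
    (l : (T -> R) -> R) : L1_contraction mu l ->
  exists z : T -> R, [/\ measurable_fun setT z, forall x, `|z x| <= 1 &
    forall f, integrable_real mu f -> l f = fine (\int[mu]_x (z x * f x)%:E)].
Proof.
move=> lP; have [h [mh h0 Ih]] := integrable_weight mu.
pose nu : {charge set T -> \bar R} := HB.pack (functional_charge l h)
  (isCharge.Build _ _ _ _ (functional_charge0 h lP)
    (functional_charge_fin l h)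
    (functional_charge_sigma_additive lP Ih h0)).
have numu : nu `<< mu := functional_charge_dominates lP Ih.
pose Z x := fine (Radon_Nikodym nu mu x).
have ZE x : (Z x)%:E = Radon_Nikodym nu mu x.
  by rewrite fineK//; exact: Radon_Nikodym_fin_num.
have IZ : integrable_real mu Z.
  have := Radon_Nikodym_integrable numu; apply: eq_integrable => // x _ /=.
  by rewrite ZE.
have mZ : measurable_fun setT Z by exact/measurable_EFinP/(measurable_int _ IZ).
have nuE A : measurable A ->
    (l (fun x => h x * \1_A x))%:E = (\int[mu]_(x in A) (Z x)%:E)%E.
  move=> mA; rewrite -[LHS]/(nu A) (Radon_Nikodym_integral numu mA).
  by apply: eq_integral => x _; rewrite ZE.
have absE A : measurable A ->
    (\int[mu]_x `|h x * \1_A x|%:E = \int[mu]_(x in A) (h x)%:E)%E.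
  move=> mA; rewrite [RHS]integral_mkcond; apply: eq_integral => x _.
  rewrite patchE indicE; case: (_ \in _); rewrite ?mulr1 ?mulr0 ?normr0//.
  by rewrite gtr0_norm.
have Zh : {ae mu, forall x, Z x <= h x}.
  apply: ae_le_integral_set => // A mA; rewrite -nuE// -absE//.
  by apply: lP.2; exact: integrable_real_indic.
have hZ : {ae mu, forall x, - Z x <= h x}.
  apply: ae_le_integral_set => //.
    by have := integrable_realZ (-1) IZ; under eq_fun do rewrite mulN1r.
  move=> A mA.
  have IZA : mu.-integrable A (EFin \o Z) by apply: integrableS IZ.
  rewrite (eq_integral (fun x => ((-1)%:E * (Z x)%:E)%E)); last first.
    by move=> x _; rewrite -EFinM mulN1r.
  rewrite integralZl// -nuE// -absE// -EFinM.
  rewrite -(L1_contractionZ lP); last exact: integrable_real_indic.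
  have := lP.2 _ (integrable_realZ (-1) (integrable_real_indic mA Ih)).
  by under eq_integral do rewrite mulN1r normrN.
(* Truncation makes the bound hold everywhere, and changes [Z / h] only on a
   null set. *)
pose z x := Num.max (-1) (Num.min 1 (Z x / h x)).
have mz : measurable_fun setT z.
  apply: measurable_maxr => //; apply: measurable_minr => //.
  by apply: measurable_funM => //; exact: measurable_funV.
have z1 x : `|z x| <= 1.
  by rewrite ler_norml /z le_max lexx /= ge_max ge_min lexx /= andbT; lra.
exists z; split => //.
have [Iz zP] := L1_contraction_mul mu mz z1.
apply: (L1_contraction_unique lP zP Ih h0) => A mA.
apply: EFin_inj; rewrite nuE//= fineK; last first.
  by apply: integrable_fin_num => //; exact/Iz/integrable_real_indic.
rewrite integral_mkcond; apply: ae_eq_integral => //.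
- apply/(measurable_restrictT _ mA); apply/measurable_EFinP.
  exact: measurable_funTS.
- by apply: measurable_int (Iz _ (integrable_real_indic mA Ih)).
move: Zh hZ; apply: filterS2 => x Zh hZ _.
rewrite patchE indicE; case: (_ \in _); rewrite ?mulr1 ?mulr0//.
congr EFin; rewrite /z min_r; last by rewrite ler_pdivrMr ?mul1r.
rewrite max_r; last by rewrite ler_pdivlMr// mulN1r lerNl.
by rewrite divfK// gt_eqF.
Qed.

End L1_dual.

(** * The kernel *)

Section kernel.
Context {R : realType}.

Lemma rV_coord_le_norm n (x : 'rV[R]_n) i : `|x ord0 i| <= `|x|.
Proof.
rewrite [leRHS]mx_normrE /=.
exact: (le_bigmax_cond _ (fun ij : 'I_1 * 'I_n => `|x ij.1 ij.2|) (j := (ord0, i))).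
Qed.

Lemma rV_norm_le n (x : 'rV[R]_n) (r : R) : 0 <= r ->
  (forall i, `|x ord0 i| <= r) -> `|x| <= r.
Proof.
move=> r0 xr; rewrite [leLHS]mx_normrE /=; apply: bigmax_le => // -[i j] _ /=.
by rewrite (ord1 i).
Qed.

Lemma rV_norm_le_enorm n (x : 'rV[R]_n) : `|x| <= enorm x.
Proof.
apply: rV_norm_le; first exact: sqrtr_ge0.
move=> i; rewrite /enorm -sqrtr_sqr; apply: ler_wsqrtr.
by rewrite (bigD1 i)//= lerDl sumr_ge0// => j _; exact: sqr_ge0.
Qed.

Lemma enorm_le_rV_norm n (x : 'rV[R]_n.+1) : enorm x <= n.+1%:R * `|x|.
Proof.
rewrite /enorm -[leRHS]ger0_norm ?mulr_ge0// -sqrtr_sqr; apply: ler_wsqrtr.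
rewrite exprMn; apply: (@le_trans _ _ (\sum_(i < n.+1) `|x| ^+ 2)).
  apply: ler_sum => i _; rewrite -real_normK ?num_real//.
  by rewrite lerXn2r ?nnegrE// rV_coord_le_norm.
rewrite sumr_const card_ord -[leLHS]mulr_natl ler_wpM2r ?sqr_ge0//.
by rewrite -natrX ler_nat leq_pmulr.
Qed.

Lemma enormN n (x : 'rV[R]_n) : enorm (- x) = enorm x.
Proof. by congr Num.sqrt; apply: eq_bigr => i _; rewrite mxE sqrrN. Qed.

Lemma enorm_gt0 n (x : 'rV[R]_n) : x != 0 -> 0 < enorm x.
Proof.
by move=> x0; apply: lt_le_trans (rV_norm_le_enorm x); rewrite normr_gt0.
Qed.

Lemma measurable_fun_rV_coord d (T : measurableType d) n (f : T -> 'rV[R]_n) i :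
  measurable_fun setT f -> measurable_fun setT (fun x => f x ord0 i).
Proof. by move/measurable_fun_rVP. Qed.

Lemma measurable_fun_rVB d (T : measurableType d) n (f g : T -> 'rV[R]_n) :
  measurable_fun setT f -> measurable_fun setT g ->
  measurable_fun setT (fun x => f x - g x).
Proof.
move=> mf mg; apply/measurable_fun_rVP => i.
rewrite [X in measurable_fun _ X](_ : _ = fun x => f x ord0 i - g x ord0 i).
  by apply: measurable_funB; exact: measurable_fun_rV_coord.
by apply/funext => x; rewrite !mxE.
Qed.

Lemma measurable_fun_rVZ d (T : measurableType d) n (a : T -> R) (v : 'rV[R]_n) :
  measurable_fun setT a -> measurable_fun setT (fun x => a x *: v).
Proof.
move=> ma; apply/measurable_fun_rVP => i.
rewrite [X in measurable_fun _ X](_ : _ = fun x => a x * v ord0 i).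
  exact: measurable_funM.
by apply/funext => x; rewrite !mxE.
Qed.

Lemma measurable_rV_norm d (T : measurableType d) n (f : T -> 'rV[R]_n) :
  measurable_fun setT f -> measurable_fun setT (fun x => `|f x|).
Proof.
move=> mf; apply: (measurableT_comp (f := fun x : 'rV[R]_n => `|x|)) => //.
by apply: continuous_measurable_rV; exact: norm_continuous.
Qed.

Variable n : nat.
Implicit Types (s : R) (x y : 'rV[R]_n.+1).
Local Notation leb := (@lebesgue_rV R n.+1).

Lemma measurable_frac_kernel s : measurable_fun setT (@frac_kernel R n.+1 s).
Proof.
apply: measurable_funV; apply: (measurableT_comp (measurable_powR _)).
apply: (measurableT_comp (f := @Num.sqrt R)).
  by apply: continuous_measurable_fun; exact: sqrt_continuous.
apply: measurable_sum => i; apply: measurable_funX.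
apply: measurable_fun_rV_coord; apply: measurable_fun_rVB;
  [exact: measurable_fst|exact: measurable_snd].
Qed.

Lemma frac_kernel_ge0 s p : 0 <= @frac_kernel R n.+1 s p.
Proof. by rewrite invr_ge0 powR_ge0. Qed.

Lemma frac_kernel_gt0 s p : p.1 != p.2 -> 0 < @frac_kernel R n.+1 s p.
Proof.
by move=> p12; rewrite invr_gt0 powR_gt0// enorm_gt0// subr_eq0.
Qed.

Lemma frac_kernel_swap s p : @frac_kernel R n.+1 s (p.2, p.1) = frac_kernel s p.
Proof. by rewrite /frac_kernel /= -enormN opprB. Qed.

Lemma frac_kernel_le s x y (r : R) : 0 < s -> 0 < r -> r <= `|x - y| ->
  frac_kernel s (x, y) <= (r `^ (n.+1%:R + s))^-1.
Proof.
move=> s0 r0 rxy; have r1 : r <= enorm (x - y) := le_trans rxy (rV_norm_le_enorm _).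
rewrite /frac_kernel /= lef_pV2 ?posrE ?powR_gt0//; last exact: lt_le_trans r1.
by apply: ge0_ler_powR; rewrite ?nnegrE ?sqrtr_ge0 ?(ltW r0) ?addr_ge0 ?(ltW s0).
Qed.

Lemma frac_kernel_ge s x y (r : R) : 0 < s -> x != y -> `|x - y| <= r ->
  ((n.+1%:R * r) `^ (n.+1%:R + s))^-1 <= frac_kernel s (x, y).
Proof.
move=> s0 xy xyr; have e0 : 0 < enorm (x - y) by rewrite enorm_gt0// subr_eq0.
have er : enorm (x - y) <= n.+1%:R * r.
  by apply: (le_trans (enorm_le_rV_norm _)); rewrite ler_wpM2l.
have r0 : 0 < n.+1%:R * r := lt_le_trans e0 er.
rewrite /frac_kernel /= lef_pV2 ?posrE ?powR_gt0//.
by apply: ge0_ler_powR; rewrite ?nnegrE ?sqrtr_ge0 ?(ltW r0) ?addr_ge0 ?(ltW s0).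
Qed.

Lemma measurable_frac_kernel_section s x :
  measurable_fun setT (fun y => frac_kernel s (x, y)).
Proof.
exact: measurable_fun_pair2 (measurable_frac_kernel s).
Qed.

Lemma measurable_oscillation s (u : 'rV[R]_n.+1 -> R) : measurable_fun setT u ->
  measurable_fun setT (fun p => (`|u p.1 - u p.2| * frac_kernel s p)%:E).
Proof.
move=> mu; apply/measurable_EFinP; apply: measurable_funM; last exact: measurable_frac_kernel.
apply: measurableT_comp => //; apply: measurable_funB.
  exact: (measurableT_comp mu measurable_fst).
exact: (measurableT_comp mu measurable_snd).
Qed.

Lemma nneseries_geometric_le (a q : R) : 0 <= a -> 0 < q < 1 ->
  (\sum_(k <oo) (a * q ^+ k)%:E <= (a / (1 - q))%:E)%E.
Proof.
move=> a0 /andP[q0 q1].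
have t0 k : (0 <= (a * q ^+ k)%:E)%E.
  by rewrite lee_fin mulr_ge0// exprn_ge0// ltW.
apply: lime_le; first by apply: is_cvg_nneseries => k _ _; exact: t0.
apply: nearW => k; rewrite sumEFin lee_fin -mulr_sumr ler_wpM2l//.
rewrite big_mkord -[leRHS]mul1r ler_pdivlMr ?subr_gt0//.
have := subrX1 q k; have : 0 <= q ^+ k by rewrite exprn_ge0// ltW.
by move: (q ^+ k) (\sum_(i < k) _) => u S; lra.
Qed.

(** Cut the exterior of the ball into the dyadic rings where
    [2 ^ k * r <= `|x - y| < 2 ^ k.+1 * r].  With [N] the dimension, the kernel
    is at most [(2 ^ k * r) `^ - (N + s)] there and the ring has volume at most
    [(4 * 2 ^ k * r) ^ N], so the contributions form a geometric series of
    ratio [2 `^ - s]. *)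
Lemma kernel_tail s : 0 < s -> exists2 C : R, 0 <= C &
  forall x (r : R), 0 < r ->
  (\int[leb]_(y in ~` ball x r) (frac_kernel s (x, y))%:E <=
   (C * (r `^ s)^-1)%:E)%E.
Proof.
move=> s0; pose q : R := (2 `^ s)^-1.
have q0 : 0 < q by rewrite invr_gt0 powR_gt0.
have q1 : q < 1.
  rewrite invf_lt1 ?powR_gt0//.
  have := gt0_ltr_powR s0 (x := 1) (y := 2).
  by rewrite !nnegrE powR1; apply; rewrite ?ltr1n.
exists (4 ^+ n.+1 / (1 - q)).
  by rewrite divr_ge0 ?exprn_ge0// subr_ge0 ltW.
move=> x r r0.
have rk0 k : 0 < 2 ^+ k * r by rewrite mulr_gt0// exprn_gt0.
pose c k := ((2 ^+ k * r) `^ (n.+1%:R + s))^-1.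
have c0 k : 0 <= c k by rewrite invr_ge0 powR_ge0.
pose B k := ball x (2 ^+ k.+1 * r).
have mB k : measurable (B k) by exact: measurable_ball_rV.
have mball : measurable (~` ball x r) by apply: measurableC; exact: measurable_ball_rV.
have term0 k y : (0 <= (c k)%:E * (\1_(B k) y)%:E :> \bar R)%E.
  by rewrite mule_ge0// lee_fin// indicE ler0n.
apply: (@le_trans _ _ (\int[leb]_(y in ~` ball x r)
    \sum_(k <oo) ((c k)%:E * (\1_(B k) y)%:E))%E).
  apply: ge0_le_integral => //.
  - by move=> y _; rewrite lee_fin frac_kernel_ge0.
  - apply/measurable_EFinP; apply: measurable_funTS.
    exact: measurable_frac_kernel_section.
  - apply: measurable_funTS; apply: ge0_emeasurable_sum => // k _.
    by apply/measurable_EFinP; apply: measurable_funM.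
  move=> y; rewrite -ball_normE /= => /negP; rewrite -leNgt => rxy.
  have [k0 hk0] : exists k : nat, `|x - y| < 2 ^+ k * r.
    exists (Num.bound (`|x - y| / r)).
    rewrite -ltr_pdivrMr//; apply: (lt_trans (archi_boundP _)).
      by rewrite divr_ge0// ltW.
    by rewrite -natrX ltr_nat ltn_expl.
  have [k kP kmin] := ex_minnP (ex_intro (fun k => `|x - y| < 2 ^+ k * r) _ hk0).
  case: k kP kmin => [|k] kP kmin.
    by move: kP; rewrite expr0 mul1r ltNge rxy.
  have kxy : 2 ^+ k * r <= `|x - y|.
    by rewrite leNgt; apply/negP => /kmin; rewrite ltnn.
  apply: (@le_trans _ _ ((c k)%:E * (\1_(B k) y)%:E)%E).
    rewrite indicE mem_set ?mule1 ?lee_fin; first exact: frac_kernel_le.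
    by rewrite /B -ball_normE.
  apply: le_trans (nneseries_lim_ge k.+1 _) => //.
  by rewrite big_nat_recr//= leeDr// sume_ge0.
apply: (@le_trans _ _ (\int[leb]_y
    \sum_(k <oo) ((c k)%:E * (\1_(B k) y)%:E))%E).
  apply: ge0_subset_integral => //.
    apply: ge0_emeasurable_sum => // k _.
    by apply/measurable_EFinP; apply: measurable_funM.
  by move=> y _; exact: nneseries_ge0.
rewrite integral_nneseries//; last first.
  by move=> k; apply/measurable_EFinP; apply: measurable_funM.
rewrite mulrAC.
apply: le_trans (nneseries_geometric_le _ _); last 2 first.
- by rewrite mulr_ge0// ?exprn_ge0// invr_ge0 powR_ge0.
- by rewrite q0 q1.
apply: lee_nneseries => [k _ _|k _]; first exact: integral_ge0.
rewrite ge0_integralZl//; last 2 first.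
- by apply/measurable_EFinP; exact: measurable_indic.
- by rewrite lee_fin.
rewrite integral_indic// setIT.
rewrite [X in (_ * X)%E](_ : _ = ((2 * (2 ^+ k.+1 * r)) ^+ n.+1)%:E); last first.
  exact: lebesgue_rV_ball.
rewrite -EFinM lee_fin.
rewrite /c le_eqVlt; apply/orP; left; apply/eqP.
rewrite powRD; last by rewrite (gt_eqF (rk0 k)) implybT.
rewrite powR_mulrn ?ltW// powRM ?exprn_ge0// ?ltW//.
have -> : (2 ^+ k) `^ s = q ^- k :> R.
  by rewrite -powR_mulrn// -!powRrM /q exprVn invrK -[RHS]powR_mulrn ?powR_ge0// -powRrM mulrC.
rewrite (_ : 2 * (2 ^+ k.+1 * r) = 4 * (2 ^+ k * r)); last by rewrite exprS; ring.
rewrite [(4 * _) ^+ _]exprMn.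
have A0 : (2 ^+ k * r) ^+ n.+1 != 0 by rewrite expf_neq0// gt_eqF.
have r0' : r `^ s != 0 by rewrite gt_eqF// powR_gt0.
have q0' : q ^+ k != 0 by rewrite expf_neq0// gt_eqF.
by field; rewrite A0 r0' q0'.
Qed.

End kernel.

(** * The fractional Hardy inequality near the boundary *)

(** Near the boundary, [t] is the height above the graph bounding the domain
    and [e] the vertical direction: moving by [r *: e] raises [t] by [r]. *)
Section slab.
Context {R : realType} {n : nat}.
Variables (t : 'rV[R]_n.+1 -> R) (e : 'rV[R]_n.+1) (L : R).
Hypotheses (mt : measurable_fun setT t) (te : forall x r, t (x + r *: e) = t x + r).
Hypothesis eL : `|e| <= L.
Local Notation leb := (@lebesgue_rV R n.+1).

(** The part of a ball in a slab of thickness [d] is small because [J] disjoint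
    vertical translates of it fit in a larger ball. *)
Lemma slab_measure y (r a d : R) (J : nat) : 0 < r -> 0 < d ->
  (J%:R%:E * leb (ball y r `&` [set x | (a < t x)%R /\ (t x <= a + d)%R]) <=
   ((2 * (r + J%:R * (d * L))) ^+ n.+1)%:E)%E.
Proof.
move=> r0 d0; set S := _ `&` _.
have L0 : 0 <= L := le_trans (normr_ge0 _) eL.
have mS : measurable S.
  apply: measurableI; first exact: measurable_ball_rV.
  by apply: measurableI; [exact: measurable_set_lt|exact: measurable_set_le].
pose F j := (fun x => x + (- (j%:R * d)) *: e) @^-1` S.
have mF j : measurable (F j).
  by rewrite -[X in measurable X]setTI; exact: measurable_shift_rV.
have FS j : leb (F j) = leb S by exact: lebesgue_rV_shift.
have tF : trivIset setT F.
  apply: ltn_trivIset => i j ij; apply/seteqP; split => // x [[_ /=]].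
  rewrite !te => -[h1 h2] [_ /=]; rewrite !te => -[h3 h4].
  have : j.+1%:R * d <= i%:R * d :> R by rewrite ler_wpM2r ?ler_nat// ltW.
  rewrite -natr1 mulrDl mul1r; lra.
rewrite (_ : (_ * _)%E = leb (\big[setU/set0]_(j < J) F j)); last first.
  rewrite measure_semi_additive_ord_I//=; last first.
  - by apply: bigsetU_measurable => j _; exact: mF.
  - exact: (sub_trivIset (@subsetT _ _) tF).
  under eq_bigr do rewrite FS.
  have E (k : nat) : (k%:R%:E * leb S = \sum_(j < k) leb S)%E.
    elim: k => [|k ih]; first by rewrite big_ord0 mul0e.
    by rewrite big_ord_recr /= -ih -natr1 EFinD ge0_muleDl ?mul1e// lee_fin.
  exact: E.
apply: (@le_trans _ _ (leb (ball y (r + J%:R * (d * L))))); last first.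
  rewrite lebesgue_rV_ball// ltr_pwDl// !mulr_ge0// ltW//.
apply: le_measure; rewrite ?inE.
- by apply: bigsetU_measurable => j _; exact: mF.
- exact: measurable_ball_rV.
move=> x; rewrite -bigcup_mkord => -[j /= jJ] [].
rewrite -!ball_normE /= => h _.
rewrite (_ : y - x = (y - (x + (- (j%:R * d)) *: e)) - (j%:R * d) *: e); last first.
  by rewrite scaleNr opprD opprK addrA addrK.
apply: (le_lt_trans (ler_normB _ _)); apply: ltr_leD => //.
rewrite normrZ ger0_norm ?mulr_ge0 ?(ltW d0)// mulrA.
rewrite ler_pM ?mulr_ge0 ?(ltW d0)// ler_pM2r//.
by rewrite ler_nat ltnW.
Qed.

End slab.

Section outer_kernel.
Context {R : realType} {n : nat}.
Local Notation leb := (@lebesgue_rV R n.+1).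

(** The weight of the interactions of [x] with the complement.  It plays the
    role of the distance to the boundary raised to the power [- s] in the Hardy
    inequality. *)
Definition outer_kernel (s : R) (Omega : set 'rV[R]_n.+1) (x : 'rV[R]_n.+1) : \bar R :=
  (\int[leb]_(y in ~` Omega) (frac_kernel s (x, y))%:E)%E.

Lemma outer_kernel_ge0 s Omega x : (0 <= outer_kernel s Omega x)%E.
Proof. by apply: integral_ge0 => y _; rewrite lee_fin frac_kernel_ge0. Qed.

Lemma measurable_outer_kernel s Omega : measurable Omega ->
  measurable_fun setT (outer_kernel s Omega).
Proof.
move=> mO; have mOc : measurable (~` Omega) by exact: measurableC.
pose h (p : 'rV[R]_n.+1 * 'rV[R]_n.+1) := (frac_kernel s p * \1_(~` Omega) p.2)%:E.
have mh : measurable_fun setT h.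
  apply/measurable_EFinP; apply: measurable_funM; first exact: measurable_frac_kernel.
  by apply: (measurableT_comp _ measurable_snd); exact: measurable_indic.
have h0 p : (0 <= h p)%E.
  by rewrite lee_fin mulr_ge0 ?frac_kernel_ge0// indicE ler0n.
have := measurable_fun_fubini_tonelli_F (m2 := leb) h mh h0.
apply: eq_measurable_fun => x _; rewrite /fubini_F /outer_kernel [RHS]integral_mkcond.
apply: eq_integral => y _; rewrite patchE /h indicE /=.
by case: (y \in _); rewrite ?mulr1 ?mulr0.
Qed.

Lemma outer_kernel_le (s : R) : 0 < s -> exists2 C : R, 0 <= C &
  forall (Omega : set 'rV[R]_n.+1) (x : 'rV[R]_n.+1) (r : R), measurable Omega -> 0 < r -> ball x r `<=` Omega ->
  (outer_kernel s Omega x <= (C * (r `^ s)^-1)%:E)%E.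
Proof.
move=> s0; have [C C0 h] := @kernel_tail R n s s0; exists C => //.
move=> Omega x r mO r0 BO; apply: le_trans (h x r r0).
apply: ge0_subset_integral => //.
- exact: measurableC.
- by apply: measurableC; exact: measurable_ball_rV.
- by apply/measurable_EFinP/measurable_funTS; exact: measurable_frac_kernel_section.
- by move=> y _; rewrite lee_fin frac_kernel_ge0.
- exact: subsetC.
Qed.

End outer_kernel.

(** The local Hardy inequality bounds the integral of [f * t `^ - s] near a
    boundary point.  Compare the value of [f] at [x] with its average over a ball
    of points [y] that lie higher by a factor of order [M].  The error is
    controlled by the fractional seminorm of [f].  The average involves [f] at
    points [y] only, and such a [y] is reached from points [x] in a slab whose
    thickness is of order [t y / M]: since the weight [t x `^ - s] is of order
    [M `^ s * t y `^ - s], the average contributes at most a multiple of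
    [M `^ (s - 1)] times the quantity to be bounded.  As [s < 1], it is
    absorbed when [M] is large. *)
Section local_hardy.
Context {R : realType} {n : nat}.
Local Notation rV := 'rV[R]_n.+1.
Local Notation N := n.+1.
Local Notation leb := (@lebesgue_rV R n.+1).
Variables (s : R) (t : rV -> R) (e : rV) (L : R).
Hypotheses (s0 : 0 < s) (s1 : s < 1).
Hypotheses (mt : measurable_fun setT t) (te : forall x r, t (x + r *: e) = t x + r).
Hypotheses (L1 : 1 <= L) (eL : `|e| <= L).
Hypothesis tL : forall x y, `|t x - t y| <= L * `|x - y|.

Let L0 : 0 < L. Proof. exact: lt_le_trans L1. Qed.

Variables (m : nat) (M : R).
Hypotheses (ME : M = m%:R) (m_ge2 : 2 <= M).
(* The left-hand side is the proportion of the integral contributed by the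
   averages, as computed in [average_bound]. *)
Hypothesis mA : (2 * (24 * L ^+ 2) ^+ N * M `^ s) / M <= 2^-1.

Let m_gt0 : 0 < M. Proof. exact: lt_le_trans m_ge2. Qed.

(** The points over which the value at [p.1] is averaged: a ball centred at
    height [M * t p.1] above [p.1], with a radius small enough for [t] to be
    comparable to [M * t p.1] on it. *)
Definition reach (p : rV * rV) : Prop :=
  `|p.2 - (p.1 + (M * t p.1) *: e)| < M * t p.1 / (2 * L).

Lemma reach_height x y : 0 < t x -> reach (x, y) ->
  M * t x / 2 < t y - t x /\ t y < 2 * (M * t x).
Proof.
move=> tx; rewrite /reach /= => h.
have := le_lt_trans (tL _ _) (_ : L * _ < L * (M * t x / (2 * L))).
move=> /(_ y (x + (M * t x) *: e)); rewrite ltr_pM2l// => /(_ h).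
rewrite te (_ : L * _ = M * t x / 2); last by field; rewrite gt_eqF.
have : 2 * t x <= M * t x by rewrite ler_pM2r.
by rewrite ltr_norml => h1 /andP[h2 h3]; split; lra.
Qed.

Lemma reach_dist x y : 0 < t x -> reach (x, y) ->
  `|x - y| <= 2 * L * (M * t x).
Proof.
move=> tx; rewrite /reach /= => h; rewrite distrC.
have u0 : 0 < M * t x by rewrite mulr_gt0.
rewrite (_ : y - x = (y - (x + (M * t x) *: e)) + (M * t x) *: e); last first.
  by rewrite opprD addrA subrK.
apply: (le_trans (ler_normD _ _)); rewrite normrZ (gtr0_norm u0).
have h1 : M * t x * `|e| <= M * t x * L by rewrite ler_pM2l.
have h2 : M * t x / (2 * L) <= M * t x * L.
  rewrite ler_pM2l// -[leLHS]mul1r ler_pdivrMr ?mulr_gt0//.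
  by have := L1; nra.
by move: h h1 h2; move: (M * t x) => u; lra.
Qed.

Lemma measurable_reach : measurable [set p | reach p].
Proof.
apply: measurable_set_lt.
  apply: measurable_rV_norm; apply: measurable_fun_rVB; first exact: measurable_snd.
  rewrite [X in measurable_fun _ X](_ : _ = fun p : rV * rV => p.1 - (- (M * t p.1)) *: e).
    apply: measurable_fun_rVB; first exact: measurable_fst.
    apply: measurable_fun_rVZ; apply: measurableT_comp => //.
    by apply: measurable_funM => //; exact: (measurableT_comp mt measurable_fst).
  by apply/funext => p; rewrite scaleNr opprK.
apply: measurable_funM => //.
by apply: measurable_funM => //; exact: (measurableT_comp mt measurable_fst).
Qed.

Lemma reach_volume x : 0 < t x ->
  leb [set y | reach (x, y)] = ((M * t x / L) ^+ N)%:E.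
Proof.
move=> tx; rewrite (_ : [set y | _] =
    ball (x + (M * t x) *: e) (M * t x / (2 * L))); last first.
  by apply/seteqP; split => y; rewrite -ball_normE /reach /= distrC.
rewrite lebesgue_rV_ball; last by rewrite divr_gt0// mulr_gt0.
by congr (_ ^+ _)%:E; field; rewrite gt_eqF.
Qed.

(* [x0] is a boundary point and [t] describes [Omega] in the ball of radius
   [r0].  The choice of [rho] keeps in this ball the points reached from the
   smaller ball of radius [rho], where [t x <= L * rho]. *)
Variables (x0 : rV) (r0 rho : R) (Omega : set rV) (f : rV -> R).
Hypotheses (r0_gt0 : 0 < r0) (mOmega : measurable Omega).
Hypothesis OmegaE : forall x, ball x0 r0 x -> (Omega x <-> 0 < t x).
Hypothesis tx0 : t x0 <= 0.
Hypotheses (rho_gt0 : 0 < rho) (rho_le : rho + 2 * L * (M * (L * rho)) <= r0).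
Hypotheses (mf : measurable_fun setT f) (f0 : forall x, 0 <= f x).
Hypothesis If : (\int[leb]_(x in Omega) (f x)%:E < +oo)%E.
Hypothesis Iff : (\int[leb \x leb]_(p in Omega `*` Omega)
  (`|f p.1 - f p.2| * frac_kernel s p)%:E < +oo)%E.

(** A Lipschitz cutoff.  Averaging does not stay in the ball of radius [rho];
    an indicator function would leave uncontrolled terms there, whereas the
    cutoff changes by at most [`|x - y|], which is of the order of [t y]. *)
Definition bump (x : rV) : R := Num.max 0 (rho - `|x - x0|).

Lemma bump_ge0 x : 0 <= bump x. Proof. by rewrite le_max lexx. Qed.

Lemma bump_le x : bump x <= rho.
Proof. by rewrite ge_max ltW//= lerBlDr lerDl. Qed.

Lemma bump_lipschitz x y : bump x <= bump y + `|x - y|.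
Proof.
rewrite ge_max addr_ge0 ?bump_ge0//=.
apply: (@le_trans _ _ (rho - `|y - x0| + `|x - y|)).
  have := ler_distD x y x0; rewrite [`|y - x|]distrC; lra.
by rewrite lerD2r le_max lexx orbT.
Qed.

Lemma measurable_bump : measurable_fun setT bump.
Proof.
apply: measurable_maxr => //; apply: measurable_funB => //.
by apply: measurable_rV_norm; exact: measurable_fun_rVB.
Qed.

Definition near_layer (r eps : R) : set rV :=
  ball x0 r `&` [set x | eps < t x].

Lemma measurable_near_layer r eps : measurable (near_layer r eps).
Proof.
by apply: measurableI; [exact: measurable_ball_rV|exact: measurable_set_lt].
Qed.

Lemma height_le x r : ball x0 r x -> t x <= L * r.
Proof.
rewrite -ball_normE /= => h; have := tL x x0; rewrite distrC => h1.
have : L * `|x0 - x| <= L * r by rewrite ler_pM2l// ltW.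
move: (ler_norm (t x - t x0)); move: tx0 h1.
by rewrite [`|t x0 - _|]distrC [`|x - x0|]distrC; lra.
Qed.

Lemma reach_near_layer eps x y : 0 < eps -> near_layer rho eps x -> reach (x, y) ->
  near_layer r0 eps y.
Proof.
move=> eps0 [Bx /= tx] xy; have tx0' : 0 < t x := lt_trans eps0 tx.
have h := height_le Bx; split.
  move: Bx; rewrite -!ball_normE /= => Bx.
  apply: (le_lt_trans (ler_distD x _ _)).
  apply: lt_le_trans rho_le; apply: ltr_leD => //.
  apply: (le_trans (reach_dist tx0' xy)).
  by rewrite ler_pM2l ?mulr_gt0// ler_pM2l.
have [h1 h2] := reach_height tx0' xy.
have : 0 < M * t x by rewrite mulr_gt0.
by move=> /=; lra.
Qed.

Lemma near_layer_Omega r eps : 0 < eps -> r <= r0 -> near_layer r eps `<=` Omega.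
Proof.
move=> eps0 rr0 x [Bx /= tx]; apply/OmegaE; first exact: le_ball Bx.
exact: lt_trans tx.
Qed.

(** Normalized by the volume of the set reached from [x], so that integrating
    in [y] over this set gives [bump x * t x `^ - s]. *)
Definition averaging_weight (x : rV) : R :=
  bump x * (t x `^ s)^-1 * (L / (M * t x)) ^+ N.

Lemma measurable_averaging_weight : measurable_fun setT averaging_weight.
Proof.
apply: measurable_funM; first apply: measurable_funM.
- exact: measurable_bump.
- by apply: measurable_funV; exact: (measurableT_comp (measurable_powR _) mt).
- apply: measurable_funX; apply: measurable_funM => //.
  by apply: measurable_funV; exact: measurable_funM.
Qed.

Lemma averaging_weight_ge0 x : 0 < t x -> 0 <= averaging_weight x.
Proof.
move=> tx; rewrite /averaging_weight !mulr_ge0 ?bump_ge0 ?invr_ge0 ?powR_ge0//.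
by rewrite exprn_ge0// divr_ge0 ?mulr_ge0 ?(ltW L0) ?(ltW m_gt0) ?(ltW tx).
Qed.

Lemma averaging_weight_volume x : 0 < t x ->
  averaging_weight x * (M * t x / L) ^+ N = bump x * (t x `^ s)^-1.
Proof.
move=> tx; rewrite /averaging_weight -mulrA -exprMn.
rewrite (_ : L / (M * t x) * (M * t x / L) = 1) ?expr1n ?mulr1//.
by field; rewrite !gt_eqF.
Qed.

(** Since [`|x - y|] is at most a multiple of [t x], the kernel is at least, and
    the weight at most, a multiple of [t x `^ - (N + s)]. *)
Lemma averaging_weight_kernel x y : 0 < t x -> reach (x, y) -> x != y ->
  averaging_weight x <= rho * ((N%:R * (2 * L * M)) `^ (N%:R + s)) * (L / M) ^+ N
    * frac_kernel s (x, y).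
Proof.
move=> tx xy nxy.
have Mt : 0 < M * t x by rewrite mulr_gt0.
have := frac_kernel_ge s0 nxy (reach_dist tx xy).
set A := N%:R * (2 * L * M).
have A0 : 0 < A by rewrite !mulr_gt0.
rewrite (_ : N%:R * _ = A * t x); last by rewrite /A; ring.
move=> h.
apply: (@le_trans _ _ (rho * A `^ (N%:R + s) * (L / M) ^+ N *
    ((A * t x) `^ (N%:R + s))^-1)); last first.
  rewrite ler_wpM2l// !mulr_ge0 ?powR_ge0 ?(ltW rho_gt0)//.
  by rewrite exprn_ge0// divr_ge0// ltW.
rewrite powRM ?(ltW A0) ?(ltW tx)// [t x `^ (_ + _)]powRD; last first.
  by rewrite (gt_eqF tx) implybT.
rewrite powR_mulrn ?(ltW tx)//.
have pA : A `^ (N%:R + s) != 0 by rewrite gt_eqF// powR_gt0.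
have pt : t x `^ s != 0 by rewrite gt_eqF// powR_gt0.
have ptN : t x ^+ N != 0 by rewrite expf_neq0// gt_eqF.
rewrite /averaging_weight.
rewrite (_ : L / (M * t x) = L / M / t x); last by field; rewrite !gt_eqF.
rewrite [(L / M / t x) ^+ N]exprMn exprVn.
rewrite (_ : rho * _ * _ * _ = rho * (t x `^ s)^-1 * ((L / M) ^+ N * (t x ^+ N)^-1)); last first.
  by field; rewrite pA pt ptN.
rewrite ler_wpM2r//; last first.
  by rewrite ler_wpM2r ?bump_le// invr_ge0 powR_ge0.
by rewrite mulr_ge0 ?exprn_ge0 ?invr_ge0 ?exprn_ge0 ?divr_ge0 ?(ltW L0) ?(ltW m_gt0) ?(ltW tx).
Qed.

(** The weight at [x] is expressed through the height [t y], which lies between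
    [M * t x / 2] and [2 * M * t x]. *)
Lemma averaging_weight_reach x y : 0 < t x -> reach (x, y) ->
  averaging_weight x <= (bump y + 4 * L * t y) * (2 * (M `^ s / t y `^ s))
    * (2 * L / t y) ^+ N.
Proof.
move=> tx xy; have [h1 h2] := reach_height tx xy; have h3 := reach_dist tx xy.
have Mt : 0 < M * t x by rewrite mulr_gt0.
have ty : 0 < t y by lra.
have inv_le : (M * t x)^-1 <= 2 / t y.
  rewrite -[leLHS]mul1r ler_pdivrMr// mulrAC ler_pdivlMr//; lra.
have L0' := ltW L0; have m0' := ltW m_gt0.
rewrite /averaging_weight; apply: ler_pM.
- by rewrite mulr_ge0 ?bump_ge0 ?invr_ge0 ?powR_ge0.
- by rewrite exprn_ge0// divr_ge0// ltW.
- apply: ler_pM => //; first exact: bump_ge0.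
  + by rewrite invr_ge0 powR_ge0.
  + apply: (le_trans (bump_lipschitz x y)); rewrite lerD2l.
    apply: (le_trans h3); rewrite -!mulrA.
    have : L * (M * t x) <= L * (2 * t y) by rewrite ler_pM2l//; lra.
    by lra.
  + have invpow (a : R) : 0 < a -> a^-1 `^ (- s) = a `^ s.
      by move=> a0; rewrite -[a^-1]powR_inv1 ?ltW// -powRrM mulrNN mul1r.
    have -> : M `^ s / t y `^ s = (M^-1 * t y) `^ (- s).
      by rewrite powRM ?invr_ge0 ?(ltW ty)// invpow// powRN.
    rewrite -powRN; apply: (@le_trans _ _ ((2^-1 * (M^-1 * t y)) `^ (- s))).
      rewrite !powRN lef_pV2 ?posrE ?powR_gt0// ?mulr_gt0 ?invr_gt0//.
      apply: ge0_ler_powR; rewrite ?(ltW s0) ?nnegrE ?(ltW tx) ?mulr_ge0 ?invr_ge0 ?(ltW ty)//.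
      by rewrite mulrCA mulrC ler_pdivrMr// mulrC [t x * _]mulrC; lra.
    rewrite [leLHS]powRM ?mulr_ge0 ?invr_ge0 ?(ltW ty)//.
    by rewrite ler_wpM2r ?powR_ge0// invpow// ler1_powR ?ler1n ?(ltW s1).
- rewrite lerXn2r ?nnegrE ?divr_ge0 ?mulr_ge0 ?(ltW ty) ?(ltW tx)//.
  by rewrite [2 * L]mulrC -[L * 2 / _]mulrA ler_wpM2l.
Qed.

(** The absorption argument needs the quantity to be absorbed to be finite,
    which holds when it is restricted to the points at height more than [eps];
    the resulting bound does not depend on [eps]. *)
Section truncated.
Variable eps : R.
Hypothesis eps0 : 0 < eps.
Local Notation X := (near_layer rho eps).
Local Notation Y := (near_layer r0 eps).
Local Notation leb2 := (leb \x leb)%E.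

Let rho_r0 : rho <= r0.
Proof.
apply: le_trans rho_le; rewrite lerDl !mulr_ge0 ?(ltW L0) ?(ltW m_gt0) ?(ltW rho_gt0)//.
Qed.

Let X_gt0 x : X x -> 0 < t x. Proof. by move=> [_]; exact: lt_trans. Qed.
Let Y_gt0 x : Y x -> 0 < t x. Proof. by move=> [_]; exact: lt_trans. Qed.

Definition reach_layer : set (rV * rV) := [set p | X p.1 /\ reach p].

Lemma measurable_reach_layer : measurable reach_layer.
Proof.
apply: measurableI; last exact: measurable_reach.
rewrite -[X in measurable X]setTI; apply: measurable_fst => //.
exact: measurable_near_layer.
Qed.

Definition averaging_kernel (p : rV * rV) : R :=
  \1_reach_layer p * averaging_weight p.1.

Lemma measurable_averaging_kernel : measurable_fun setT averaging_kernel.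
Proof.
apply: measurable_funM.
  by apply: measurable_indic; exact: measurable_reach_layer.
exact: (measurableT_comp measurable_averaging_weight measurable_fst).
Qed.

Lemma averaging_kernel_ge0 p : 0 <= averaging_kernel p.
Proof.
rewrite /averaging_kernel indicE; case: (boolP (p \in _)); last by rewrite mul0r.
rewrite inE mul1r => -[Xp _].
by apply: averaging_weight_ge0; exact: X_gt0.
Qed.

Let mf1 : measurable_fun setT (fun p : rV * rV => f p.1).
Proof. exact: (measurableT_comp mf measurable_fst). Qed.
Let mf2 : measurable_fun setT (fun p : rV * rV => f p.2).
Proof. exact: (measurableT_comp mf measurable_snd). Qed.

Definition layer_integral : \bar R :=
  (\int[leb]_(x in X) (bump x * f x * (t x `^ s)^-1)%:E)%E.

Lemma layer_integral_average :
  (layer_integral = \int[leb2]_p (f p.1 * averaging_kernel p)%:E)%E.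
Proof.
rewrite fubini_tonelli1//=; last 2 first.
- apply/measurable_EFinP; apply: measurable_funM => //.
  exact: measurable_averaging_kernel.
- by move=> p; rewrite lee_fin mulr_ge0 ?averaging_kernel_ge0.
rewrite /layer_integral integral_mkcond; apply: eq_integral => x _.
rewrite /fubini_F /= patchE; have [Xx|Xx] := pselect (X x); last first.
  rewrite memNset// integral0_eq// => y _.
  by rewrite /averaging_kernel indicE memNset ?mul0r ?mulr0// => -[].
rewrite mem_set//; have tx := X_gt0 Xx.
have mR : measurable [set y | reach (x, y)].
  have := measurable_xsection x measurable_reach.
  by congr (measurable _); apply/seteqP; split => y; rewrite /xsection /= inE.
transitivity (\int[leb]_(y in [set y | reach (x, y)]) (f x * averaging_weight x)%:E)%E.
  rewrite integral_cst//.
  rewrite [X in (_ * X)%E](_ : _ = ((M * t x / L) ^+ N)%:E); last exact: reach_volume.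
  rewrite -EFinM; congr EFin.
  rewrite (_ : bump x * _ * _ = f x * (bump x * (t x `^ s)^-1)); last by ring.
  by rewrite -averaging_weight_volume// mulrA.
rewrite integral_mkcond; apply: eq_integral => y _.
rewrite patchE /averaging_kernel indicE.
have [xy|xy] := pselect (reach (x, y)); first by rewrite !mem_set// mul1r.
by rewrite !memNset ?mul0r ?mulr0// => -[].
Qed.

Definition layer_constant : R :=
  rho * ((N%:R * (2 * L * M)) `^ (N%:R + s)) * (L / M) ^+ N.

Lemma oscillation_bound :
  (\int[leb2]_p (`|f p.1 - f p.2| * averaging_kernel p)%:E <=
   layer_constant%:E * \int[leb2]_(p in Omega `*` Omega)
     (`|f p.1 - f p.2| * frac_kernel s p)%:E)%E.
Proof.
have mO2 : measurable (Omega `*` Omega) by exact: measurableX.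
have mosc : measurable_fun setT (fun p : rV * rV => `|f p.1 - f p.2|).
  by apply: measurableT_comp => //; exact: measurable_funB.
have c0 : 0 <= layer_constant.
  by rewrite !mulr_ge0 ?powR_ge0 ?exprn_ge0 ?divr_ge0 ?(ltW rho_gt0) ?(ltW L0) ?(ltW m_gt0).
rewrite -ge0_integralZl//; last 2 first.
- apply/measurable_EFinP/measurable_funTS; apply: measurable_funM => //.
  exact: measurable_frac_kernel.
- by move=> p _; rewrite lee_fin mulr_ge0 ?frac_kernel_ge0.
rewrite [leRHS]integral_mkcond; apply: ge0_le_integral => //.
- by move=> p _; rewrite lee_fin mulr_ge0 ?averaging_kernel_ge0.
- apply/measurable_EFinP; apply: measurable_funM => //.
  exact: measurable_averaging_kernel.
- apply/(measurable_restrictT _ mO2) => //.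
  apply/measurable_EFinP/measurable_funTS; apply: measurable_funM => //.
  apply: measurable_funM => //; exact: measurable_frac_kernel.
move=> [x y] _ /=; rewrite patchE /averaging_kernel indicE.
have [|xy] := pselect (reach_layer (x, y)); last first.
  rewrite memNset// mul0r mulr0; case: ifPn => // _.
  by rewrite -EFinM lee_fin mulr_ge0// mulr_ge0// frac_kernel_ge0.
move=> /[dup] rxy [/= Xx xy]; rewrite (mem_set rxy) mul1r mem_set; last first.
  split=> /=; first exact: (near_layer_Omega eps0 rho_r0 Xx).
  exact: (near_layer_Omega eps0 (lexx _) (reach_near_layer eps0 Xx xy)).
rewrite -EFinM lee_fin [leRHS]mulrCA.
have [->|nxy] := eqVneq x y; first by rewrite /= subrr normr0 !mul0r.
by rewrite ler_wpM2l//; apply: averaging_weight_kernel => //; exact: X_gt0.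
Qed.

(** All the points [x] that reach [y] lie at height at most [2 * t y / M] in the
    ball of radius [4 * L * t y], a set of measure at most
    [(12 * L * t y) ^ N / M] by [slab_measure] with [m] translates. *)
Lemma average_bound y :
  (\int[leb]_x (f y * averaging_kernel (x, y))%:E <=
   ((fun y => (2^-1 * (f y * (bump y + 4 * L * t y) * (t y `^ s)^-1))%:E) \_ Y) y)%E.
Proof.
rewrite patchE; have [Yy|Yy] := pselect (Y y); last first.
  rewrite memNset// integral0_eq// => x _; rewrite /averaging_kernel indicE memNset ?mul0r ?mulr0//.
  by move=> [/= Xx xy]; apply: Yy; exact: reach_near_layer xy.
rewrite mem_set//; have ty := Y_gt0 Yy.
have tyL : 0 < 4 * L * t y by rewrite !mulr_gt0.
have d0 : 0 < 2 * t y / M by rewrite divr_gt0// mulr_gt0.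
pose V := (bump y + 4 * L * t y) * (2 * (M `^ s / t y `^ s)) * (2 * L / t y) ^+ N.
have V0 : 0 <= V.
  rewrite /V !mulr_ge0 ?addr_ge0 ?bump_ge0 ?(ltW tyL) ?invr_ge0 ?powR_ge0//.
  by rewrite exprn_ge0// divr_ge0 ?mulr_ge0 ?(ltW L0) ?(ltW ty).
pose Z := ball y (4 * L * t y) `&` [set x | 0 < t x /\ t x <= 0 + 2 * t y / M].
have mZ : measurable Z.
  apply: measurableI; first exact: measurable_ball_rV.
  by apply: measurableI; [exact: measurable_set_lt|exact: measurable_set_le].
apply: (@le_trans _ _ (\int[leb]_x (f y * V * \1_Z x)%:E)%E).
  apply: ge0_le_integral => //.
  - by move=> x _; rewrite lee_fin mulr_ge0 ?averaging_kernel_ge0.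
  - apply/measurable_EFinP; apply: measurable_funM => //.
    exact: measurable_fun_pair1 measurable_averaging_kernel.
  - by apply/measurable_EFinP; apply: measurable_funM.
  move=> x _; rewrite lee_fin -mulrA ler_wpM2l// /averaging_kernel !indicE.
  have [|xy] := pselect (reach_layer (x, y)); last first.
    by rewrite memNset// mul0r mulr_ge0.
  move=> /[dup] rxy [/= Xx xy]; rewrite (mem_set rxy); have tx := X_gt0 Xx.
  have [h1 h2] := reach_height tx xy; have h3 := reach_dist tx xy.
  rewrite mul1r mem_set ?mulr1; first exact: averaging_weight_reach.
  split; last first.
    split => //=; rewrite add0r ler_pdivlMr// mulrC; lra.
  rewrite -ball_normE /= distrC; apply: (le_lt_trans h3).
  have : L * (M * t x) < L * (2 * t y) by rewrite ltr_pM2l//; lra.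
  by rewrite -!mulrA; lra.
under eq_integral do rewrite EFinM.
rewrite ge0_integralZl//; last 2 first.
- by apply/measurable_EFinP; exact: measurable_indic.
- by rewrite lee_fin mulr_ge0.
rewrite integral_indic// setIT.
have := slab_measure mt te eL y 0 m tyL d0; rewrite -/Z -ME.
rewrite (_ : 2 * (4 * L * t y + M * (2 * t y / M * L)) = 12 * L * t y); last first.
  by field; rewrite gt_eqF.
move=> hZ.
have fZ : leb Z \is a fin_num.
  rewrite ge0_fin_numE//.
  apply: (@le_lt_trans _ _ (leb (ball y (4 * L * t y)))).
    apply: le_measure; rewrite ?inE//; first exact: measurable_ball_rV.
    exact: subIsetl.
  by rewrite lebesgue_rV_ball// ltry.
rewrite [X in (_ * X)%E](_ : _ = (fine (leb Z))%:E); last by rewrite fineK.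
move: hZ; rewrite -[in X in X -> _](fineK fZ); move: (fine (leb Z)) => z.
rewrite -!EFinM !lee_fin => hZ.
have hz : z <= (12 * L * t y) ^+ N / M by rewrite ler_pdivlMr// mulrC.
apply: (@le_trans _ _ (f y * V * ((12 * L * t y) ^+ N / M))).
  by rewrite ler_wpM2l// mulr_ge0.
have E : (2 * L / t y) ^+ N * (12 * L * t y) ^+ N = (24 * L ^+ 2) ^+ N.
  by rewrite -exprMn; congr (_ ^+ _); field; rewrite gt_eqF.
rewrite (_ : f y * V * _ = (f y * (bump y + 4 * L * t y) * (t y `^ s)^-1) *
    (2 * (24 * L ^+ 2) ^+ N * M `^ s / M)); last first.
  by rewrite -E /V; ring.
rewrite mulrC; apply: ler_wpM2r => //.
by rewrite !mulr_ge0 ?invr_ge0 ?powR_ge0// addr_ge0 ?bump_ge0// ltW.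
Qed.

Let X_Omega : X `<=` Omega.
Proof. exact: near_layer_Omega. Qed.

Let Y_Omega : Y `<=` Omega.
Proof. exact: near_layer_Omega. Qed.

Let mX : measurable X. Proof. exact: measurable_near_layer. Qed.
Let mY : measurable Y. Proof. exact: measurable_near_layer. Qed.

Let mts : measurable_fun setT (fun x => (t x `^ s)^-1).
Proof. by apply: measurable_funV; exact: (measurableT_comp (measurable_powR _) mt). Qed.

Let mbf : measurable_fun setT (fun x => bump x * f x * (t x `^ s)^-1).
Proof.
by apply: measurable_funM => //; apply: measurable_funM => //; exact: measurable_bump.
Qed.

Let bf_ge0 x : 0 <= bump x * f x * (t x `^ s)^-1.
Proof. by rewrite !mulr_ge0 ?bump_ge0 ?invr_ge0 ?powR_ge0. Qed.

(** This crude bound depends on [eps], and only serves to subtract half of the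
    integral from both sides of an inequality. *)
Lemma layer_integral_lty : (layer_integral < +oo)%E.
Proof.
pose c := rho * (eps `^ s)^-1.
have c0 : 0 <= c by rewrite mulr_ge0 ?invr_ge0 ?powR_ge0 ?(ltW rho_gt0).
apply: (@le_lt_trans _ _ (\int[leb]_(x in X) (c%:E * (f x)%:E))%E).
  apply: ge0_le_integral => //.
  - by move=> x _; rewrite lee_fin.
  - by apply/measurable_EFinP/measurable_funTS.
  - by apply/measurable_EFinP/measurable_funTS; exact: measurable_funM.
  move=> x Xx; rewrite -EFinM lee_fin mulrAC ler_wpM2r//.
  apply: ler_pM; rewrite ?bump_ge0 ?invr_ge0 ?powR_ge0 ?bump_le//.
  rewrite lef_pV2 ?posrE ?powR_gt0 ?X_gt0//.
  have tx := X_gt0 Xx.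
  by apply: ge0_ler_powR; rewrite ?nnegrE ?(ltW s0) ?(ltW eps0) ?(ltW tx) ?(ltW Xx.2).
rewrite ge0_integralZl//; last 2 first.
- by apply/measurable_EFinP/measurable_funTS.
- by move=> x _; rewrite lee_fin.
rewrite lte_mul_pinfty// ?lee_fin//.
apply: le_lt_trans If; apply: ge0_subset_integral => //.
- by apply/measurable_EFinP/measurable_funTS.
- by move=> x _; rewrite lee_fin.
Qed.

(** The error of the cutoff brings in [t `^ (1 - s)], bounded near the boundary
    because [s < 1]. *)
Lemma average_integral_bound :
  (\int[leb2]_p (f p.2 * averaging_kernel p)%:E <=
   (2^-1)%:E * layer_integral +
   (2 * L * (L * r0) `^ (1 - s))%:E * \int[leb]_(x in Omega) (f x)%:E)%E.
Proof.
have mFk : measurable_fun setT (fun p => (f p.2 * averaging_kernel p)%:E).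
  apply/measurable_EFinP; apply: measurable_funM => //.
  exact: measurable_averaging_kernel.
have Fk0 p : (0 <= (f p.2 * averaging_kernel p)%:E)%E.
  by rewrite lee_fin mulr_ge0 ?averaging_kernel_ge0.
have mbump := measurable_bump.
have m1 : measurable_fun setT (fun y => f y * (bump y + 4 * L * t y) * (t y `^ s)^-1).
  apply: measurable_funM => //; apply: measurable_funM => //.
  by apply: measurable_funD => //; exact: measurable_funM.
rewrite fubini_tonelli2//.
apply: (@le_trans _ _ (\int[leb]_y
  ((fun y => (2^-1 * (f y * (bump y + 4 * L * t y) * (t y `^ s)^-1))%:E) \_ Y) y)%E).
  apply: ge0_le_integral => //.
  - by move=> y _; apply: integral_ge0 => x _; exact: Fk0.
  - exact: measurable_fun_fubini_tonelli_G.
  - apply/(measurable_restrictT _ mY) => //.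
    by apply/measurable_EFinP/measurable_funTS; exact: measurable_funM.
  by move=> y _; exact: average_bound.
rewrite -integral_mkcond.
have D0 : 0 <= 2 * L * (L * r0) `^ (1 - s).
  by rewrite !mulr_ge0 ?powR_ge0 ?(ltW L0).
apply: (@le_trans _ _ (\int[leb]_(y in Y) ((2^-1 * (bump y * f y * (t y `^ s)^-1))%:E +
   (2 * L * (L * r0) `^ (1 - s) * f y)%:E))%E).
  apply: ge0_le_integral => //.
  - move=> y Yy; rewrite lee_fin !mulr_ge0 ?invr_ge0 ?powR_ge0//.
    by rewrite addr_ge0 ?bump_ge0// !mulr_ge0 ?(ltW L0) ?(ltW (Y_gt0 Yy)).
  - by apply/measurable_EFinP/measurable_funTS; exact: measurable_funM.
  - apply: emeasurable_funD; apply/measurable_EFinP/measurable_funTS.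
      exact: measurable_funM.
    exact: measurable_funM.
  move=> y Yy; have ty := Y_gt0 Yy; rewrite -EFinD lee_fin.
  have ts0 : 0 < t y `^ s by rewrite powR_gt0.
  have h : t y * (t y `^ s)^-1 <= (L * r0) `^ (1 - s).
    have -> : t y * (t y `^ s)^-1 = t y `^ (1 - s).
      rewrite powRB ?powRr1 ?(ltW ty)//; by rewrite (gt_eqF ty) implybT.
    apply: ge0_ler_powR; rewrite ?subr_ge0 ?(ltW s1)//.
    - by rewrite nnegrE ltW.
    - by rewrite nnegrE mulr_ge0 ?(ltW L0) ?(ltW r0_gt0).
    - by apply: height_le; have [] := Yy.
  have : 2 * L * f y * (t y * (t y `^ s)^-1) <= 2 * L * f y * (L * r0) `^ (1 - s).
    by rewrite ler_wpM2l// !mulr_ge0 ?(ltW L0).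
  by lra.
rewrite ge0_integralD//; last 4 first.
- by move=> y _; rewrite lee_fin mulr_ge0.
- by apply/measurable_EFinP/measurable_funTS; exact: measurable_funM.
- by move=> y _; rewrite lee_fin mulr_ge0.
- by apply/measurable_EFinP/measurable_funTS; exact: measurable_funM.
apply: leeD.
  under eq_integral do rewrite EFinM.
  rewrite ge0_integralZl//; last 2 first.
  - by apply/measurable_EFinP/measurable_funTS.
  - by move=> y _; rewrite lee_fin.
  rewrite lee_pmul2l ?lte_fin// /layer_integral.
  rewrite integral_mkcond [leRHS]integral_mkcond.
  rewrite (eq_integral ((fun x => (bump x * f x / t x `^ s)%:E) \_ X))// => y _.
  rewrite !patchE; have [By|nBy] := pselect (ball x0 rho y); last first.
    have -> : bump y = 0.
      apply/eqP; rewrite eq_le bump_ge0 andbT ge_max lexx /= subr_le0 leNgt.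
      by apply/negP => h; apply: nBy; rewrite -ball_normE /= distrC.
    by rewrite !mul0r; case: ifP; case: ifP.
  suff -> : (y \in Y) = (y \in X) by [].
  apply/idP/idP; rewrite !inE => -[_ ?]; split => //.
  exact: le_ball By.
under eq_integral do rewrite EFinM.
rewrite ge0_integralZl//; last 2 first.
- by apply/measurable_EFinP/measurable_funTS.
- by move=> y _; rewrite lee_fin.
apply: lee_wpmul2l; first by rewrite lee_fin.
apply: ge0_subset_integral => //.
- by apply/measurable_EFinP/measurable_funTS.
- by move=> x _; rewrite lee_fin.
Qed.

Definition layer_bound : R :=
  2 * (layer_constant * fine (\int[leb2]_(p in Omega `*` Omega)
     (`|f p.1 - f p.2| * frac_kernel s p)%:E)%E +
    2 * L * (L * r0) `^ (1 - s) * fine (\int[leb]_(x in Omega) (f x)%:E)%E).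

Lemma layer_integral_le : (layer_integral <= layer_bound%:E)%E.
Proof.
have I0 : (0 <= \int[leb]_(x in Omega) (f x)%:E)%E.
  by apply: integral_ge0 => x _; rewrite lee_fin.
have II0 : (0 <= \int[leb2]_(p in Omega `*` Omega)
    (`|f p.1 - f p.2| * frac_kernel s p)%:E)%E.
  by apply: integral_ge0 => p _; rewrite lee_fin mulr_ge0 ?frac_kernel_ge0.
have A0 : (0 <= layer_integral)%E.
  by apply: integral_ge0 => x _; rewrite lee_fin.
have mosc : measurable_fun setT (fun p : rV * rV => `|f p.1 - f p.2|).
  by apply: measurableT_comp => //; exact: measurable_funB.
have mG := measurable_averaging_kernel.
have : (layer_integral <=
    \int[leb2]_p (`|f p.1 - f p.2| * averaging_kernel p)%:E +
    \int[leb2]_p (f p.2 * averaging_kernel p)%:E)%E.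
  rewrite layer_integral_average -ge0_integralD//; last 4 first.
  - by move=> p _; rewrite lee_fin mulr_ge0 ?averaging_kernel_ge0.
  - by apply/measurable_EFinP; exact: measurable_funM.
  - by move=> p _; rewrite lee_fin mulr_ge0 ?averaging_kernel_ge0.
  - by apply/measurable_EFinP; exact: measurable_funM.
  apply: ge0_le_integral => //.
  - by move=> p _; rewrite lee_fin mulr_ge0 ?averaging_kernel_ge0.
  - by apply/measurable_EFinP; exact: measurable_funM.
  - by apply: emeasurable_funD; apply/measurable_EFinP; exact: measurable_funM.
  move=> p _; rewrite -EFinD lee_fin -mulrDl ler_wpM2r ?averaging_kernel_ge0//.
  by have := ler_norm (f p.1 - f p.2); lra.
move/le_trans => /(_ _ (leeD oscillation_bound average_integral_bound)).
rewrite /layer_bound.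
have := layer_integral_lty; rewrite -ge0_fin_numE// => /fineK <-.
move: If; rewrite -ge0_fin_numE// => /fineK <-.
move: Iff; rewrite -ge0_fin_numE// => /fineK <-.
rewrite -!EFinM -!EFinD !lee_fin /=; lra.
Qed.

End truncated.

(** As [t] is [L]-Lipschitz and positive exactly in the domain, the ball of
    radius [t x / L] around [x] lies in the domain; so the outer kernel is at most of
    the order of [t x `^ - s], and monotone convergence lets [eps] tend to [0]. *)
Lemma local_boundary_integral_lty :
  (\int[leb]_(x in Omega `&` ball x0 (rho / 2))
     ((f x)%:E * outer_kernel s Omega x) < +oo)%E.
Proof.
have [C C0 kC] := @outer_kernel_le R n s s0.
have rho_r0 : rho <= r0.
  by apply: le_trans rho_le; rewrite lerDl !mulr_ge0 ?(ltW L0) ?(ltW m_gt0) ?(ltW rho_gt0).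
pose eps (j : nat) : R := j.+1%:R^-1.
have eps0 j : 0 < eps j by rewrite invr_gt0.
pose Z j := near_layer (rho / 2) (eps j).
have ZX j : Z j `<=` near_layer rho (eps j).
  move=> x [Bx tx]; split => //; apply: le_ball Bx.
  by rewrite ler_pdivrMr// ler_peMr ?ler1n// ltW.
have mZ j : measurable (Z j) by exact: measurable_near_layer.
have mfk : measurable_fun setT (fun x => ((f x)%:E * outer_kernel s Omega x)%E).
  apply: emeasurable_funM; first exact/measurable_EFinP.
  exact: measurable_outer_kernel.
have fk0 x : (0 <= (f x)%:E * outer_kernel s Omega x)%E.
  by rewrite mule_ge0 ?lee_fin ?outer_kernel_ge0.
have -> : Omega `&` ball x0 (rho / 2) = \bigcup_j Z j.
  apply/seteqP; split => x.
    move=> [Ox Bx]; have tx : 0 < t x.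
      apply/OmegaE => //; apply: le_ball Bx; apply: le_trans rho_r0.
      by rewrite ler_pdivrMr// ler_peMr ?ler1n// ltW.
    have [k _ /(_ _ (leqnn k)) /= h] := near_infty_natSinv_lt (PosNum tx).
    by exists k.
  move=> [j _ Zx]; split; last by case: Zx.
  by apply: (near_layer_Omega (eps0 j) rho_r0); exact: ZX.
pose c := 2 / rho * (C * L).
have c0 : 0 <= c by rewrite !mulr_ge0 ?invr_ge0 ?(ltW rho_gt0) ?(ltW L0).
have bound j : (\int[leb]_(x in Z j) ((f x)%:E * outer_kernel s Omega x) <=
    (c * layer_bound)%:E)%E.
  have mX := measurable_near_layer rho (eps j).
  have mg : measurable_fun setT (fun x => bump x * f x * (t x `^ s)^-1).
    apply: measurable_funM; first by apply: measurable_funM => //; exact: measurable_bump.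
    by apply: measurable_funV; exact: (measurableT_comp (measurable_powR _) mt).
  have g0 x : 0 <= bump x * f x * (t x `^ s)^-1.
    by rewrite !mulr_ge0 ?bump_ge0 ?invr_ge0 ?powR_ge0.
  apply: (@le_trans _ _ (\int[leb]_(x in near_layer rho (eps j))
     (c%:E * (bump x * f x * (t x `^ s)^-1)%:E))%E); last first.
    rewrite ge0_integralZl//; last 2 first.
    - by apply/measurable_EFinP/measurable_funTS.
    - by move=> x _; rewrite lee_fin.
    rewrite [leRHS]EFinM; apply: lee_wpmul2l; first by rewrite lee_fin.
    exact: layer_integral_le.
  have mcg : measurable_fun setT (fun x => (c%:E * (bump x * f x * (t x `^ s)^-1)%:E)%E).
    by apply/measurable_EFinP; exact: measurable_funM.
  apply: (@le_trans _ _ (\int[leb]_(x in Z j)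
     (c%:E * (bump x * f x * (t x `^ s)^-1)%:E))%E); last first.
    apply: ge0_subset_integral => //.
    - exact: measurable_funTS.
    - by move=> x _; rewrite -EFinM lee_fin mulr_ge0.
  apply: ge0_le_integral => //.
  - exact: measurable_funTS.
  - exact: measurable_funTS.
  move=> x Zx; have [Bx tx'] := Zx; have tx : 0 < t x := lt_trans (eps0 j) tx'.
  have tL2 : t x / L <= rho / 2 by rewrite ler_pdivrMr// mulrC; exact: height_le.
  have r1 : 0 < t x / L by rewrite divr_gt0.
  have BO : ball x (t x / L) `<=` Omega.
    move=> y By; apply/OmegaE.
      apply: (@le_ball _ _ _ (rho / 2 + t x / L)); last exact: ball_triangle By.
      by apply: le_trans rho_r0; lra.
    move: By; rewrite -ball_normE /= ltr_pdivlMr// mulrC => h.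
    have := le_lt_trans (tL x y) h; have := ler_norm (t x - t y); lra.
  apply: (@le_trans _ _ ((f x)%:E * (C * ((t x / L) `^ s)^-1)%:E)%E).
    by apply: lee_wpmul2l; rewrite ?lee_fin//; exact: kC.
  rewrite -!EFinM lee_fin.
  have bx : rho / 2 <= bump x.
    rewrite /bump le_max; apply/orP; right.
    move: Bx; rewrite -ball_normE /= distrC; lra.
  have ts0 : 0 < t x `^ s by rewrite powR_gt0.
  have h : ((t x / L) `^ s)^-1 <= L * (t x `^ s)^-1.
    rewrite powRM ?invr_ge0 ?(ltW tx) ?(ltW L0)// invfM mulrC ler_wpM2r ?invr_ge0 ?(ltW ts0)//.
    rewrite -[L^-1]powR_inv1 ?(ltW L0)// -powRrM mulN1r powRN invrK.
    by rewrite ler1_powR// ltW.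
  have : (f x * C * (L * (t x `^ s)^-1)) * (2 / rho * (rho / 2)) <=
         (f x * C * (L * (t x `^ s)^-1)) * (2 / rho * bump x).
    apply: ler_wpM2l; first by rewrite !mulr_ge0 ?invr_ge0 ?(ltW L0) ?(ltW ts0).
    by rewrite ler_wpM2l// divr_ge0// ltW.
  rewrite (_ : 2 / rho * (rho / 2) = 1); last by field; rewrite gt_eqF.
  rewrite mulr1 => h2.
  have h3 : f x * (C * ((t x / L) `^ s)^-1) <= f x * C * (L * (t x `^ s)^-1).
    by rewrite mulrA ler_wpM2l// mulr_ge0.
  apply: (le_trans h3); apply: (le_trans h2).
  by rewrite le_eqVlt; apply/orP; left; apply/eqP; rewrite /c; ring.
have ndZ : nondecreasing_seq Z.
  move=> i j ij; rewrite subsetEset => x [Bx tx]; split => //.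
  by apply: le_lt_trans tx; rewrite /eps lef_pV2 ?posrE// ler_nat.
have cvg_int := @ge0_nondecreasing_set_cvg_integral _ _ R Z
  (fun x => ((f x)%:E * outer_kernel s Omega x)%E) leb.
apply: (@le_lt_trans _ _ (c * layer_bound)%:E); last exact: ltry.
rewrite -(cvg_lim _ (cvg_int _ _ _ _))//.
- apply: lime_le; last exact: nearW.
  apply: ereal_nondecreasing_is_cvgn.
  apply: ge0_nondecreasing_set_nondecreasing_integral => // i.
  exact: measurable_funTS.
- by move=> i; exact: measurable_funTS.
Qed.

End local_hardy.

(** * Integrability of admissible functions over Q *)

Section boundary_chart.
Context {R : realType} {n : nat}.
Local Notation rV := 'rV[R]_n.+1.

Lemma mulmx_coord_le (O : 'M[R]_n.+1) (z : rV) i :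
  `|(z *m O) ord0 i| <= (\sum_k \sum_j `|O k j|) * `|z|.
Proof.
rewrite mxE mulr_suml; apply: (le_trans (ler_norm_sum _ _ _)).
apply: ler_sum => k _; rewrite normrM mulrC.
apply: ler_pM => //; last exact: rV_coord_le_norm.
by rewrite (bigD1 i)//= lerDl sumr_ge0.
Qed.

Lemma lipschitz_bound m (g : 'rV[R]_m -> R) : lipschitz g ->
  exists2 K : R, 0 < K & forall x y, `|g x - g y| <= K * `|x - y|.
Proof.
move=> /pinfty_ex_gt0[K K0 h]; exists K => // x y.
exact: (h (x, y)).
Qed.

(** In the rotated coordinates, [t] is the first coordinate minus the Lipschitz
    function of the others, and [e] is the first basis vector. *)
Lemma boundary_chart (Omega : set rV) x0 : open Omega ->
  lipschitz_boundary Omega -> (closure Omega `\` interior Omega) x0 ->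
  exists (t : rV -> R) (e : rV) (L r0 : R),
  [/\ 1 <= L, `|e| <= L, 0 < r0, t x0 <= 0 &
      [/\ forall x r, t (x + r *: e) = t x + r,
          forall x y, `|t x - t y| <= L * `|x - y| &
          forall x, ball x0 r0 x -> (Omega x <-> 0 < t x)]].
Proof.
move=> oO lO bx0; have := lO _ bx0; move=> [P [g [PP]]] /lipschitz_bound [K K0 gK] nO.
pose t x := headrV (x *m P) - g (tailrV (x *m P)).
pose e : rV := delta_mx ord0 ord0 *m P^T.
have eO : e *m P = delta_mx ord0 ord0.
  by rewrite -mulmxA (mulmx1C PP) mulmx1.
pose B := \sum_k \sum_j `|P k j|.
have B0 : 0 <= B by apply: sumr_ge0 => k _; apply: sumr_ge0.
have /nbhs_ballP[r0 /= r00 Or0] : nbhs x0 [set x | Omega x <->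
    g (tailrV (x *m P)) < headrV (x *m P)] by [].
have OE x : ball x0 r0 x -> (Omega x <-> 0 < t x).
  by move=> /Or0 /= ->; rewrite subr_gt0.
exists t, e, (1 + `|e| + (B + K * B)), r0; split => //.
- by rewrite -addrA lerDl !addr_ge0// mulr_ge0// ltW.
- by rewrite [1 + _]addrC -addrA lerDl !addr_ge0// mulr_ge0// ltW.
- rewrite leNgt; apply/negP => /(OE _ (ballxx _ r00)) Ox0.
  by case: bx0 => _; apply; apply: open_nbhs_nbhs.
split => // [x r|x y].
- rewrite /t mulmxDl -scalemxAl eO.
  rewrite (_ : headrV _ = headrV (x *m P) + r); last first.
    by rewrite /headrV !mxE eqxx mulr1.
  rewrite (_ : tailrV (x *m P + _) = tailrV (x *m P)); first by rewrite addrAC.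
  by apply/rowP => i; rewrite !mxE /= mulr0 addr0.
have h1 : `|headrV (x *m P) - headrV (y *m P)| <= B * `|x - y|.
  have := mulmx_coord_le P (x - y) ord0; by rewrite mulmxBl mxE [in X in _ + X]mxE.
have h2 : `|tailrV (x *m P) - tailrV (y *m P)| <= B * `|x - y|.
  apply: rV_norm_le => [|i]; first by rewrite mulr_ge0.
  have := mulmx_coord_le P (x - y) (lift ord0 i); by rewrite mulmxBl !mxE.
have h3 := gK (tailrV (x *m P)) (tailrV (y *m P)).
have h4 : K * `|tailrV (x *m P) - tailrV (y *m P)| <= K * (B * `|x - y|).
  by rewrite ler_pM2l.
have h5 : 0 <= (1 + `|e|) * `|x - y| by rewrite mulr_ge0// addr_ge0.
have h6 (a b c d : R) : `|(a - c) - (b - d)| <= `|a - b| + `|c - d|.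
  by rewrite (_ : _ - _ = (a - b) - (c - d)); [exact: ler_normB|ring].
by apply: (le_trans (h6 _ _ _ _)); move: h1 h3 h4 h5; nra.
Qed.

End boundary_chart.

(** As [s < 1], the ratio [m `^ s / m] tends to [0]. *)
Lemma exists_ratio {R : realType} (s A : R) : 0 < s < 1 -> 0 < A ->
  exists m : nat, 2 <= m%:R :> R /\ A * m%:R `^ s / m%:R <= 2^-1.
Proof.
move=> /andP[s0 s1] A0; pose b := (2 * A) `^ (1 - s)^-1.
have b0 : 0 <= b by exact: powR_ge0.
have s10 : 0 < 1 - s by rewrite subr_gt0.
exists (Num.bound b + 2)%N; set m := (_ + _)%N.
have m2 : 2 <= m%:R :> R by rewrite ler_nat leq_addl.
have m0 : 0 < m%:R :> R by apply: lt_le_trans m2.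
split => //.
have bm : b <= m%:R.
  by apply: (le_trans (ltW (archi_boundP b0))); rewrite ler_nat leq_addr.
have h : 2 * A <= m%:R `^ (1 - s).
  have -> : 2 * A = b `^ (1 - s).
    by rewrite /b -powRrM mulVf ?gt_eqF// powRr1// mulr_ge0// ltW.
  by apply: ge0_ler_powR; rewrite ?nnegrE ?(ltW s10).
rewrite ler_pdivrMr//.
have : 2 * A * m%:R `^ s <= m%:R `^ (1 - s) * m%:R `^ s.
  by rewrite ler_wpM2r ?powR_ge0.
rewrite -powRD ?subrK ?powRr1 ?(ltW m0)//; last by rewrite (gt_eqF m0) implybT.
lra.
Qed.

Section fractional_hardy.
Context {R : realType} {n : nat}.
Local Notation rV := 'rV[R]_n.+1.
Local Notation leb := (@lebesgue_rV R n.+1).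
Local Notation leb2 := (leb \x leb)%E.
Variables (s : R) (Omega : set rV).
Hypotheses (s01 : 0 < s < 1) (oO : open Omega) (bO : bounded_set Omega).
Hypothesis lO : lipschitz_boundary Omega.

Let s0 : 0 < s. Proof. by case/andP: s01. Qed.
Let mO : measurable Omega. Proof. exact: open_measurable_rV. Qed.

Section nonneg.
Variable f : rV -> R.
Hypotheses (mf : measurable_fun setT f) (f0 : forall x, 0 <= f x).
Hypothesis If : (\int[leb]_(x in Omega) (f x)%:E < +oo)%E.
Hypothesis Iff : (\int[leb2]_(p in Omega `*` Omega)
  (`|f p.1 - f p.2| * frac_kernel s p)%:E < +oo)%E.

Let F x := ((f x)%:E * outer_kernel s Omega x)%E.

Let mF : measurable_fun setT F.
Proof.
apply: emeasurable_funM; first exact/measurable_EFinP.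
exact: measurable_outer_kernel.
Qed.

Let F0 x : (0 <= F x)%E.
Proof. by rewrite mule_ge0 ?lee_fin ?outer_kernel_ge0. Qed.

Lemma interior_integral_lty x : Omega x ->
  exists2 r, 0 < r & (\int[leb]_(y in Omega `&` ball x r) F y < +oo)%E.
Proof.
move=> Ox; have /nbhs_ballP[r /= r0 rO] : nbhs x Omega by exact: open_nbhs_nbhs.
have [C C0 kC] := @outer_kernel_le R n s s0.
exists (r / 2); first by rewrite divr_gt0.
have mB : measurable (Omega `&` ball x (r / 2)).
  by apply: measurableI => //; exact: measurable_ball_rV.
pose c := C * ((r / 2) `^ s)^-1.
have c0 : 0 <= c by rewrite mulr_ge0 ?invr_ge0 ?powR_ge0.
apply: (@le_lt_trans _ _ (\int[leb]_(y in Omega `&` ball x (r / 2)) (c%:E * (f y)%:E))%E).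
  apply: ge0_le_integral => //.
  - exact: measurable_funTS.
  - by apply/measurable_EFinP/measurable_funTS; exact: measurable_funM.
  move=> y [_ By]; rewrite [leRHS]muleC; apply: lee_wpmul2l; first by rewrite lee_fin.
  apply: kC => //; first by rewrite divr_gt0.
  move=> z Bz; apply: rO; rewrite (splitr r).
  exact: ball_triangle Bz.
rewrite ge0_integralZl//; last 2 first.
- by apply/measurable_EFinP/measurable_funTS.
- by move=> y _; rewrite lee_fin.
rewrite lte_mul_pinfty ?lee_fin//.
apply: le_lt_trans If; apply: ge0_subset_integral => //.
- by apply/measurable_EFinP/measurable_funTS.
- by move=> y _; rewrite lee_fin.
Qed.

Lemma boundary_integral_lty x0 : (closure Omega `\` interior Omega) x0 ->
  exists2 r, 0 < r & (\int[leb]_(y in Omega `&` ball x0 r) F y < +oo)%E.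
Proof.
move=> /(boundary_chart oO lO)[t [e [L [r0 [L1 eL r00 tx0 [te tL OE]]]]]].
have L0 : 0 < L by exact: lt_le_trans L1.
have A0 : 0 < 2 * (24 * L ^+ 2) ^+ n.+1 by rewrite mulr_gt0// exprn_gt0// mulr_gt0// exprn_gt0.
have [m [m2 mA]] := exists_ratio s01 A0.
have mt : measurable_fun setT t.
  apply: continuous_measurable_rV => x.
  apply/(@cvgrPdist_lt _ _ _ (nbhs x) (nbhs_filter x)) => eps eps0.
  apply/nbhs_ballP; exists (eps / L); first by rewrite /= divr_gt0.
  move=> y; rewrite -ball_normE /= ltr_pdivlMr// mulrC => h.
  exact: le_lt_trans (tL _ _) h.
have m0 : 0 < m%:R :> R by exact: lt_le_trans m2.
(* With [rho = r0 / d], the constraint on [rho] is an equality. *)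
pose d := 1 + 2 * L * (m%:R * L).
have d0 : 0 < d by rewrite /d ltr_pwDl// !mulr_ge0 ?(ltW L0).
exists (r0 / d / 2); first by rewrite !divr_gt0.
apply: (@local_boundary_integral_lty R n s t e L s0 _ mt te L1 eL tL m m%:R
  erefl m2 mA x0 r0 (r0 / d) Omega f r00 mO OE tx0) => //.
- by case/andP: s01.
- by rewrite divr_gt0.
- rewrite (_ : r0 / d + _ = r0 / d * d); last by rewrite /d; ring.
  by rewrite divfK// gt_eqF.
Qed.

(** The closure of the domain is compact, hence covered by finitely many balls
    on which the integral is finite: interior points are at positive distance
    from the complement, boundary points are covered by the local inequality. *)
Lemma domain_integral_lty : (\int[leb]_(x in Omega) F x < +oo)%E.
Proof.
have /choice[r rP] : forall x, exists r, closure Omega x ->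
    0 < r /\ (\int[leb]_(y in Omega `&` ball x r) F y < +oo)%E.
  move=> x; have [cx|ncx] := pselect (closure Omega x); last by exists 0.
  have [Ox|nOx] := pselect (Omega x).
    by have [r ? ?] := interior_integral_lty Ox; exists r.
  have [|r ? ?] := @boundary_integral_lty x; last by exists r.
  by split => // /interior_subset.
have cO : compact (closure Omega).
  apply: bounded_closed_compact; last exact: closed_closure.
  have [M M0 OM] := pinfty_ex_gt0 bO.
  exists M; split; first exact: num_real.
  move=> M' MM' x cx /=; apply: ltW; apply: le_lt_trans MM'.
  rewrite leNgt; apply/negP => Mx.
  have e0 : 0 < `|x| - M by rewrite subr_gt0.
  have [y [/OM /= yM]] := cx _ (nbhsx_ballx x _ e0).
  rewrite -ball_normE /= => xy.
  by have := ler_normD (x - y) y; rewrite subrK; lra.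
have mB x : measurable (ball x (r x)) by exact: measurable_ball_rV.
move: cO; rewrite compact_cover => /(_ _ (closure Omega) (fun x => ball x (r x))).
case.
- by move=> x _; exact: ball_open.
- by move=> x cx; exists x => //; apply: ballxx; exact: (rP x cx).1.
move=> D DO ODB.
pose U (l : seq rV) := \big[setU/set0]_(x <- l) ball x (r x).
have mU l : measurable (U l) by apply: bigsetU_measurable.
have Ul (l : seq rV) : (forall x, x \in l -> closure Omega x) ->
    (\int[leb]_(y in Omega `&` U l) F y < +oo)%E.
  elim: l => [|x l ih] lO'; first by rewrite /U big_nil setI0 integral_set0.
  rewrite /U big_cons -/(U l).
  rewrite (_ : Omega `&` _ = (Omega `&` ball x (r x)) `|` (Omega `&` (U l `\` ball x (r x)))); last first.
    apply/seteqP; split => y.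
      move=> [Oy [By|Uy]]; first by left.
      by have [By|nBy] := pselect (ball x (r x) y); [left|right].
    by move=> [[Oy By]|[Oy [Uy _]]]; split => //; [left|right].
  have mOU : measurable (Omega `&` (U l `\` ball x (r x))).
    by apply: measurableI => //; exact: measurableD.
  have mOB : measurable (Omega `&` ball x (r x)) by exact: measurableI.
  rewrite ge0_integral_setU//; last 2 first.
  - exact: measurable_funTS.
  - by apply/disj_setPS => y [[_ By] [_ [_]]].
  rewrite lte_add_pinfty//.
    by apply: (rP x _).2; apply: lO'; rewrite mem_head.
  apply: (@le_lt_trans _ _ (\int[leb]_(y in Omega `&` U l) F y)%E); last first.
    by apply: ih => y yl; apply: lO'; rewrite in_cons yl orbT.
  apply: ge0_subset_integral => //.
  - exact: measurableI.
  - exact: measurable_funTS.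
  - by apply: setIS; exact: subDsetl.
apply: (@le_lt_trans _ _ (\int[leb]_(y in Omega `&` U (finmap.enum_fset D)) F y)%E); last first.
  by apply: Ul => x xD; have := DO x xD; rewrite inE.
rewrite (_ : Omega `&` _ = Omega)//.
apply/setIidPl => x Ox; have [y /= yD By] := ODB x (subset_closure Ox).
by rewrite /U -bigcup_seq; exists y.
Qed.

End nonneg.

Lemma crossQE : crossQ Omega =
  (Omega `*` Omega) `|` ((Omega `*` ~` Omega) `|` (~` Omega `*` Omega)).
Proof.
apply/seteqP; split => -[x y] /=; rewrite /crossQ /=.
  move=> h; have [Ox|nOx] := pselect (Omega x); have [Oy|nOy] := pselect (Omega y).
  - by left.
  - by right; left.
  - by right; right.
  - by exfalso; apply: h.
by move=> [[Ox Oy]|[[Ox Oy]|[Ox Oy]]] [/= nOx nOy].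
Qed.

Lemma measurable_crossQ : measurable (crossQ Omega).
Proof.
by apply: measurableC; apply: measurableX; apply: measurableC.
Qed.

(** [Q] consists of [Omega * Omega] and of two symmetric mixed parts.  On the
    latter, [w] vanishes at one of the two points, and integrating out that point
    leaves the integral of [`|w|] against the outer kernel. *)
Lemma fractional_hardy (w : rV -> R) : measurable_fun setT w ->
  (forall x, ~ Omega x -> w x = 0) ->
  (\int[leb]_(x in Omega) `|w x|%:E < +oo)%E ->
  (\int[leb2]_(p in Omega `*` Omega)
     (`|w p.1 - w p.2| * frac_kernel s p)%:E < +oo)%E ->
  (\int[leb2]_(p in crossQ Omega)
     (`|w p.1 - w p.2| * frac_kernel s p)%:E < +oo)%E.
Proof.
move=> mw w0 Iw Iww.
pose f x := `|w x|.
have mf : measurable_fun setT f by exact: measurableT_comp.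
have f0 x : 0 <= f x by exact: normr_ge0.
pose g (p : rV * rV) := (`|w p.1 - w p.2| * frac_kernel s p)%:E.
have mg : measurable_fun setT g by exact: measurable_oscillation.
have g0 p : (0 <= g p)%E by rewrite lee_fin mulr_ge0 ?frac_kernel_ge0.
have mOc : measurable (~` Omega) by exact: measurableC.
have Iff : (\int[leb2]_(p in Omega `*` Omega)
    (`|f p.1 - f p.2| * frac_kernel s p)%:E < +oo)%E.
  apply: le_lt_trans Iww; apply: ge0_le_integral => //.
  - exact: measurableX.
  - by move=> p _; rewrite lee_fin mulr_ge0 ?frac_kernel_ge0.
  - by apply: measurable_funTS; exact: measurable_oscillation.
  - exact: measurable_funTS.
  - by move=> p _; rewrite lee_fin ler_wpM2r ?frac_kernel_ge0 ?ler_dist_dist.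
have side : (\int[leb2]_(p in Omega `*` ~` Omega) g p < +oo)%E.
  have mOO : measurable (Omega `*` ~` Omega) by exact: measurableX.
  rewrite integral_mkcond fubini_tonelli1//; last 2 first.
  - exact/(measurable_restrictT _ mOO)/measurable_funTS.
  - by move=> p; rewrite patchE; case: ifP.
  apply: le_lt_trans (domain_integral_lty mf f0 Iw Iff).
  rewrite [leRHS]integral_mkcond le_eqVlt; apply/orP; left; apply/eqP.
  apply: eq_integral => x _; rewrite /fubini_F patchE.
  have [Ox|nOx] := pselect (Omega x); last first.
    rewrite memNset// integral0_eq// => y _; rewrite patchE memNset//.
    by move=> [].
  rewrite mem_set// /outer_kernel -ge0_integralZl//; last 3 first.
  - apply/measurable_EFinP/measurable_funTS; exact: measurable_frac_kernel_section.
  - by move=> y _; rewrite lee_fin frac_kernel_ge0.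
  - by rewrite lee_fin.
  rewrite [RHS]integral_mkcond; apply: eq_integral => y _; rewrite !patchE.
  have [Oy|nOy] := pselect (Omega y).
    by rewrite !memNset//=; move=> [].
  by rewrite !mem_set// /g /= (w0 y)// subr0 -EFinM.
have mOO2 : measurable (~` Omega `*` Omega) by exact: measurableX.
have side' : (\int[leb2]_(p in ~` Omega `*` Omega) g p < +oo)%E.
  have -> := ge0_integral_swap leb mOO2 (measurable_funTS mg) g0.
  have -> : @swap_pair rV rV @^-1` (~` Omega `*` Omega) = Omega `*` ~` Omega.
    by apply/seteqP; split => -[x y] [].
  apply: le_lt_trans side; rewrite le_eqVlt; apply/orP; left; apply/eqP.
  apply: eq_integral => p _.
  by rewrite /g /= frac_kernel_swap distrC.
have m11 : measurable (Omega `*` Omega) by exact: measurableX.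
have m12 : measurable (Omega `*` ~` Omega) by exact: measurableX.
have m122 := measurableU _ _ m12 mOO2.
have I11 : (\int[leb2]_(p in Omega `*` Omega) g p < +oo)%E := Iww.
rewrite -[X in (X < _)%E]/(\int[leb2]_(p in crossQ Omega) g p)%E crossQE.
rewrite ge0_integral_setU//; last 2 first.
- exact: measurable_funTS.
- by apply/disj_setPS => -[x y] [/= [Ox Oy]] [[]|[]].
rewrite lte_add_pinfty// ge0_integral_setU//; last 2 first.
- exact: measurable_funTS.
- by apply/disj_setPS => -[x y] [/= [Ox Oy]] [].
by rewrite lte_add_pinfty.
Qed.

End fractional_hardy.

(** * Minimal sets minimize the energy of functions *)

Section layer_cake.
Context {R : realType}.

(** The left-hand side is the length of the part in [(0, 1)] of the interval
    with endpoints [a] and [b]. *)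
Lemma layer_cake_le (a b : R) :
  (\int[@lebesgue_measure R]_(tau in `]0%R, 1%R[)
     `|(tau < a)%R%:R - (tau < b)%R%:R|%:E <= `|a - b|%:E)%E.
Proof.
wlog ab : a b / a <= b.
  move=> h; have [ab|ba] := leP a b; first exact: h.
  under eq_integral do rewrite distrC.
  by rewrite [`|a - b|]distrC; apply: h; exact: ltW.
pose I := `[a, b[%classic.
have mI : measurable (I : set (measurableTypeR R)) by exact: measurable_itv.
apply: (@le_trans _ _ (\int[@lebesgue_measure R]_(tau in `]0%R, 1%R[) (\1_I tau)%:E)%E).
  rewrite le_eqVlt; apply/orP; left; apply/eqP; apply: eq_integral => tau _.
  congr EFin; rewrite indicE /I mem_setE in_itv /=.
  case: (ltP tau a) => ta; case: (ltP tau b) => tb;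
    rewrite ?subrr ?normr0 ?sub0r ?normrN ?normr1//=.
  by exfalso; lra.
rewrite integral_indic//.
apply: (@le_trans _ _ (lebesgue_measure I)).
  apply: le_measure; rewrite ?inE//.
  exact: (measurableI _ _ mI (measurable_itv _)).
rewrite /I lebesgue_measure_itv /= lte_fin; case: ifPn => [_|].
  by rewrite -EFinD lee_fin distrC ger0_norm// subr_ge0.
by rewrite lee_fin.
Qed.

End layer_cake.

Section energy.
Context {R : realType} {n : nat}.
Local Notation rV := 'rV[R]_n.+1.
Local Notation leb := (@lebesgue_rV R n.+1).
Local Notation leb2 := (leb \x leb)%E.
Variables (s : R) (Omega : set rV).
Hypothesis oO : open Omega.

Definition energy (u : rV -> R) : \bar R :=
  (\int[leb2]_(p in crossQ Omega) (`|u p.1 - u p.2| * frac_kernel s p)%:E)%E.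

Lemma s_perimeterE (E : set rV) : s_perimeter s E Omega = (2^-1%:E * energy \1_E)%E.
Proof. by []. Qed.

Lemma energy_ge0 u : (0 <= energy u)%E.
Proof. by apply: integral_ge0 => p _; rewrite lee_fin mulr_ge0 ?frac_kernel_ge0. Qed.

Lemma s_perimeter_lty (E : set rV) :
  (s_perimeter s E Omega < +oo)%E <-> (energy \1_E < +oo)%E.
Proof.
rewrite s_perimeterE; split => [h|h]; last by rewrite lte_mul_pinfty// lee_fin.
have e2 : (2%:E * (2^-1%:E * energy \1_E) = energy \1_E)%E.
  by rewrite muleA -EFinM divff// mul1e.
by rewrite -e2 lte_mul_pinfty// ?lee_fin// mule_ge0 ?energy_ge0// lee_fin.
Qed.

Lemma s_perimeter_le (E F : set rV) :
  (s_perimeter s E Omega <= s_perimeter s F Omega)%E <->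
  (energy \1_E <= energy \1_F)%E.
Proof. by rewrite !s_perimeterE lee_pmul2l// ?fin_numE// lte_fin invr_gt0. Qed.

Lemma ae_eq_energy (u v : rV -> R) : {ae leb, forall x, u x = v x} ->
  energy u = energy v.
Proof.
move=> uv; apply: integral_ae_eq_fun.
have := ae_fst uv; have := ae_snd uv; apply: filterS2 => p -> -> //.
Qed.

Let mO : measurable Omega. Proof. exact: open_measurable_rV. Qed.

(** Coarea argument.  Let [v = \1_E + w].  For [0 < tau < 1] the set where
    [tau < v] coincides with [E] outside [Omega], because [v = \1_E] there, and
    so has at least the energy of [E].  Integrate in [tau], exchange the
    integrals, and apply [layer_cake_le] at each pair of points. *)
Lemma minimal_energy_le (E : set rV) (w : rV -> R) :
  Lmeasurable leb E -> s_minimal s E Omega -> measurable_fun setT w ->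
  (forall x, ~ Omega x -> w x = 0) ->
  (energy \1_E <= energy (fun x => \1_E x + w x)%R)%E.
Proof.
move=> mE [_ Emin] mw w0.
have [B [mB BE]] := Lmeasurable_indic_borel mE.
pose v x : R := \1_B x + w x.
have mv : measurable_fun setT v by apply: measurable_funD.
have -> : energy (fun x => \1_E x + w x) = energy v.
  by apply: ae_eq_energy; apply: filterS BE => x; rewrite /v => ->.
have mQ := measurable_crossQ oO.
pose I : set (measurableTypeR R) := `]0%R, 1%R[%classic.
have mI : measurable I by exact: measurable_itv.
pose st (tau : R) x : R := (tau < v x)%R%:R.
have layer tau : I tau -> (energy \1_E <= energy (st tau))%E.
  rewrite /I /= in_itv /= => /andP[tau0 tau1].
  pose F := ([set x | tau < v x] `&` Omega) `|` (E `\` Omega).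
  have -> : energy (st tau) = energy \1_F.
    apply: ae_eq_energy; apply: filterS BE => x BEx.
    rewrite /st indicE; congr (nat_of_bool _)%:R.
    apply/idP/idP; rewrite inE /F /=.
      move=> tv; have [Ox|nOx] := pselect (Omega x); first by left.
      right; split => //; move: tv; rewrite /v w0// addr0 BEx indicE.
      by case: (boolP (x \in E)) => [|_]; [rewrite inE|rewrite /= ltNge (ltW tau0)].
    move=> [[]|[Ex nOx]]; first by [].
    by rewrite /v w0// addr0 BEx indicE mem_set.
  apply/s_perimeter_le; apply: Emin.
    have mOL := Lmeasurable_of_measurable (mu := leb) mO.
    apply: (@measurableU _ (g_sigma_algebraType (completed_algebra_gen leb))).
      apply: Lmeasurable_of_measurable; apply: measurableI => //.
      exact: measurable_set_lt.
    exact: (@measurableD _ (g_sigma_algebraType (completed_algebra_gen leb))).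
  apply/seteqP; split => x.
    by move=> [[[_ Ox]|Ex] nOx].
  by move=> [Ex nOx]; split => //; right.
pose h (q : (rV * rV) * measurableTypeR R) : \bar R :=
  (`|st q.2 q.1.1 - st q.2 q.1.2| * frac_kernel s q.1 * \1_(crossQ Omega) q.1 * \1_I q.2)%:E.
have mst (g : rV * rV -> rV) : measurable_fun setT g ->
    measurable_fun setT (fun q : (rV * rV) * measurableTypeR R => st q.2 (g q.1)).
  move=> mg.
  have mA : measurable [set q : (rV * rV) * measurableTypeR R | q.2 < v (g q.1)].
    apply: (@measurable_set_lt _ _ R (fun q : (rV * rV) * measurableTypeR R => q.2)).
      exact: measurable_snd.
    by apply: (measurableT_comp mv); exact: (measurableT_comp mg measurable_fst).
  have := @measurable_indic _ _ R setT _ mA; apply: eq_measurable_fun => q _.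
  by rewrite indicE /st mem_setE.
have mst1 y : measurable_fun setT (fun tau : measurableTypeR R => st tau y).
  have := @measurable_indic _ (measurableTypeR R) R setT _ (measurable_itv `]-oo, v y[).
  by apply: eq_measurable_fun => tau _; rewrite indicE /st mem_setE in_itv.
have mh : measurable_fun setT h.
  apply/measurable_EFinP; apply: measurable_funM; first apply: measurable_funM.
  - apply: measurable_funM.
      apply: measurableT_comp => //; apply: measurable_funB.
        exact: (mst fst measurable_fst).
      exact: (mst snd measurable_snd).
    exact: (measurableT_comp (measurable_frac_kernel s) measurable_fst).
  - by apply: (measurableT_comp _ measurable_fst); exact: measurable_indic.
  - by apply: (measurableT_comp _ measurable_snd); exact: measurable_indic.
have h0 q : (0 <= h q)%E.
  by rewrite lee_fin !mulr_ge0 ?frac_kernel_ge0// indicE ler0n.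
have := fubini_tonelli (m1 := square_measure leb) (m2 := @lebesgue_measure R) h mh h0.
set lhs := (X in X = _); set rhs := (X in _ = X) => tonelli.
apply: (@le_trans _ _ rhs); last first.
  rewrite -tonelli /lhs /energy [leRHS]integral_mkcond.
  apply: ge0_le_integral => //.
  - by move=> p _; apply: integral_ge0.
  - exact: measurable_fun_fubini_tonelli_F.
  - apply/(measurable_restrictT _ mQ).
    by apply: measurable_funTS; exact: measurable_oscillation.
  move=> p _; rewrite patchE /h /=; have [Qp|nQp] := pselect (crossQ Omega p); last first.
    rewrite memNset// integral0_eq// => tau _.
    by rewrite indicE memNset// mulr0 mul0r.
  rewrite mem_set// indicE mem_set//.
  rewrite (eq_integral ((fun tau => (frac_kernel s p)%:E * `|st tau p.1 - st tau p.2|%:E)%E \_ I)); last first.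
    move=> tau _; rewrite patchE indicE; case: (_ \in I) => /=.
      by rewrite !mulr1 mulrC EFinM.
    by rewrite mulr0.
  rewrite -integral_mkcond ge0_integralZl//; last 2 first.
  - apply/measurable_EFinP/measurable_funTS; apply: measurableT_comp => //.
    exact: measurable_funB.
  - by rewrite lee_fin frac_kernel_ge0.
  rewrite mulrC EFinM; apply: lee_wpmul2l; first by rewrite lee_fin frac_kernel_ge0.
  exact: layer_cake_le.
apply: (@le_trans _ _ (\int[@lebesgue_measure R]_(tau in I) energy \1_E)%E).
  rewrite integral_cst//= lebesgue_measure_itv /= lte_fin ltr01.
  by rewrite -EFinD subr0 mule1.
rewrite integral_mkcond /rhs; apply: ge0_le_integral => //.
- by move=> tau _; rewrite patchE; case: ifP => // _; exact: energy_ge0.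
- apply/(measurable_restrictT _ mI); exact: measurable_cst.
- exact: measurable_fun_fubini_tonelli_G.
move=> tau _; rewrite patchE /fubini_G; have [It|nIt] := pselect (I tau); last first.
  by rewrite memNset//; apply: integral_ge0.
rewrite mem_set//; apply: (le_trans (layer tau It)).
rewrite /energy integral_mkcond le_eqVlt; apply/orP; left; apply/eqP.
apply: eq_integral => p _; rewrite patchE /h /= !indicE (mem_set It).
by rewrite mulr1; case: (p \in crossQ Omega); rewrite ?mulr1 ?mulr0.
Qed.

End energy.

(** * Weak solutions and minimality *)

Section Lnorm_infty.
Context d (T : measurableType d) (R : realType).
Variable mu : {measure set T -> \bar R}.

Lemma Lnorm_infty_le1 (f : T -> R) :
  (Lnorm mu +oo (EFin \o f) <= 1)%E <-> {ae mu, forall x, `|f x| <= 1}.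
Proof.
rewrite unlock; case: ifPn => [_|].
  split=> [/ess_supP|h]; first by apply: filterS => x; rewrite /= lee_fin.
  by apply/ess_supP; apply: filterS h => x; rewrite /= lee_fin.
rewrite -leNgt measure_le0 => /eqP mu0; split=> // _.
by exists setT; split.
Qed.

End Lnorm_infty.

Section flow.
Context {R : realType} {n : nat}.
Local Notation rV := 'rV[R]_n.+1.
Local Notation leb := (@lebesgue_rV R n.+1).
Local Notation leb2 := (leb \x leb)%E.
Variables (s : R) (Omega : set rV).
Hypothesis oO : open Omega.

Let mQ : measurable (crossQ Omega). Proof. exact: measurable_crossQ. Qed.

(** The difference quotients of [u], weighted by the kernel and restricted to
    [Q]: the energy of [u] is the [L^1] norm of its flow, and [flow u] is linear
    in [u], which turns the variational problem into one about [L^1]. *)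
Definition flow (u : rV -> R) (p : rV * rV) : R :=
  (u p.1 - u p.2) * frac_kernel s p * \1_(crossQ Omega) p.

Lemma measurable_flow u : measurable_fun setT u -> measurable_fun setT (flow u).
Proof.
move=> mu; apply: measurable_funM; last exact: measurable_indic.
apply: measurable_funM; last exact: measurable_frac_kernel.
apply: measurable_funB.
  exact: (measurableT_comp mu measurable_fst).
exact: (measurableT_comp mu measurable_snd).
Qed.

Lemma energy_flow u : energy s Omega u = (\int[leb2]_p `|flow u p|%:E)%E.
Proof.
rewrite /energy integral_mkcond; apply: eq_integral => p _.
rewrite patchE /flow indicE normrM normrM [`|frac_kernel _ _|]ger0_norm ?frac_kernel_ge0//.
by case: (_ \in _); rewrite ?normr1 ?normr0 ?mulr1 ?mulr0.
Qed.

Lemma integrable_flow u : measurable_fun setT u ->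
  (energy s Omega u < +oo)%E -> integrable_real leb2 (flow u).
Proof.
move=> mu; rewrite energy_flow => h; apply/integrableP; split => //.
by apply/measurable_EFinP; exact: measurable_flow.
Qed.

Lemma integral_flow z u :
  (\int[leb2]_(p in crossQ Omega) (z p * frac_kernel s p * (u p.1 - u p.2))%:E =
   \int[leb2]_p (z p * flow u p)%:E)%E.
Proof.
rewrite integral_mkcond; apply: eq_integral => p _.
rewrite patchE /flow indicE; case: (_ \in _); last by rewrite !mulr0.
by congr EFin; rewrite mulr1; ring.
Qed.

Lemma crossQ_swap p : crossQ Omega (p.2, p.1) <-> crossQ Omega p.
Proof. by case: p => x y; split => h [/= h1 h2]; apply: h. Qed.

Lemma flow_swap u p : flow u (p.2, p.1) = - flow u p.
Proof.
rewrite /flow /= frac_kernel_swap !indicE.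
have -> : ((p.2, p.1) \in crossQ Omega) = (p \in crossQ Omega).
  by apply/idP/idP; rewrite !inE => /crossQ_swap.
by ring.
Qed.

Lemma flowD a u v : flow (fun x => a * u x + v x) = fun p => a * flow u p + flow v p.
Proof. by apply/funext => p; rewrite /flow; ring. Qed.

Lemma flow_eq u p : crossQ Omega p -> flow u p = (u p.1 - u p.2) * frac_kernel s p.
Proof. by move=> Qp; rewrite /flow indicE mem_set// mulr1. Qed.

Lemma flow0 p : flow (fun=> 0) p = 0.
Proof. by rewrite /flow subrr !mul0r. Qed.

Lemma flow_out u p : ~ crossQ Omega p -> flow u p = 0.
Proof. by move=> nQp; rewrite /flow indicE memNset// mulr0. Qed.

End flow.

Lemma bounded_lebesgue_lty {R : realType} {n : nat} (A : set 'rV[R]_n.+1) :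
  measurable A -> bounded_set A -> (lebesgue_rV n.+1 A < +oo)%E.
Proof.
move=> mA /pinfty_ex_gt0[M M0 AM].
apply: (@le_lt_trans _ _ (lebesgue_rV n.+1 (ball 0 (M + 1)))).
  apply: le_measure; rewrite ?inE//; first exact: measurable_ball_rV.
  by move=> x /AM /= h; rewrite -ball_normE /= sub0r normrN ltr_pwDr.
by rewrite lebesgue_rV_ball ?ltry// addr_gt0.
Qed.

Section weak_minimal.
Context {R : realType} {n : nat}.
Local Notation rV := 'rV[R]_n.+1.
Local Notation leb := (@lebesgue_rV R n.+1).
Local Notation leb2 := (leb \x leb)%E.
Variables (s : R) (Omega : set rV) (E : set rV).
Hypotheses (oO : open Omega) (bO : bounded_set Omega).
Hypothesis mE : Lmeasurable leb E.
Hypothesis finE : (s_perimeter s E Omega < +oo)%E.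

Let mO : measurable Omega. Proof. exact: open_measurable_rV. Qed.
Let mQ : measurable (crossQ Omega). Proof. exact: measurable_crossQ. Qed.

(** The difference of two sets of finite perimeter that agree outside the domain
    is an admissible test function; its integrability over [Omega] uses that the
    domain is bounded. *)
Lemma indic_diff_W0s1 (F : set rV) : Lmeasurable leb F ->
  F `\` Omega = E `\` Omega -> (energy s Omega \1_F < +oo)%E ->
  W0s1 s Omega (fun x => \1_F x - \1_E x).
Proof.
move=> mF FE finF; have /s_perimeter_lty finE' := finE.
have [B [mB BE]] := Lmeasurable_indic_borel mE.
have [C [mC CF]] := Lmeasurable_indic_borel mF.
pose w x : R := \1_C x - \1_B x.
have mw : measurable_fun setT w by apply: measurable_funB.
have wE : {ae leb, forall x, \1_F x - \1_E x = w x}.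
  by move: BE CF; apply: filterS2 => x; rewrite /w => -> ->.
split.
- have iF := Lmeasurable_indic mF; have iE := Lmeasurable_indic mE.
  exact: (@measurable_funB _ (g_sigma_algebraType (completed_algebra_gen leb))).
- apply: aeW => x /= nOx; rewrite !indicE.
  suff -> : (x \in F) = (x \in E) by rewrite subrr.
  have h : (F `\` Omega) x = (E `\` Omega) x by rewrite FE.
  apply/idP/idP; rewrite !inE => Hx.
    by have [] : (E `\` Omega) x by rewrite -h.
  by have [] : (F `\` Omega) x by rewrite h.
- rewrite (@integral_ae_eq_fun _ _ _ leb Omega _ (fun x => `|w x|%:E)); last first.
    by apply: filterS wE => x -> _.
  apply: (@le_lt_trans _ _ (\int[leb]_(x in Omega) 1)%E).
    apply: ge0_le_integral => //.
      by apply/measurable_EFinP/measurable_funTS; exact: measurableT_comp.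
    move=> x _; rewrite lee_fin /w !indicE.
    by case: (_ \in _); case: (_ \in _); rewrite ?subrr ?normr0 ?subr0 ?normr1 ?sub0r ?normrN ?normr1.
  rewrite integral_cst// mul1e; exact: bounded_lebesgue_lty.
- have wI : {ae leb2, forall p, (Omega `*` Omega) p ->
      (`|(\1_F p.1 - \1_E p.1) - (\1_F p.2 - \1_E p.2)| * frac_kernel s p)%:E =
      (`|w p.1 - w p.2| * frac_kernel s p)%:E}.
    have := ae_fst wE; have := ae_snd wE; apply: filterS2 => p -> ->//.
  rewrite (integral_ae_eq_fun wI).
  have mOO : measurable (Omega `*` Omega) by exact: measurableX.
  have mIB : measurable_fun setT (\1_B : rV -> R) by exact: measurable_indic.
  have mIC : measurable_fun setT (\1_C : rV -> R) by exact: measurable_indic.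
  have K0 (v : rV -> R) p : (0 <= (`|v p.1 - v p.2| * frac_kernel s p)%:E)%E.
    by rewrite lee_fin mulr_ge0 ?frac_kernel_ge0.
  apply: (@le_lt_trans _ _ (energy s Omega \1_C + energy s Omega \1_B)%E); last first.
    by rewrite (ae_eq_energy s Omega CF) (ae_eq_energy s Omega BE) lte_add_pinfty.
  rewrite /energy -ge0_integralD//; last 2 first.
  - by apply: measurable_funTS; exact: measurable_oscillation.
  - by apply: measurable_funTS; exact: measurable_oscillation.
  apply: (@le_trans _ _ (\int[leb2]_(p in crossQ Omega)
      (`|w p.1 - w p.2| * frac_kernel s p)%:E)%E).
    apply: ge0_subset_integral => //.
    - by apply: measurable_funTS; exact: measurable_oscillation.
    - by move=> [x y] [/= Ox Oy] [].
  apply: ge0_le_integral => //.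
  - by apply: measurable_funTS; exact: measurable_oscillation.
  - by apply: measurable_funTS; apply: emeasurable_funD; exact: measurable_oscillation.
  move=> p _; rewrite -EFinD lee_fin -mulrDl ler_wpM2r ?frac_kernel_ge0//.
  rewrite /w (_ : _ - _ - _ = (\1_C p.1 - \1_C p.2) - (\1_B p.1 - \1_B p.2)).
    exact: ler_normB.
  by ring.
Qed.

(** Testing with [\1_F - \1_E], the integrals of [z * flow \1_E] and
    [z * flow \1_F] are equal.  The former is the energy of [E], and the latter
    is at most the energy of [F] since [`|z| <= 1]. *)
Lemma weak_solution_s_minimal :
  frac_one_laplace_weak_solution s Omega (\1_E : rV -> R) -> s_minimal s E Omega.
Proof.
move=> [_ [z [mz /Lnorm_infty_le1 z1 _ ztest zE]]]; split => // F mF FE.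
apply/s_perimeter_le.
have [finF|] := ltP (energy s Omega \1_F) +oo%E; last first.
  by rewrite leye_eq => /eqP ->; exact: leey.
have /s_perimeter_lty finE' := finE.
have [B [mB BE]] := Lmeasurable_indic_borel mE.
have [C [mC CF]] := Lmeasurable_indic_borel mF.
have [z' [mz' z'E]] := Lmeasurable_fun_borel mQ mz.
(* A Borel representative of [z], truncated so as to be bounded by [1]
   everywhere. *)
pose y p : R := Num.max (-1) (Num.min 1 (z' p)).
have my : measurable_fun setT y.
  by apply: measurable_maxr => //; exact: measurable_minr.
have y1 p : `|y p| <= 1.
  by rewrite ler_norml /y le_max lexx /= ge_max ge_min lexx /= andbT; lra.
have yz : {ae leb2, forall p, crossQ Omega p -> y p = z p}.
  move: z1 z'E; apply: filterS2 => p + h Qp.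
  rewrite patchE mem_set// /y h// ler_norml => /andP[h1 h2].
  by rewrite min_r// max_r.
have mIB : measurable_fun setT (\1_B : rV -> R) by exact: measurable_indic.
have mIC : measurable_fun setT (\1_C : rV -> R) by exact: measurable_indic.
have IB : integrable_real leb2 (flow s Omega \1_B).
  by apply: integrable_flow => //; rewrite (ae_eq_energy s Omega BE).
have IC : integrable_real leb2 (flow s Omega \1_C).
  by apply: integrable_flow => //; rewrite (ae_eq_energy s Omega CF).
have [Iy _] := L1_contraction_mul leb2 my y1.
have := etrans (esym (integral_flow s Omega z (fun x => \1_F x - \1_E x)))
  (ztest _ (indic_diff_W0s1 mF FE finF)).
rewrite (_ : (\int[leb2]_p _)%E =
    (\int[leb2]_p ((y p * flow s Omega \1_C p)%:E - (y p * flow s Omega \1_B p)%:E))%E); last first.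
  apply: integral_ae_eq_fun.
  apply: filterS3 yz (ae_fst (filterI BE CF)) (ae_snd (filterI BE CF)) => p h [B1 C1] [B2 C2] _.
  have [Qp|nQp] := pselect (crossQ Omega p); last first.
    by rewrite !flow_out// !mulr0 subee.
  rewrite -EFinB; congr EFin.
  by rewrite !flow_eq// B1 B2 C1 C2 h//; ring.
rewrite integralB_EFin//; last 2 first.
- exact: (Iy _ IC).
- exact: (Iy _ IB).
move=> yCB.
have fC : (\int[leb2]_p (y p * flow s Omega \1_C p)%:E)%E \is a fin_num.
  by apply: integrable_fin_num => //; exact: (Iy _ IC).
have fB : (\int[leb2]_p (y p * flow s Omega \1_B p)%:E)%E \is a fin_num.
  by apply: integrable_fin_num => //; exact: (Iy _ IB).
rewrite -(ae_eq_energy s Omega BE) -(ae_eq_energy s Omega CF) !energy_flow.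
have -> : (\int[leb2]_p `|flow s Omega \1_B p|%:E =
    \int[leb2]_p (y p * flow s Omega \1_B p)%:E)%E.
  apply: integral_ae_eq_fun.
  apply: filterS3 (filterI yz zE) (ae_fst BE) (ae_snd BE) => p [h1 h2] B1 B2 _.
  have [Qp|nQp] := pselect (crossQ Omega p); last first.
    by rewrite !flow_out// !mulr0 normr0.
  rewrite flow_eq// B1 B2 h1// mulrA h2// normrM [`|frac_kernel _ _|]ger0_norm//.
  exact: frac_kernel_ge0.
have -> : (\int[leb2]_p (y p * flow s Omega \1_B p)%:E =
           \int[leb2]_p (y p * flow s Omega \1_C p)%:E)%E.
  move: yCB; rewrite -(fineK fB) -(fineK fC) -EFinB => -[/eqP].
  by rewrite subr_eq0 => /eqP ->.
apply: le_integral => //; first exact: (Iy _ IC).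
  exact: (integrable_abse IC).
move=> p _; rewrite lee_fin (le_trans (ler_norm _))// normrM ler_piMl//.
Qed.

End weak_minimal.

(** * Existence of a calibration *)

Section minimal_weak.
Context {R : realType} {n : nat}.
Local Notation rV := 'rV[R]_n.+1.
Local Notation leb := (@lebesgue_rV R n.+1).
Local Notation leb2 := (leb \x leb)%E.
Variables (s : R) (Omega : set rV) (E : set rV).
Hypotheses (s01 : 0 < s < 1) (oO : open Omega) (bO : bounded_set Omega).
Hypothesis lO : lipschitz_boundary Omega.
Hypothesis mE : Lmeasurable leb E.

Let mO : measurable Omega. Proof. exact: open_measurable_rV. Qed.
Let mQ : measurable (crossQ Omega). Proof. exact: measurable_crossQ. Qed.

Local Notation flowQ := (flow s Omega).
Local Notation energyQ := (energy s Omega).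

Lemma energy_scale (a : R) (u : rV -> R) : measurable_fun setT u ->
  (energyQ (fun x => a * u x)%R = `|a|%:E * energyQ u)%E.
Proof.
move=> mu; rewrite -ge0_integralZl//; last 2 first.
- by apply: measurable_funTS; exact: measurable_oscillation.
- by move=> p _; rewrite lee_fin mulr_ge0 ?frac_kernel_ge0.
by apply: eq_integral => p _; rewrite -EFinM mulrA -normrM mulrBr.
Qed.

(** Borel representatives of the elements of [W0s1], with the integrability
    over the whole of [Q] that [W0s1_test] derives. *)
Definition test (w : rV -> R) : Prop :=
  [/\ measurable_fun setT w, forall x, ~ Omega x -> w x = 0 &
      integrable_real leb2 (flowQ w)].

Lemma testD a w w' : test w -> test w' -> test (fun x => a * w x + w' x).
Proof.
move=> [mw w0 Iw] [mw' w'0 Iw']; split.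
- by apply: measurable_funD => //; exact: measurable_funM.
- by move=> x nOx; rewrite w0// w'0// mulr0 addr0.
- by rewrite flowD; exact: integrable_realD.
Qed.

Lemma test0 : test (fun=> 0).
Proof.
split => //; rewrite (_ : flowQ _ = fun=> 0); first exact: integrable_real0.
by apply/funext => p; exact: flow0.
Qed.

(** That the flow is integrable on all of [Q], and not only on
    [Omega * Omega], is the fractional Hardy inequality. *)
Lemma W0s1_test w : W0s1 s Omega w ->
  exists2 v, test v & {ae leb, forall x, v x = w x}.
Proof.
move=> [mw w0 Iw Iww].
have [g [mg gw]] := Lmeasurable_fun_borel measurableT mw.
pose v x : R := g x * \1_Omega x.
have mv : measurable_fun setT v by exact: measurable_funM.
have vw : {ae leb, forall x, v x = w x}.
  move: w0 gw; apply: filterS2 => x h1 h2; rewrite /v indicE h2//.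
  have [Ox|nOx] := pselect (Omega x); first by rewrite mem_set// mulr1.
  by rewrite memNset// mulr0 h1.
have v0 x : ~ Omega x -> v x = 0 by move=> nOx; rewrite /v indicE memNset// mulr0.
exists v => //; split => //; apply: integrable_flow => //.
apply: fractional_hardy => //.
- rewrite (@integral_ae_eq_fun _ _ _ leb Omega _ (fun x => `|w x|%:E))//.
  by apply: filterS vw => x ->.
- have wI : {ae leb2, forall p, (Omega `*` Omega) p ->
      (`|v p.1 - v p.2| * frac_kernel s p)%:E =
      (`|w p.1 - w p.2| * frac_kernel s p)%:E}.
    by have := ae_fst vw; have := ae_snd vw; apply: filterS2 => p -> ->.
  by rewrite (integral_ae_eq_fun wI).
Qed.

Section calibration.
Hypothesis Emin : s_minimal s E Omega.
Variable u : rV -> R.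
Hypotheses (mu : measurable_fun setT u) (uE : {ae leb, forall x, u x = \1_E x}).

Let Ju : (energyQ u < +oo)%E.
Proof. by rewrite (ae_eq_energy s Omega uE); apply/s_perimeter_lty; case: Emin. Qed.

Let Iu : integrable_real leb2 (flowQ u).
Proof. exact: integrable_flow. Qed.

Definition L1norm (f : rV * rV -> R) : R := fine (\int[leb2]_p `|f p|%:E)%E.

Let L1normE f : integrable_real leb2 f -> (L1norm f)%:E = (\int[leb2]_p `|f p|%:E)%E.
Proof.
by move=> If; rewrite fineK//; apply: integrable_fin_num => //; exact: integrable_norm.
Qed.

Let measurable_norm (f : rV * rV -> R) : integrable_real leb2 f ->
  measurable_fun setT (fun p => `|f p|%:E).
Proof.
move=> /integrableP[/measurable_EFinP mf _].
by apply/measurable_EFinP; exact: measurableT_comp.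
Qed.

Lemma L1normD (f g : rV * rV -> R) : integrable_real leb2 f ->
  integrable_real leb2 g -> L1norm (fun p => f p + g p) <= L1norm f + L1norm g.
Proof.
move=> If Ig; have Ifg := integrable_real_add If Ig.
rewrite -lee_fin EFinD !L1normE// -ge0_integralD//; last 2 first.
- exact: measurable_norm.
- exact: measurable_norm.
apply: ge0_le_integral => //.
- exact: measurable_norm.
- by apply: emeasurable_funD; exact: measurable_norm.
by move=> p _; rewrite -EFinD lee_fin ler_normD.
Qed.

Lemma L1normZ (a : R) (f : rV * rV -> R) : 0 <= a -> integrable_real leb2 f ->
  L1norm (fun p => a * f p) = a * L1norm f.
Proof.
move=> a0 If; apply: EFin_inj; rewrite EFinM !L1normE//; last exact: integrable_realZ.
rewrite -ge0_integralZl//; last exact: measurable_norm.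
by apply: eq_integral => p _; rewrite -EFinM normrM ger0_norm.
Qed.

Lemma energy_le_test w : test w -> (energyQ u <= energyQ (fun x => u x + w x)%R)%E.
Proof.
move=> [mw w0 _]; rewrite (ae_eq_energy s Omega uE).
apply: (le_trans (minimal_energy_le oO mE Emin mw w0)).
rewrite (@ae_eq_energy _ _ s Omega (fun x => u x + w x) (fun x => \1_E x + w x))//.
by apply: filterS uE => x ->.
Qed.

Let V := (rV * rV -> R^o)%type.

(** The functional to be extended: it takes the value [t] times the energy of
    [u] at the flow of [t * u + w], for every test function [w]. *)
Definition calibration_graph : set (V * R) :=
  [set q | exists t w, [/\ test w, q.1 = (fun p => t * flowQ u p + flowQ w p) :> V &
     q.2 = t * L1norm (flowQ u)]].

(** For [t > 0], domination by the [L^1] norm is minimality: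
    the energy of [u + w / t] is at least that of [u]. *)
Lemma calibration_graph_dominated :
  dominated_graph (integrable_real leb2 : set V) L1norm calibration_graph.
Proof.
split.
- exists 0, (fun=> 0); split; [exact: test0| |by rewrite mul0r].
  by apply/funext => p /=; rewrite flow0 mul0r addr0.
- move=> _ _ [t [w [tw /= -> ->]]]; have [mw w0 Iw] := tw.
  have It : integrable_real leb2 (fun p => t * flowQ u p + flowQ w p).
    exact: integrable_realD.
  split=> //.
  have [t0|t0] := leP t 0.
    apply: (@le_trans _ _ 0); last by rewrite fine_ge0// integral_ge0.
    by rewrite mulr_le0_ge0// fine_ge0// integral_ge0.
  rewrite -lee_fin L1normE// EFinM L1normE// -energy_flow.
  have tw' : test (fun x => t^-1 * w x).
    have := testD t^-1 tw test0; congr test.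
    by apply/funext => x; rewrite addr0.
  rewrite (_ : (\int[leb2]_p _)%E = energyQ (fun x => t * (u x + t^-1 * w x))).
    rewrite energy_scale ?gtr0_norm//; last first.
      by apply: measurable_funD => //; exact: measurable_funM.
    apply: lee_wpmul2l; first by rewrite lee_fin ltW.
    exact: energy_le_test.
  have -> : (fun x => t * (u x + t^-1 * w x)) = (fun x => t * u x + w x).
    by apply/funext => x; rewrite mulrDr mulrA divff ?gt_eqF// mul1r.
  by rewrite energy_flow flowD.
- move=> a _ _ _ _ [t [w [tw /= -> ->]]] [t' [w' [tw' /= -> ->]]].
  exists (a * t + t'), (fun x => a * w x + w' x); split => /=.
  + exact: testD.
  + by rewrite flowD; apply/funext => p; rewrite !fctE /= /GRing.scale /=; ring.
  + by ring.
Qed.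

(** The Hahn-Banach extension of [calibration_graph] is an [L^1] contraction;
    represented by a function, it takes the value of the energy at the flow of
    [u] and vanishes at the flow of each test function. *)
Lemma exists_calibration : exists z : rV * rV -> R,
  [/\ measurable_fun setT z, forall p, `|z p| <= 1,
      (\int[leb2]_p (z p * flowQ u p)%:E = \int[leb2]_p `|flowQ u p|%:E)%E &
      forall w, test w -> (\int[leb2]_p (z p * flowQ w p)%:E = 0)%E].
Proof.
have [|||l [lG lp lD]] := @hahn_banach R V (integrable_real leb2 : set V) L1norm
  _ _ _ _ calibration_graph_dominated.
- by move=> a f g; exact: integrable_realD.
- by move=> f g; exact: L1normD.
- by move=> a f; exact: L1normZ.
have lL1 : L1_contraction leb2 l.
  split; first by move=> a f g If Ig; rewrite -lD.
  by move=> f If; rewrite -L1normE// lee_fin; exact: lp.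
have [z [mz z1 zl]] := L1_dual (mu := square_measure leb) lL1.
have [Iz _] := L1_contraction_mul leb2 mz z1.
exists z; split => //.
- have := zl _ Iu; rewrite (lG _ (L1norm (flowQ u))); last first.
    exists 1, (fun=> 0); split; [exact: test0| |by rewrite mul1r].
    by apply/funext => p /=; rewrite flow0 mul1r addr0.
  move=> h; rewrite -[RHS]L1normE// h fineK//.
  by apply: integrable_fin_num => //; exact: (Iz _ Iu).
- move=> w tw; have [_ _ Iw] := tw; have := zl _ Iw; rewrite (lG _ 0); last first.
    exists 0, w; split => //; last by rewrite mul0r.
    by apply/funext => p /=; rewrite mul0r add0r.
  move=> h; rewrite [RHS](congr1 EFin h) fineK//.
  by apply: integrable_fin_num => //; exact: (Iz _ Iw).
Qed.

End calibration.

(** [z * flow u <= `|flow u|] pointwise and the integrals are equal, so equality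
    holds almost everywhere; then divide by the kernel, positive off the
    diagonal. *)
Lemma calibration_ae (u : rV -> R) (z : rV * rV -> R) :
  measurable_fun setT z -> (forall p, `|z p| <= 1) -> integrable_real leb2 (flowQ u) ->
  (\int[leb2]_p (z p * flowQ u p)%:E = \int[leb2]_p `|flowQ u p|%:E)%E ->
  {ae leb2, forall p, crossQ Omega p -> z p * (u p.1 - u p.2) = `|u p.1 - u p.2|}.
Proof.
move=> mz z1 Iu zu; have [Iz _] := L1_contraction_mul leb2 mz z1.
have Izu := Iz _ Iu.
have Iau : integrable_real leb2 (fun p => `|flowQ u p|) by exact: integrable_norm.
pose d p := `|flowQ u p| - z p * flowQ u p.
have d0 p : 0 <= d p.
  by rewrite subr_ge0 (le_trans (ler_norm _))// normrM ler_piMl.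
have Id : (\int[leb2]_p `|(d p)%:E| = 0)%E.
  rewrite (eq_integral (fun p => (`|flowQ u p|%:E - (z p * flowQ u p)%:E)%E)); last first.
    by move=> p _; rewrite gee0_abs ?lee_fin// -EFinB.
  rewrite integralB_EFin// zu subee//.
  exact: integrable_fin_num.
have md : measurable_fun setT (fun p => (d p)%:E).
  have /integrableP[/measurable_EFinP m1 _] := Iau.
  have /integrableP[/measurable_EFinP m2 _] := Izu.
  by apply/measurable_EFinP; exact: measurable_funB.
move/(ae_eq_integral_abs leb2 measurableT md) : Id.
apply: filterS => -[x y] /(_ I) [/eqP]; rewrite /d subr_eq0 => /eqP h Qp.
move: h; rewrite flow_eq//= normrM [`|frac_kernel _ _|]ger0_norm ?frac_kernel_ge0//.
have [->|xy] := eqVneq x y; first by rewrite subrr normr0 mulr0.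
rewrite mulrA => /mulIf -> //.
by rewrite gt_eqF// frac_kernel_gt0.
Qed.

(** The calibration [z] need not be antisymmetric, but flows are, so replacing
    [z] by its antisymmetric part preserves all its other properties. *)
Theorem s_minimal_weak_solution : s_minimal s E Omega ->
  frac_one_laplace_weak_solution s Omega (\1_E : rV -> R).
Proof.
move=> Emin; split; first exact: Lmeasurable_indic.
have [B [mB BE]] := Lmeasurable_indic_borel mE.
have mIB : measurable_fun setT (\1_B : rV -> R) by exact: measurable_indic.
have IB : integrable_real leb2 (flowQ \1_B).
  apply: integrable_flow => //; rewrite (ae_eq_energy s Omega BE).
  by apply/s_perimeter_lty; case: Emin.
have [z [mz z1 zB ztest]] := exists_calibration Emin mIB BE.
pose zs p := z (p.2, p.1).
have mzs : measurable_fun setT zs.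
  apply: (measurableT_comp mz); apply/measurable_fun_pairP.
  by split; [exact: measurable_snd|exact: measurable_fst].
have zs1 p : `|zs p| <= 1 by exact: z1.
pose y p : R := 2^-1 * (z p - zs p).
have my : measurable_fun setT y.
  by apply: measurable_funM => //; exact: measurable_funB.
have y1 p : `|y p| <= 1.
  have := z1 p; have := zs1 p; rewrite /y !ler_norml => /andP[h1 h2] /andP[h3 h4].
  by apply/andP; split; lra.
exists y; split.
- by apply: Lmeasurable_fun_of_measurable => //; exact: measurable_funTS.
- apply/Lnorm_infty_le1; apply: aeW => p; rewrite patchE.
  by case: ifP => // _; rewrite normr0.
- by apply: aeW => -[x x'] _; rewrite /y /zs /=; ring.
- move=> w /W0s1_test[v tv vw]; rewrite integral_flow.
  have [_ _ Iv] := tv; have [mv _ _] := tv.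
  have [Iz _] := L1_contraction_mul leb2 mz z1.
  have [Izs _] := L1_contraction_mul leb2 mzs zs1.
  pose g p := (z p * flowQ v p)%:E.
  have mg : measurable_fun setT g by have /integrableP[] := Iz _ Iv.
  have gs : (\int[leb2]_p g (p.2, p.1) = 0)%E.
    rewrite -[RHS](ztest _ tv); apply/esym.
    exact: (integral_swap leb measurableT mg).
  have Igs : leb2.-integrable setT (fun p => g (p.2, p.1)).
    have := integrable_realZ (-1) (Izs _ Iv); apply: eq_integrable => // p _.
    by rewrite /g flow_swap /=; congr EFin; rewrite /zs; ring.
  transitivity (\int[leb2]_p (2^-1%:E * g p + 2^-1%:E * g (p.2, p.1)))%E.
    apply: integral_ae_eq_fun.
    have := ae_fst vw; have := ae_snd vw; apply: filterS2 => p v2 v1 _.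
    rewrite /g flow_swap -!EFinM -EFinD; congr EFin.
    by rewrite /flow v1 v2 /y /zs; ring.
  rewrite integralD//; last 2 first.
  + exact: integrableZl (Iz _ Iv).
  + exact: integrableZl.
  by rewrite !integralZl//; [rewrite gs ztest// !mule0 adde0|exact: (Iz _ Iv)].
have cal := calibration_ae mz z1 IB zB.
have cal' := ae_swap cal.
have BE2 : {ae leb2, forall p, (\1_B p.1 = \1_E p.1 :> R) /\ (\1_B p.2 = \1_E p.2 :> R)}.
  by have := ae_fst BE; have := ae_snd BE; apply: filterS2 => p b2 b1; split.
move: cal cal' BE2; apply: filterS3 => -[x x'] h1 h2 [B1 B2] Qp.
move: (h1 Qp) (h2 (iffRL (crossQ_swap Omega (x, x')) Qp)).
rewrite /= B1 B2 /y /zs /=; set a : R := \1_E x; set b : R := \1_E x' => e1 e2.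
have -> : 2^-1 * (z (x, x') - z (x', x)) * (a - b) =
    2^-1 * (z (x, x') * (a - b) + z (x', x) * (b - a)) by ring.
by rewrite e1 e2 [`|b - a|]distrC; field.
Qed.

End minimal_weak.

Theorem corollary1p12 (R : realType) (n : nat) (Omega : set 'rV[R]_n.+1)
    (s : R) (E : set 'rV[R]_n.+1)
    (Omega_open : open Omega) (Omega_bounded : bounded_set Omega)
    (Omega_lipschitz : lipschitz_boundary Omega)
    (s01 : 0 < s < 1)
    (mE : Lmeasurable (lebesgue_rV n.+1) E)
    (finE : (s_perimeter s E Omega < +oo)%E) :
  s_minimal s E Omega <->
  frac_one_laplace_weak_solution s Omega (\1_E : 'rV[R]_n.+1 -> R).
Proof.
split; first exact: s_minimal_weak_solution.
exact: weak_solution_s_minimal.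
Qed.
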